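(* Let $a$ be a nonnegative measurable function on $\mathbb{R}_+$ with $a\in L_{\infty,loc}([0,\infty))$, and let $b$ be a nonnegative measurable function on $\mathbb{R}_+^2$ such that for a.e. $y>0$, $\int_0^y x\, b(x,y)\,\mathrm{d}x = y$ and $b(x,y)=0$ for a.e. $x>y$. Assume there are $l\ge0$, $b_0\ge0$ with $\int_0^x b(y,x)\,\mathrm{d}y\le b_0(1+x^l)$ for all $x\ge0$, and that $\liminf_{y\to\infty}N_{m_0}(y)/y^{m_0}>0$ for some $m_0>1$. Let $m>\max\{1,l\}$. Let $k$ be a measurable symmetric function on $\mathbb{R}_+^2$ such that for some $K>0$ and $0<\alpha<1$, $$0\le k(x,y)\le K(1+a(x))^\alpha(1+a(y))^\alpha,\quad (x,y)\in\mathbb{R}_+^2.$$ Then for each nonnegative $f^{in}\in X^{\alpha}_{0,m}$ there is $\tau(f^{in})>0$ such that the problem $$\partial_t f=A_{0,m}f+B_{0,m}f+C_{0,m}f,\qquad f(0)=f^{in},$$ has a unique nonnegative classical solution $$f\in C([0,\tau(f^{in})),X^\alpha_{0,m})\cap C^1((0,\tau(f^{in})),X^\alpha_{0,m})\cap C((0,\tau(f^{in})),D(A_{0,m})).$$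
   Context: $N_m(y)=y^m-\int_0^y b(x,y)x^m\,\mathrm{d}x$. $w_m(x)=1+x^m$, $X_{0,m}=L_1(\mathbb{R}_+,w_m(x)\,\mathrm{d}x)$. $A_{0,m}f=-af$ on $D(A_{0,m})=\{f\in X_{0,m}: af\in X_{0,m}\}$; $B_{0,m}$ is the restriction to $D(A_{0,m})$ of $(\mathcal{B}f)(x)=\int_x^\infty a(y)b(x,y)f(y)\,\mathrm{d}y$; $F_{0,m}=A_{0,m}+B_{0,m}$ generates an analytic semigroup on $X_{0,m}$. $C_{0,m}$ is the operator $\mathcal{C}f(x)=\frac12\int_0^x k(x-y,y)f(x-y)f(y)\,\mathrm{d}y-\int_0^\infty k(x,y)f(y)f(x)\,\mathrm{d}y$ on its maximal domain $\{f\in X_{0,m}:\mathcal{C}f\in X_{0,m}\}$. For a fixed $\omega>1$ larger than the type of the semigroup generated by $F_{0,m}$, $X^\alpha_{0,m}=\{f\in X_{0,m}:\int_0^\infty|f(x)|(\omega+a(x))^\alpha w_m(x)\,\mathrm{d}x<\infty\}$ with the natural norm $\|f\|^{(\alpha)}_{[0,m]}=\int_0^\infty|f(x)|(\omega+a(x))^\alpha w_m(x)\,\mathrm{d}x$. *)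

(* Defs.v *)
From HB Require Import structures.
From mathcomp Require Import all_boot all_order all_algebra.
From mathcomp Require Import all_classical all_reals all_analysis.
Set Implicit Arguments. Unset Strict Implicit. Unset Printing Implicit Defensive.
Import Order.TTheory GRing.Theory Num.Theory.
Import numFieldNormedType.Exports.
Local Open Scope classical_set_scope.
Local Open Scope ring_scope.

Section Defs.
Context {R : realType}.
Local Notation mu := (@lebesgue_measure R).

Definition Rp : set R := `[0%R, +oo[%classic.

Definition liminf_pinfty (g : R -> R) : \bar R :=
  ereal_sup [set ereal_inf [set (g y)%:E | y in `]Y, +oo[%classic] | Y in [set: R]].

Definition Nm (b : R -> R -> R) (m y : R) : R :=
  y `^ m - fine (\int[mu]_(x in `[0%R, y]) (b x y * x `^ m)%:E)%E.

Definition wm (m x : R) : R := 1 + x `^ m.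

Definition wint (rho h : R -> R) : \bar R :=
  (\int[mu]_(x in Rp) (`|h x| * rho x)%:E)%E.

Definition inL1w (rho h : R -> R) : Prop :=
  measurable_fun Rp h /\ (wint rho h < +oo)%E.

Definition X0 (m : R) (h : R -> R) : Prop := inL1w (wm m) h.

Definition walpha (a : R -> R) (om al m : R) : R -> R :=
  fun x => (om + a x) `^ al * wm m x.

Definition Xalpha (a : R -> R) (om al m : R) (h : R -> R) : Prop :=
  X0 m h /\ (wint (walpha a om al m) h < +oo)%E.

Definition DA (a : R -> R) (m : R) (h : R -> R) : Prop :=
  X0 m h /\ X0 m (fun x => a x * h x).

(** weight of the graph norm of A_{0,m}:  ||f|| + ||a f|| = int |f| (1+|a|) w_m *)
Definition wgraph (a : R -> R) (m : R) : R -> R :=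
  fun x => (1 + `|a x|) * wm m x.

Definition opB (a : R -> R) (b : R -> R -> R) (h : R -> R) : R -> R :=
  fun x => fine (\int[mu]_(y in `]x, +oo[) (a y * b x y * h y)%:E)%E.

Definition opC (k : R -> R -> R) (h : R -> R) : R -> R :=
  fun x => fine (\int[mu]_(y in `[0%R, x]) (k (x - y) y * h (x - y) * h y)%:E)%E / 2
         - fine (\int[mu]_(y in Rp) (k x y * h y * h x)%:E)%E.

Definition DC (k : R -> R -> R) (m : R) (h : R -> R) : Prop :=
  X0 m h /\
  {ae mu, forall x, Rp x ->
     mu.-integrable `[0%R, x] (fun y => (k (x - y) y * h (x - y) * h y)%:E) /\
     mu.-integrable Rp (fun y => (k x y * h y * h x)%:E)} /\
  X0 m (opC k h).

Definition wcont (rho : R -> R) (I : set R) (f : R -> R -> R) : Prop :=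
  forall t, I t -> forall e : R, 0 < e ->
    exists2 d : R, 0 < d & forall s, I s -> `|s - t| < d ->
      (wint rho (fun x => (f s x - f t x)%R) < e%:E)%E.

Definition wderiv (rho : R -> R) (I : set R) (f g : R -> R -> R) : Prop :=
  forall t, I t -> forall e : R, 0 < e ->
    exists2 d : R, 0 < d & forall s, I s -> s != t -> `|s - t| < d ->
      (wint rho (fun x => ((f s x - f t x) / (s - t) - g t x)%R) < e%:E)%E.

Definition classical_sol (a : R -> R) (b k : R -> R -> R) (om al m : R)
    (fin : R -> R) (tau : R) (f : R -> R -> R) : Prop :=
  (forall t, `[0%R, tau[%classic t -> Xalpha a om al m (f t)) /\
  wcont (walpha a om al m) `[0%R, tau[%classic f /\
  (exists g : R -> R -> R,
     (forall t, `]0%R, tau[%classic t -> Xalpha a om al m (g t)) /\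
     wderiv (walpha a om al m) `]0%R, tau[%classic f g /\
     wcont (walpha a om al m) `]0%R, tau[%classic g /\
     (forall t, `]0%R, tau[%classic t ->
        DA a m (f t) /\ DC k m (f t) /\
        {ae mu, forall x, Rp x ->
           g t x = - (a x * f t x) + opB a b (f t) x + opC k (f t) x})) /\
  (forall t, `]0%R, tau[%classic t -> DA a m (f t)) /\
  wcont (wgraph a m) `]0%R, tau[%classic f /\
  {ae mu, forall x, Rp x -> f 0 x = fin x} /\
  (forall t, `[0%R, tau[%classic t -> {ae mu, forall x, Rp x -> 0 <= f t x}).

End Defs.

(* Main.v *)
(** The equation is solved in mild form: for every size x the gain-loss rate g(., x) is a function of
    time, and Duhamel's formula expresses u(., x) as exp(- a t) f + duh(g). The unknown is g, and it is
    found by Picard iteration among rates whose time profile is dominated, in the seminorm [tnorm], by a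
    w_m-integrable function of x. On that class g |-> a u has norm at most 1 + z with z arbitrarily small.
    The condition on N_m0, interpolated with mass conservation, gives int b(x, y) w_m(x) dx <= q w_m(y)
    with q < 1 for large y, so that fragmentation contracts by q (1 + z), while coagulation and the
    fragmentation of small particles carry a factor T^(1 - alpha). As the dominating functions do not
    depend on time, continuity and differentiability in the weighted L1 norms follow from dominated
    convergence. For positivity and uniqueness, h being the negative part of a solution or the absolute
    value of the difference of two solutions, int h w_m satisfies a Gronwall inequality: fragmentation
    uses up only the fraction q of the absorption - int a h w_m, whose rest dominates the coagulation
    terms since a^alpha <= e a + C_e. *)
Require Import Defs.
From HB Require Import structures.
From mathcomp Require Import all_boot all_order all_algebra.
From mathcomp Require Import all_classical all_reals all_analysis.
From mathcomp Require Import measurable_realfun ring lra.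
Import Order.TTheory GRing.Theory Num.Theory.
Import numFieldNormedType.Exports.
Local Open Scope classical_set_scope.
Local Open Scope ring_scope.
Set Implicit Arguments. Unset Strict Implicit. Unset Printing Implicit Defensive.

(** The obstacle is that fragmentation is as unbounded as absorption, so a perturbation argument
    survives only if solving u' + a u = g and multiplying by a costs a factor below 1 / q. The L1
    norm in time costs nothing, since a exp(- a r) has integral at most 1 over r > 0 for every a. It
    does not see single times, however, whereas membership in D(A) and the time derivative require a
    pointwise and a Lipschitz bound away from 0. [tnorm] adds these two with small weights, and
    cutting Duhamel's integral close to its upper end keeps the cost near 1. Time is measured first
    and sizes are integrated afterwards, so that the linear part is a scalar equation in which x is
    a mere parameter. Coagulation is of lower order: [rho * u] with rho = (om + a)^al stays bounded
    up to time 0, and comparing t with t^al leaves the factor T^(1 - al). Uniqueness must cover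
    solutions not known to lie in the class of the iteration, hence the separate energy argument;
    convexity at the later of two times yields a one-sided inequality, which is why Gronwall's lemma
    is used in a form with left differences only. *)

Section measure_toolkit.
Context {R : realType}.
Local Notation mu := (@lebesgue_measure R).

(** No integrability in y is needed: the integral is the difference of those of the positive and
    negative parts, each measurable by Tonelli, and [fine] is measurable. *)
Lemma measurable_Rintegral_param d (A : measurableType d) (F : A * R -> R) :
  measurable_fun [set: A * R] F ->
  measurable_fun [set: A] (fun p => \int[mu]_y F (p, y)).
Proof.
move=> mF; rewrite /Rintegral.
apply: (measurableT_comp (fine_measurable measurableT)).
have mE : measurable_fun [set: A * R] (EFin \o F) by exact/measurable_EFinP.
have -> : (fun p => \int[mu]_y (F (p, y))%:E)%E =
  (fun p => \int[mu]_y (EFin \o F)^\+%E (p, y) - \int[mu]_y (EFin \o F)^\-%E (p, y))%E.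
  apply/funext => p; rewrite integralE; by congr (_ - _)%E; apply: eq_integral => y _; rewrite ?funeposE ?funenegE.
apply: emeasurable_funB.
- apply: (@measurable_fun_fubini_tonelli_F _ _ A (measurableTypeR R) R mu (EFin \o F)^\+%E) => //.
  exact: measurable_funepos.
- apply: (@measurable_fun_fubini_tonelli_F _ _ A (measurableTypeR R) R mu (EFin \o F)^\-%E) => //.
  exact: measurable_funeneg.
Qed.

(** The pushforward is a measure that gives half-open intervals their length, and this determines
    Lebesgue measure. *)
Lemma lebesgue_measure_shift (h : R) (A : set R) : measurable A ->
  pushforward mu ((fun x => x + h) : _ -> measurableTypeR R) A = mu A.
Proof.
move=> mA.
have mh : @measurable_fun _ _ (measurableTypeR R) (measurableTypeR R) setT (fun x => x + h).
  by apply: (@measurable_funD _ (measurableTypeR R)).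
pose phi := HB.pack_for {mfun measurableTypeR R >-> measurableTypeR R}
  ((fun x => x + h) : measurableTypeR R -> measurableTypeR R) (isMeasurableFun.Build _ _ _ _ _ mh).
apply/esym; have := @lebesgue_measure_unique R (pushforward mu phi).
apply => // _ [[a b]] _ <-.
rewrite /pushforward/= lebesgue_measure_itv/=.
rewrite [X in _ = mu X](_ : _ = `](a - h), (b - h)]%classic); last first.
  by apply/seteqP; split=> x /=; rewrite !in_itv/= ltrBlDr lerBrDr.
rewrite lebesgue_measure_itv/= !lte_fin ltrD2r; case: ifP => // _.
by rewrite -!EFinD; congr EFin; ring.
Qed.

Lemma ge0_integral_shift (h : R) (f : R -> \bar R) :
  measurable_fun [set: R] f -> (forall x, 0 <= f x)%E ->
  (\int[mu]_x f (x + h)%R = \int[mu]_x f x)%E.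
Proof.
move=> mf f0.
have mh : @measurable_fun _ _ (measurableTypeR R) (measurableTypeR R) setT (fun x => x + h).
  by apply: (@measurable_funD _ (measurableTypeR R)).
have := @ge0_integral_pushforward _ _ _ _ R _ mh mu setT f measurableT mf (fun y _ => f0 y).
rewrite preimage_setT => <-.
by apply: eq_measure_integral => A mA _; exact: lebesgue_measure_shift.
Qed.

Lemma ge0_integral_reflect (c : R) (f : R -> \bar R) :
  measurable_fun [set: R] f -> (forall x, 0 <= f x)%E ->
  (\int[mu]_x f (c - x)%R = \int[mu]_x f x)%E.
Proof.
move=> mf f0.
have mN : @measurable_fun _ _ (measurableTypeR R) (measurableTypeR R) setT -%R by exact: oppr_measurable.
have H := @ge0_integral_pushforward _ _ _ _ R _ mN mu setT f measurableT mf (fun y _ => f0 y).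
rewrite preimage_setT in H.
transitivity (\int[mu]_x f (- x)%R)%E; last first.
  rewrite -H; apply: eq_measure_integral => A mA _; exact: lebesgue_measureN.
rewrite -(@ge0_integral_shift (- c) (f \o -%R)); last 2 first.
- exact: measurableT_comp.
- by move=> x /=.
by apply: eq_integral => x _ /=; rewrite opprD opprK addrC.
Qed.

Lemma Rintegral_shift (h : R) (f : R -> R) : measurable_fun [set: R] f ->
  \int[mu]_x f (x + h)%R = \int[mu]_x f x.
Proof.
move=> mf; rewrite /Rintegral; congr fine.
have mE : measurable_fun [set: R] (EFin \o f) by exact/measurable_EFinP.
rewrite [RHS]integralE [LHS]integralE; congr (_ - _)%E.
- rewrite -(@ge0_integral_shift h (fun x => (f x)%:E)^\+%E) //.
    by apply: eq_integral => y _; rewrite !funeposE.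
  exact: measurable_funepos.
- rewrite -(@ge0_integral_shift h (fun x => (f x)%:E)^\-%E) //.
    by apply: eq_integral => y _; rewrite !funenegE.
  exact: measurable_funeneg.
Qed.

(** Meant for convolution terms: for fixed x, what holds at almost every size also holds at [x - y]
    for almost every y. The measure of the reflected null set is computed as the integral of its
    indicator. *)
Lemma ae_reflect (P : R -> Prop) (c : R) :
  {ae mu, forall x, P x} -> {ae mu, forall x, P (c - x)}.
Proof.
move=> [N [mN N0 PN]].
exists ((fun x => c - x) @^-1` N).
have mc : measurable_fun [set: R] (fun x : R => c - x).
  by apply: measurable_funB.
split.
- by rewrite -[X in measurable X]setTI; exact: mc.
- have mcN : measurable ((fun x => c - x) @^-1` N : set (measurableTypeR R)).
    by rewrite -[X in measurable X]setTI; exact: mc.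
  rewrite -(setIT (_ @^-1` _)) -[LHS](@integral_indic _ _ _ mu)//.
  rewrite -[RHS]N0 -[in RHS](setIT N) -[RHS](@integral_indic _ _ _ mu)//.
  rewrite -[RHS](@ge0_integral_reflect c (EFin \o \1_N)) //.
  + by apply/measurable_EFinP; exact: measurable_indic.
  + by move=> x; rewrite /= lee_fin.
- by move=> x /= nP; exact: (PN (c - x)).
Qed.

End measure_toolkit.

(** * Powers and time functions singular at the origin *)

Section expR_integral.
Context {R : realType}.
Local Notation mu := (@lebesgue_measure R).

Lemma integral_expR_affine (c d u v : R) : u <= v ->
  (\int[mu]_(s in `[u, v]) (c * expR (c * s + d))%:E =
     (expR (c * v + d) - expR (c * u + d))%:E)%E.
Proof.
rewrite le_eqVlt => /predU1P[->|uv].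
  by rewrite subrr set_itv1 integral_set1.
have dF (x : R) : is_derive x 1 (fun s => expR (c * s + d)) (c * expR (c * x + d)).
  apply: is_derive_eq.
  by rewrite /GRing.scale/= addr0 mulr1 mulrC.
have cF (x : R) : {for x, continuous (fun s : R => expR (c * s + d))}.
  by apply: differentiable_continuous; apply/derivable1_diffP; exact: ex_derive.
rewrite (@continuous_FTC2 R (fun s => c * expR (c * s + d)) (fun s => expR (c * s + d)))//.
- apply: continuous_subspaceT => x.
  by apply: cvgM; [exact: cvg_cst|exact: cF].
- split.
  + by move=> x _; exact: ex_derive.
  + by apply: cvg_at_right_filter; exact: cF.
  + by apply: cvg_at_left_filter; exact: cF.
- by move=> x _; rewrite derive1E; exact: derive_val.
Qed.

End expR_integral.

Section powers.
Context {R : realType} (al : R).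
Hypothesis al01 : 0 < al < 1.

Let al0 : 0 < al. Proof. by case/andP: al01. Qed.
Let al1 : al < 1. Proof. by case/andP: al01. Qed.

Lemma le_powR_le1 (z : R) : 0 <= z <= 1 -> z <= z `^ al.
Proof.
move=> /andP[]; rewrite le_eqVlt => /predU1P[<-|z0] z1; first by rewrite powR_ge0.
by apply: ger1_powR; [rewrite z0|exact: ltW].
Qed.

Lemma powR_le_ge1 (z : R) : 1 <= z -> z `^ al <= z.
Proof. by move=> z1; apply: ler1_powR => //; exact: ltW. Qed.

Lemma powR_ge1 (z : R) : 1 <= z -> 1 <= z `^ al.
Proof. by move=> z1; rewrite -[leLHS](powRr0 z); apply: ler_powR => //; exact: ltW. Qed.

Lemma powR_mono (x y : R) : 0 <= x -> x <= y -> x `^ al <= y `^ al.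
Proof.
move=> x0 xy; apply: ge0_ler_powR; rewrite ?nnegrE//; first exact: ltW.
exact: le_trans xy.
Qed.

Lemma powR_le1 (x : R) : 0 <= x <= 1 -> x `^ al <= 1.
Proof.
move=> /andP[x0 x1]; have := powR_mono x0 x1.
by rewrite (_ : 1 `^ al = 1)// powR1.
Qed.

(** This is the monotonicity of t^al / t, multiplied out; it carries a bound at time s over to all
    later times. *)
Lemma powR_concave (s r : R) : 0 < s -> s <= r -> r `^ al * s <= s `^ al * r.
Proof.
move=> s0 sr; have : (r / s) `^ al <= r / s by apply: powR_le_ge1; rewrite ler_pdivlMr// mul1r.
have r0 : 0 < r by exact: lt_le_trans sr.
rewrite powRM ?(ltW r0) ?invr_ge0 ?(ltW s0)//.
have -> : s^-1 `^ al = (s `^ al)^-1 by rewrite -powR_inv1 ?(ltW s0)// powRAC powR_inv1 ?powR_ge0.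
rewrite ler_pdivlMr// mulrAC ler_pdivrMr ?powR_gt0//.
by rewrite [X in _ <= X -> _]mulrC.
Qed.

Lemma powR_split (t : R) : 0 <= t -> t = t `^ (1 - al) * t `^ al.
Proof.
move=> t0; rewrite -powRD; first by rewrite subrK powRr1.
by rewrite subrK oner_eq0.
Qed.

(** The only source of the small factor: a quantity of order t is compared with the order t^al that
    [tnorm] allows. *)
Lemma le_tau (T t : R) : 0 <= t <= T -> t <= T `^ (1 - al) * t `^ al.
Proof.
move=> /andP[t0 tT]; rewrite {1}(powR_split t0) ler_wpM2r ?powR_ge0//.
apply: ge0_ler_powR; rewrite ?nnegrE ?subr_ge0 ?(ltW al1)//.
exact: le_trans tT.
Qed.

(** At [z = a * t], this and the next two lemmas are the pointwise, the Lipschitz and the integrated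
    bound of [tnorm] for the rate of free decay. For z <= 1 the left sides are at most of order z <=
    z^al; for z >= 1 they are bounded and z^al >= 1. *)
Lemma mul_expRN_le_powR (z : R) : 0 <= z -> z * expR (- z) <= z `^ al.
Proof.
move=> z0; have [z1|z1] := leP z 1.
  rewrite (@le_trans _ _ z)//; last by apply: le_powR_le1; rewrite z0.
  by rewrite ler_piMr// -expR0 ler_expR oppr_le0.
rewrite (@le_trans _ _ 1)//; last by apply: powR_ge1; exact: ltW.
rewrite expRN ler_pdivrMr ?expR_gt0// mul1r.
by apply: le_trans (expR_ge1Dx z); rewrite lerDr.
Qed.

Lemma sqr_expRN_le_powR (z : R) : 0 <= z -> z ^+ 2 * expR (- z) <= 2 * z `^ al.
Proof.
move=> z0; have e2 : z ^+ 2 <= 2 * expR z.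
  have := @expR_ge1Dxn R z 1 z0; rewrite /= (_ : 2`!%:R = 2)//.
  by lra.
rewrite expRN ler_pdivrMr ?expR_gt0//; have [z1|z1] := leP z 1.
  have zz : z <= z `^ al by apply: le_powR_le1; rewrite z0.
  have e1 : 1 <= expR z by rewrite -expR0 ler_expR.
  apply: (@le_trans _ _ z); first by rewrite expr2 ler_piMr.
  rewrite -mulrA; nra.
have zz := powR_ge1 (ltW z1).
by apply: le_trans e2 _; rewrite mulrAC ler_peMr// mulr_ge0// expR_ge0.
Qed.

Lemma one_sub_expRN_le_powR (z : R) : 0 <= z -> 1 - expR (- z) <= z `^ al.
Proof.
move=> z0; have [z1|z1] := leP z 1.
  rewrite (@le_trans _ _ z)//; last by apply: le_powR_le1; rewrite z0.
  by have := expR_ge1Dx (- z); lra.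
by have := powR_ge1 (ltW z1); have := expR_ge0 (- z); lra.
Qed.

End powers.

Section tnorm.
Context {R : realType} (al T eps : R).
Hypothesis al01 : 0 < al < 1.
Hypothesis T01 : 0 < T <= 1.
Hypothesis eps01 : 0 < eps <= 2^-1.
Local Notation mu := (@lebesgue_measure R).

Let al0 : 0 < al. Proof. by case/andP: al01. Qed.
Let T0 : 0 < T. Proof. by case/andP: T01. Qed.
Let T1 : T <= 1. Proof. by case/andP: T01. Qed.
Let e0 : 0 < eps. Proof. by case/andP: eps01. Qed.

(* The three bounds scale like [p t = t `^ (al - 1)], the profile of [a * expR (- a * t) * c] when
   [a `^ al * c] is bounded. The small factors [eps] leave the first bound as the one that decides
   whether the fixed point map contracts. *)
Definition tnorm (p : R -> R) (G : R) : Prop :=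
  [/\ measurable_fun [set: R] p,
      forall t : R, 0 < t <= T ->
        (\int[mu]_(s in `[0%R, t]) `|p s|%:E <= (t `^ al * G)%:E)%E,
      forall t : R, 0 < t <= T -> eps * t * `|p t| <= t `^ al * G &
      forall s t : R, 0 < s -> s < t -> t <= T ->
        eps ^+ 2 * s ^+ 2 * `|p t - p s| <= s `^ al * (G * (t - s))].

Lemma tnorm_ge0 p G : tnorm p G -> 0 <= G.
Proof.
case=> _ _ + _ => /(_ T); rewrite T0 lexx => /(_ isT) h.
have : 0 <= T `^ al * G by apply: le_trans h; rewrite !mulr_ge0// ltW.
by rewrite pmulr_rge0// powR_gt0.
Qed.

Lemma tnorm_le p G H : G <= H -> tnorm p G -> tnorm p H.
Proof.
move=> GH [mp h0 h1 h2]; split=> //.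
- move=> t tT; apply: le_trans (h0 t tT) _.
  by rewrite lee_fin ler_wpM2l ?powR_ge0.
- by move=> t tT; apply: le_trans (h1 t tT) _; rewrite ler_wpM2l ?powR_ge0.
- move=> s t s0 st tT; apply: le_trans (h2 s t s0 st tT) _.
  by rewrite ler_wpM2l ?powR_ge0// ler_wpM2r// subr_ge0 ltW.
Qed.

Lemma measurable_abs_EFin (D : set R) (p : R -> R) : measurable_fun [set: R] p ->
  measurable_fun D (fun s => `|p s|%:E).
Proof.
move=> mp; apply/measurable_EFinP; apply: measurableT_comp => //.
exact: measurable_funTS.
Qed.

Lemma tnorm_eq p q G : p =1 q -> tnorm p G -> tnorm q G.
Proof. by move=> /funext ->. Qed.

Lemma tnorm0 : tnorm (fun=> 0) 0.
Proof.
split=> //.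
- by move=> t tT; under eq_integral do rewrite normr0; rewrite integral0 mulr0.
- by move=> t tT; rewrite normr0 !mulr0.
- by move=> s t s0 st tT; rewrite subrr normr0 mul0r !mulr0.
Qed.

Lemma tnormD p q G H : tnorm p G -> tnorm q H -> tnorm (fun t => p t + q t) (G + H).
Proof.
move=> [mp p0 p1 p2] [mq q0 q1 q2]; split.
- exact: measurable_funD.
- move=> t tT; rewrite mulrDr EFinD; apply: le_trans (leeD (p0 t tT) (q0 t tT)).
  rewrite -ge0_integralD//; last 2 first.
    exact: measurable_abs_EFin.
    exact: measurable_abs_EFin.
  apply: ge0_le_integral => //.
  + by apply: measurable_abs_EFin; exact: measurable_funD.
  + by apply: emeasurable_funD; exact: measurable_abs_EFin.
  + by move=> s _; rewrite -EFinD lee_fin ler_normD.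
- move=> t tT; rewrite mulrDr; apply: le_trans (lerD (p1 t tT) (q1 t tT)).
  rewrite -mulrDr ler_wpM2l ?ler_normD// mulr_ge0 ?(ltW e0)//.
  by case/andP: tT => /ltW.
- move=> s t s0 st tT; rewrite mulrDl mulrDr.
  apply: le_trans (lerD (p2 s t s0 st tT) (q2 s t s0 st tT)).
  have e2 : 0 <= eps ^+ 2 * s ^+ 2 by rewrite mulr_ge0 ?sqr_ge0.
  rewrite -mulrDr ler_wpM2l//.
  by rewrite (_ : _ - _ = (p t - p s) + (q t - q s)) ?ler_normD//; ring.
Qed.

Lemma tnormZ c p G : tnorm p G -> tnorm (fun t => c * p t) (`|c| * G).
Proof.
move=> [mp p0 p1 p2]; split.
- exact: measurable_funM.
- move=> t tT; under eq_integral do rewrite normrM EFinM.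
  rewrite ge0_integralZl_EFin//; last exact: measurable_abs_EFin.
  by rewrite mulrCA EFinM lee_wpmul2l ?lee_fin// p0.
- by move=> t tT; rewrite normrM mulrCA [leRHS]mulrCA ler_wpM2l// p1.
- move=> s t s0 st tT; rewrite -mulrBr normrM mulrCA -[X in _ <= _ * X]mulrA [leRHS]mulrCA ler_wpM2l//.
  exact: p2.
Qed.

Lemma tnormN p G : tnorm p G -> tnorm (fun t => - p t) G.
Proof.
move=> /(tnormZ (- 1)); rewrite normrN1 mul1r; apply: tnorm_eq => t.
by rewrite mulN1r.
Qed.

Lemma tnormB p q G H : tnorm p G -> tnorm q H -> tnorm (fun t => p t - q t) (G + H).
Proof. by move=> hp /tnormN; exact: tnormD. Qed.

(** One factor is estimated by its supremum and the other by its seminorm, so a single [tau]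
    survives. The 2 comes from the product rule in the difference bound. *)
Lemma tnormM (p q : R -> R) (S S' tau : R) :
  (forall t : R, 0 <= t <= T -> `|p t| <= S) -> (forall t : R, 0 <= t <= T -> `|q t| <= S') ->
  tnorm p (tau * S) -> tnorm q (tau * S') ->
  tnorm (fun t => p t * q t) (2 * tau * S * S').
Proof.
move=> hp hq [mp p0 p1 p2] [mq q0 q1 q2].
have S0 : 0 <= S by apply: le_trans (hp 0 _); rewrite ?lexx ?(ltW T0).
have S'0 : 0 <= S' by apply: le_trans (hq 0 _); rewrite ?lexx ?(ltW T0).
have tauSS : 0 <= tau * S' * S.
  have := tnorm_ge0 (And4 mq q0 q1 q2) => h.
  by rewrite mulr_ge0.
split.
- exact: measurable_funM.
- move=> t tT; apply: (@le_trans _ _ (\int[mu]_(s in `[0%R, t]) (S%:E * `|q s|%:E))%E).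
    apply: ge0_le_integral => //.
    + by apply: measurable_abs_EFin; exact: measurable_funM.
    + by apply: emeasurable_funM => //; exact: measurable_abs_EFin.
    + move=> s; rewrite /= in_itv/= => /andP[s0 st].
      rewrite normrM -EFinM lee_fin ler_wpM2r// hp// s0 (le_trans st)//.
      by case/andP: tT.
  rewrite ge0_integralZl_EFin//; last exact: measurable_abs_EFin.
  apply: (@le_trans _ _ (S%:E * (t `^ al * (tau * S'))%:E)%E).
    by rewrite lee_wpmul2l ?lee_fin// q0.
  rewrite -EFinM lee_fin.
  have -> : S * (t `^ al * (tau * S')) = t `^ al * (tau * S' * S) by ring.
  rewrite ler_wpM2l ?powR_ge0//; lra.
- move=> t tT; rewrite normrM.
  have tT' : 0 <= t <= T by case/andP: tT => /ltW -> ->.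
  apply: (@le_trans _ _ (S * (eps * t * `|q t|))).
    rewrite mulrCA ler_wpM2r ?hp// !mulr_ge0 ?(ltW e0)//.
    by case/andP: tT'.
  apply: (@le_trans _ _ (S * (t `^ al * (tau * S')))); first by rewrite ler_wpM2l// q1.
  have -> : S * (t `^ al * (tau * S')) = t `^ al * (tau * S' * S) by ring.
  rewrite ler_wpM2l ?powR_ge0//; lra.
- move=> s t s0 st tT.
  have hs : 0 <= s <= T by rewrite ltW//= (le_trans _ tT)// ltW.
  have ht : 0 <= t <= T by rewrite tT andbT (le_trans (ltW s0))// ltW.
  rewrite (_ : _ - _ = (p t - p s) * q t + p s * (q t - q s)); last by ring.
  have e2 : 0 <= eps ^+ 2 * s ^+ 2 by rewrite mulr_ge0 ?sqr_ge0.
  apply: (@le_trans _ _ (eps ^+ 2 * s ^+ 2 * (`|p t - p s| * S' + S * `|q t - q s|))).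
    rewrite ler_wpM2l//; apply: le_trans (ler_normD _ _) _.
    by rewrite !normrM lerD// ?ler_wpM2l ?ler_wpM2r// ?hp ?hq.
  set A := `|p t - p s| in p2 *; set B := `|q t - q s| in q2 *.
  have -> : eps ^+ 2 * s ^+ 2 * (A * S' + S * B) =
    eps ^+ 2 * s ^+ 2 * A * S' + S * (eps ^+ 2 * s ^+ 2 * B) by ring.
  apply: (@le_trans _ _ (s `^ al * (tau * S * (t - s)) * S' + S * (s `^ al * (tau * S' * (t - s))))).
    by apply: lerD; [rewrite ler_wpM2r//; exact: p2|rewrite ler_wpM2l//; exact: q2].
  by rewrite le_eqVlt; apply/orP; left; apply/eqP; ring.
Qed.

(** Fatou's lemma handles the integrated bound, and the two others pass to the limit pointwise. *)
Lemma tnorm_lim (p_ : nat -> R -> R) p G : measurable_fun [set: R] p ->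
  (forall n, tnorm (p_ n) G) ->
  (forall t : R, 0 < t <= T -> (fun n => p_ n t) @ \oo --> (p t : R)) -> tnorm p G.
Proof.
move=> mp hn hl; split=> //.
- move=> t tT; have t0 : 0 < t by case/andP: tT.
  (* The endpoint 0 is dropped, as convergence is known only at positive times. *)
  have -> : (\int[mu]_(s in `[0%R, t]) `|p s|%:E = \int[mu]_(s in `]0%R, t]) `|p s|%:E)%E.
    by rewrite integral_itv_obnd_cbnd//; exact: measurable_abs_EFin.
  rewrite (@eq_integral _ _ _ mu _ (fun s => limn_einf (fun n => `|p_ n s|%:E))); last first.
    move=> s; rewrite inE/= in_itv/= => /andP[s0 st].
    have hc : (fun n => `|p_ n s|%:E) @ \oo --> `|p s|%:E.
      apply: cvg_EFin; first by near=> n.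
      by apply: cvg_norm; apply: hl; rewrite s0 (le_trans st)//; case/andP: tT.
    rewrite is_cvg_limn_einfE; last by apply: cvgP; exact: hc.
    by apply/esym/cvg_lim => //; exact: hc.
  apply: le_trans (fatou _ _ _ _) _ => //.
  + by move=> n; apply: measurable_abs_EFin; case: (hn n).
  have h n : (\int[mu]_(s in `]0%R, t]) `|p_ n s|%:E <= (t `^ al * G)%:E)%E.
    rewrite integral_itv_obnd_cbnd; last first.
      by apply: measurable_abs_EFin; case: (hn n).
    by case: (hn n) => _ /(_ t tT).
  rewrite limn_einf_lim; apply: lime_le; first exact: is_cvg_einfs.
  near=> n; apply: le_trans (h n).
  by apply: ereal_inf_lbound; exists n => /=.
- move=> t tT; have h : (fun n => eps * t * `|p_ n t|) @ \oo --> eps * t * `|p t|.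
    by apply: cvgM; [exact: cvg_cst|apply: cvg_norm; exact: hl].
  rewrite -(cvg_lim _ h)//; apply: limr_le; first by apply: cvgP h.
  by near=> n; case: (hn n) => _ _ /(_ t tT).
- move=> s t s0 st tT.
  have hs : 0 < s <= T by rewrite s0 (le_trans _ tT)// ltW.
  have ht : 0 < t <= T by rewrite tT andbT (lt_trans s0).
  have h : (fun n => eps ^+ 2 * s ^+ 2 * `|p_ n t - p_ n s|) @ \oo --> eps ^+ 2 * s ^+ 2 * `|p t - p s|.
    by apply: cvgM; [exact: cvg_cst|apply: cvg_norm; apply: cvgB; exact: hl].
  rewrite -(cvg_lim _ h)//; apply: limr_le; first by apply: cvgP h.
  by near=> n; case: (hn n) => _ _ _; exact.
Unshelve. all: by end_near.
Qed.

End tnorm.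

(** * Duhamel's formula *)

Section Rintegral_bounds.
Context {R : realType}.
Local Notation mu := (@lebesgue_measure R).

Lemma norm_Rintegral_le (D : set R) (f h : R -> R) (c C : R) :
  measurable (D : set (measurableTypeR R)) -> measurable_fun D f -> measurable_fun D h ->
  0 <= c -> (forall x, D x -> c * `|f x| <= h x) ->
  (\int[mu]_(x in D) (h x)%:E <= C%:E)%E -> c * `|\int[mu]_(x in D) f x| <= C.
Proof.
move=> mD mf mh c0 fh hC; rewrite -lee_fin; apply: le_trans hC.
have mE : measurable_fun D (EFin \o f) by exact/measurable_EFinP.
rewrite /Rintegral EFinM.
apply: (@le_trans _ _ (c%:E * `|\int[mu]_(x in D) (f x)%:E|))%E.
  rewrite lee_wpmul2l ?lee_fin//.
  (* An infinite integral has [fine] equal to 0, so the inequality holds without integrability of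
     f. *)
  by case: (\int[mu]_(x in D) (f x)%:E)%E => //= *; rewrite ?normr0 ?leey.
apply: (@le_trans _ _ (c%:E * \int[mu]_(x in D) `|(f x)%:E|))%E.
  by rewrite lee_wpmul2l ?lee_fin//; exact: le_abse_integral.
rewrite -ge0_integralZl_EFin//; last exact: measurableT_comp.
apply: ge0_le_integral => //.
- by move=> x _; rewrite mule_ge0 ?lee_fin.
- by apply: emeasurable_funM => //; exact: measurableT_comp.
- exact/measurable_EFinP.
Qed.

End Rintegral_bounds.

Section duhamel.
Context {R : realType}.
Local Notation mu := (@lebesgue_measure R).

Definition duh (a : R) (g : R -> R) (t : R) : R :=
  \int[mu]_(s in `[0, t]) (expR (- (a * (t - s))) * g s).

(** The variable upper limit is absorbed into an indicator, which leaves an integral over all of R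
    depending on a parameter. *)
Lemma measurable_duh d (X : measurableType d) (a : X -> R) (g : R * X -> R) :
  measurable_fun [set: X] a -> measurable_fun [set: R * X] g ->
  measurable_fun [set: R * X] (fun p => duh (a p.2) (fun s => g (s, p.2)) p.1).
Proof.
move=> ma mg; rewrite /duh.
under eq_fun do rewrite Rintegral_mkcond.
apply: (@measurable_Rintegral_param _ _ _ (fun q : (R * X) * R =>
  ((fun s => expR (- (a q.1.2 * (q.1.1 - s))) * g (s, q.1.2)) \_ `[0, q.1.1]) q.2)).
have m11 : measurable_fun [set: (R * X) * R] (fun q => q.1.1).
  exact: (measurableT_comp (@measurable_fst _ _ _ _) (@measurable_fst _ _ _ _)).
have m12 : measurable_fun [set: (R * X) * R] (fun q => q.1.2).
  exact: (measurableT_comp (@measurable_snd _ _ _ _) (@measurable_fst _ _ _ _)).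
have m2 : measurable_fun [set: (R * X) * R] (fun q => q.2) by exact: measurable_snd.
rewrite (_ : (fun q => _) = (fun q : (R * X) * R => if (0 <= q.2) && (q.2 <= q.1.1)
    then expR (- (a q.1.2 * (q.1.1 - q.2))) * g (q.2, q.1.2) else 0)); last first.
  apply/funext => q; rewrite patchE mem_setE in_itv/=.
  by case: ifP.
apply: measurable_fun_ifT => //.
- apply: measurable_and.
  + exact: measurable_fun_ler.
  + exact: measurable_fun_ler.
- apply: measurable_funM.
  + apply: measurableT_comp => //; apply: measurableT_comp => //.
    apply: measurable_funM; first exact: measurableT_comp.
    exact: measurable_funB.
  + apply: (measurableT_comp mg); exact: measurable_fun_pair.
Qed.

Lemma measurable_duh1 (a : R) (g : R -> R) : measurable_fun [set: R] g ->
  measurable_fun [set: R] (duh a g).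
Proof.
move=> mg.
have H := @measurable_duh _ R (fun=> a) (fun p => g p.1) (measurable_cst _)
  (measurableT_comp mg (@measurable_fst _ _ _ _)).
by have := measurable_fun_pair1 (0 : R) H.
Qed.

Section fixed_rate.
Variables (al T eps a : R) (g : R -> R) (G : R).
Hypothesis al01 : 0 < al < 1.
Hypothesis T01 : 0 < T <= 1.
Hypothesis eps01 : 0 < eps <= 2^-1.
Hypothesis a0 : 0 <= a.
Hypothesis hg : tnorm al T eps g G.

Let mg : measurable_fun [set: R] g. Proof. by case: hg. Qed.
Let G0 : 0 <= G. Proof. exact: tnorm_ge0 hg. Qed.
Let e0 : 0 < eps. Proof. by case/andP: eps01. Qed.

Lemma measurable_duh_kernel (c : R) (D : set R) :
  measurable_fun D (fun s => expR (- (a * (c - s))) * g s).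
Proof.
apply: measurable_funTS; apply: measurable_funM => //.
apply: measurableT_comp => //; apply: measurableT_comp => //.
by apply: measurable_funM => //; exact: measurable_funB.
Qed.

Lemma duh_kernel_le (c s : R) : s <= c -> `|expR (- (a * (c - s))) * g s| <= `|g s|.
Proof.
move=> sc; rewrite normrM ler_piMl// ger0_norm ?expR_ge0//.
by rewrite -expR0 ler_expR oppr_le0 mulr_ge0// subr_ge0.
Qed.

Lemma duh_kernel_integrable (c : R) : 0 < c <= T ->
  mu.-integrable `[0, c] (fun s => (expR (- (a * (c - s))) * g s)%:E).
Proof.
move=> cT; apply/integrableP; split.
  by apply/measurable_EFinP; exact: measurable_duh_kernel.
apply: (@le_lt_trans _ _ (\int[mu]_(s in `[0%R, c]) `|g s|%:E)%E); last first.
  by case: hg => _ /(_ c cT) h _ _; apply: le_lt_trans h _; rewrite ltey.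
apply: ge0_le_integral => //.
- by apply: measurableT_comp => //; apply/measurable_EFinP; exact: measurable_duh_kernel.
- exact: measurable_abs_EFin.
- move=> s; rewrite /= in_itv/= => /andP[_ sc].
  by rewrite -?abse_EFin/= lee_fin; exact: duh_kernel_le.
Qed.

Lemma norm_duh_le (t : R) : 0 < t <= T -> `|duh a g t| <= t `^ al * G.
Proof.
move=> tT; rewrite -[leLHS]mul1r.
apply: (@norm_Rintegral_le _ _ _ (fun s => `|g s|)) => //.
- exact: measurable_duh_kernel.
- by apply: measurable_funTS; exact: measurableT_comp.
- by move=> s; rewrite /= in_itv/= => /andP[_ sc]; rewrite mul1r duh_kernel_le.
- by case: hg => _ /(_ t tT).
Qed.

(** Restarting at [s0] separates the times near 0, where g is only integrable, from those where g is
    bounded and Lipschitz. *)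
Lemma duh_split (s0 t : R) : 0 < s0 -> s0 <= t -> t <= T ->
  duh a g t = expR (- (a * (t - s0))) * duh a g s0 +
    \int[mu]_(s in `]s0, t]) (expR (- (a * (t - s))) * g s).
Proof.
move=> s00 s0t tT; rewrite /duh.
have tT' : 0 < t <= T by rewrite tT (lt_le_trans s00).
have hi := duh_kernel_integrable tT'.
have -> : `[0, t]%classic = `[0, s0]%classic `|` `]s0, t]%classic.
  by rewrite -itv_bndbnd_setU// bnd_simp// ltW.
rewrite Rintegral_setU//; last 2 first.
- by rewrite -itv_bndbnd_setU// bnd_simp// ltW.
- rewrite disj_set2E; apply/eqP/seteqP; split=> // x [] /=; rewrite !in_itv/=.
  by move=> /andP[_ h1] /andP[h2 _]; move: (lt_le_trans h2 h1); rewrite ltxx.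
congr (_ + _).
rewrite -RintegralZl//; last first.
  by apply: duh_kernel_integrable; rewrite s00 (le_trans s0t).
apply: eq_Rintegral => s _; rewrite mulrA -expRD; congr (expR _ * _); ring.
Qed.

(** The second bound is uniform in a, because a exp(- a (t - s)) has integral at most 1 over s <=
    t. *)
Lemma duh_tail_le (s0 t Gam : R) (h : R -> R) : s0 <= t -> 0 <= Gam ->
  measurable_fun [set: R] h -> (forall s, s0 < s <= t -> `|h s| <= Gam) ->
  `|\int[mu]_(s in `]s0, t]) (expR (- (a * (t - s))) * h s)| <= Gam * (t - s0) /\
  a * `|\int[mu]_(s in `]s0, t]) (expR (- (a * (t - s))) * h s)| <= Gam.
Proof.
move=> s0t Gam0 mh hGam.
have me : measurable_fun [set: R] (fun s => expR (- (a * (t - s)))).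
  apply: measurableT_comp => //; apply: measurableT_comp => //.
  by apply: measurable_funM => //; exact: measurable_funB.
have mk : measurable_fun `]s0, t] (fun s => expR (- (a * (t - s))) * h s).
  by apply: measurable_funTS; exact: measurable_funM.
have hk s : s0 < s <= t -> `|expR (- (a * (t - s))) * h s| <= expR (- (a * (t - s))) * Gam.
  by move=> sI; rewrite normrM ger0_norm ?expR_ge0// ler_wpM2l ?expR_ge0// hGam.
split.
- rewrite -[leLHS]mul1r.
  apply: (@norm_Rintegral_le _ _ _ (fun s => Gam)) => //.
  + move=> s; rewrite /= in_itv/= => sI; rewrite mul1r; apply: le_trans (hk s sI) _.
    rewrite ler_piMl// -expR0 ler_expR oppr_le0 mulr_ge0// subr_ge0.
    by case/andP: sI.
  + rewrite integral_cst//= lebesgue_measure_itv/= lte_fin.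
    case: ltP => [_|ts]; first by rewrite -EFinD -EFinM.
    by rewrite mule0 lee_fin mulr_ge0// subr_ge0.
- apply: (@norm_Rintegral_le _ _ _ (fun s => a * expR (- (a * (t - s))) * Gam)) => //.
  + apply: measurable_funTS; apply: measurable_funM => //.
    exact: measurable_funM.
  + by move=> s; rewrite /= in_itv/= => sI; rewrite -mulrA ler_wpM2l// hk.
  + rewrite (@integral_itv_obnd_cbnd _ s0); last first.
      apply/measurable_EFinP; apply: measurable_funTS; apply: measurable_funM => //.
      exact: measurable_funM.
    under eq_integral do rewrite mulrC EFinM.
    rewrite ge0_integralZl_EFin//; last 2 first.
      by move=> s _; rewrite lee_fin mulr_ge0// expR_ge0.
      by apply/measurable_EFinP; apply: measurable_funTS; exact: measurable_funM.
    have := @integral_expR_affine R a (- (a * t)) s0 t s0t.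
    rewrite (_ : (fun s => _) = (fun s => (a * expR (- (a * (t - s))))%:E)); last first.
      by apply/funext => s; congr (a * expR _)%:E; ring.
    move=> ->; rewrite -EFinM lee_fin addrN expR0 ler_piMr// lerBlDr lerDl.
Qed.


(** The estimate without loss: after exchanging the order of integration over the triangle s <= r <=
    t, the kernel a exp(- a (r - s)) integrates in r to 1 - exp(- a (t - s)) <= 1. *)
Lemma integral_duh_le (t : R) : 0 < t <= T ->
  (\int[mu]_(r in `[0%R, t]) `|(a * duh a g r)%R|%:E <= \int[mu]_(s in `[0%R, t]) `|g s|%:E)%E.
Proof.
move=> tT.
pose F (p : R * R) : R := if (0 <= p.2) && (p.2 <= p.1) && (p.1 <= t)
  then a * expR (- (a * (p.1 - p.2))) * `|g p.2| else 0.
have F0 p : 0 <= F p.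
  by rewrite /F; case: ifP => // _; rewrite !mulr_ge0// expR_ge0.
have mF : measurable_fun [set: R * R] F.
  apply: measurable_fun_ifT => //.
  - apply: measurable_and; [apply: measurable_and|].
    + exact: measurable_fun_ler.
    + exact: measurable_fun_ler.
    + exact: measurable_fun_ler.
  - apply: measurable_funM.
    + apply: measurable_funM => //; apply: measurableT_comp => //.
      apply: measurableT_comp => //; apply: measurable_funM => //.
      exact: measurable_funB.
    + by apply: measurableT_comp => //; exact: measurableT_comp.
have mFE : measurable_fun [set: R * R] (EFin \o F) by exact/measurable_EFinP.
rewrite integral_mkcond [leRHS]integral_mkcond.
apply: (@le_trans _ _ (\int[mu]_r \int[mu]_s (EFin \o F) (r, s)))%E.
  apply: ge0_le_integral => //.
  - by move=> r _; rewrite patchE; case: ifP.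
  - apply/(measurable_restrictT _ _).1 => //.
    apply: measurable_abs_EFin; apply: measurable_funM => //.
    exact: measurable_duh1.
  - exact: (@measurable_fun_fubini_tonelli_F _ _ R (measurableTypeR R) R mu).
  - move=> r _; rewrite patchE mem_setE; case: ifP => rI; last first.
      by apply: integral_ge0 => s _; rewrite lee_fin.
    move: rI; rewrite in_itv/= => /andP[r0 rt].
    rewrite normrM (ger0_norm a0).
    have -> : (\int[mu]_s (EFin \o F) (r, s) =
        \int[mu]_(s in `[0%R, r]) (a * expR (- (a * (r - s))) * `|g s|)%:E)%E.
      rewrite [RHS]integral_mkcond; apply: eq_integral => s _.
      rewrite patchE mem_setE in_itv/= /F/= rt andbT.
      by case: ifP.
    have me : measurable_fun [set: R] (fun s => expR (- (a * (r - s)))).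
      apply: measurableT_comp => //; apply: measurableT_comp => //.
      by apply: measurable_funM => //; exact: measurable_funB.
    (* The bounds of [tnorm] start at positive times, so r = 0 is treated apart; [duh] vanishes
       there. *)
    have [rI|] := pselect (r = 0).
      rewrite rI /duh set_itv1 Rintegral_set1 normr0 mulr0.
      apply: integral_ge0 => s _; rewrite lee_fin !mulr_ge0// expR_ge0//.
    move=> /eqP rn0; have rT : 0 < r <= T.
      rewrite lt_neqAle eq_sym rn0 r0/= (le_trans rt)//; by case/andP: tT.
    (* Finiteness allows this integral to serve as the real bound in [norm_Rintegral_le]. *)
    have fi : (\int[mu]_(s in `[0%R, r]) (a * expR (- (a * (r - s))) * `|g s|)%:E)%E \is a fin_num.
      rewrite ge0_fin_numE; last first.
        by apply: integral_ge0 => s _; rewrite lee_fin !mulr_ge0// expR_ge0.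
      apply: (@le_lt_trans _ _ (a%:E * \int[mu]_(s in `[0%R, r]) `|g s|%:E)%E).
        rewrite -ge0_integralZl_EFin//; last exact: measurable_abs_EFin.
        apply: ge0_le_integral => //.
        + by move=> s _; rewrite lee_fin !mulr_ge0// expR_ge0.
        + apply/measurable_EFinP; apply: measurable_funTS; apply: measurable_funM => //.
          * exact: measurable_funM.
          * exact: measurableT_comp.
        + by apply: emeasurable_funM => //; exact: measurable_abs_EFin.
        + move=> s; rewrite /= in_itv/= => /andP[s0 sr].
          rewrite -EFinM lee_fin -mulrA ler_wpM2l// ler_piMl//.
          by rewrite -expR0 ler_expR oppr_le0 mulr_ge0// subr_ge0.
      case: hg => _ /(_ r rT) h _ _.
      by apply: (@le_lt_trans _ _ (a%:E * (r `^ al * G)%:E)%E);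
        [rewrite lee_wpmul2l ?lee_fin|rewrite -EFinM ltey].
    rewrite -(fineK fi) lee_fin.
    apply: (@norm_Rintegral_le _ _ _ (fun s => a * expR (- (a * (r - s))) * `|g s|)) => //.
    + exact: measurable_duh_kernel.
    + apply: measurable_funTS; apply: measurable_funM; first exact: measurable_funM.
      exact: measurableT_comp.
    + by move=> s _; rewrite normrM (ger0_norm (expR_ge0 _)) mulrA.
    + by rewrite fineK.
rewrite (@fubini_tonelli _ _ (measurableTypeR R) (measurableTypeR R) R mu mu (EFin \o F))//.
apply: ge0_le_integral => //.
- by move=> s _; apply: integral_ge0 => r _; rewrite lee_fin.
- exact: (@measurable_fun_fubini_tonelli_G _ _ (measurableTypeR R) (measurableTypeR R) R mu).
- by apply/(measurable_restrictT _ _).1 => //; exact: measurable_abs_EFin.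
- move=> s _; rewrite patchE mem_setE in_itv/=; case: ifPn => sI; last first.
    rewrite integral0_eq// => r _; rewrite /= /F/=; case: ifP => // /andP[/andP[s0 sr] rt].
    by move: sI; rewrite s0 (le_trans sr).
  case/andP: sI => s0 st.
  have -> : (\int[mu]_r (EFin \o F) (r, s) =
      \int[mu]_(r in `[s, t]) (`|g s|%:E * (a * expR (a * - r + a * s))%:E))%E.
    rewrite [RHS]integral_mkcond; apply: eq_integral => r _.
    rewrite patchE mem_setE in_itv/= /F/= s0/=.
    case: ifP => // _; rewrite -EFinM [in RHS]mulrC; congr (_ * expR _ * _)%:E; ring.
  have me : measurable_fun [set: R] (fun r => a * expR (a * - r + a * s)).
    apply: measurable_funM => //; apply: measurableT_comp => //.
    by apply: measurable_funD => //; exact: measurable_funM.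
  rewrite ge0_integralZl_EFin//; last 2 first.
  + by move=> r _; rewrite lee_fin mulr_ge0// expR_ge0.
  + by apply/measurable_EFinP; exact: measurable_funTS.
  have := @integral_expR_affine R (- a) (a * s) s t st.
  have -> : (\int[mu]_(r in `[s, t]) (- a * expR (- a * r + a * s))%:E =
    - \int[mu]_(r in `[s, t]) (a * expR (a * - r + a * s))%:E)%E.
    rewrite -integral_ge0N; last by move=> r _; rewrite lee_fin mulr_ge0// expR_ge0.
    apply: eq_integral => r _; rewrite -EFinN; congr EFin.
    by rewrite mulNr mulrN mulNr.
  move/(congr1 (fun x => - x)%E); rewrite oppeK => ->.
  rewrite -EFinN -EFinM lee_fin ler_piMr//.
  have -> : - a * s + a * s = 0 by ring.
  by rewrite expR0 opprB lerBlDr lerDl expR_ge0.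
Qed.

(** The pointwise bound allows growth like t^(al - 1), which decreases in t, so its value at s
    serves for all later times. *)
Lemma tnorm_sup (s r : R) : 0 < s -> s <= r -> r <= T ->
  `|g r| <= s `^ al * G / (eps * s).
Proof.
move=> s0 sr rT; have r0 : 0 < r by exact: lt_le_trans sr.
case: hg => _ _ /(_ r) + _; rewrite r0 rT => /(_ isT) h.
rewrite ler_pdivlMr ?mulr_gt0//.
have c := powR_concave al01 s0 sr.
rewrite -(ler_pM2r r0).
apply: (@le_trans _ _ (s * (r `^ al * G))).
  rewrite (_ : `|g r| * _ * _ = s * (eps * r * `|g r|)); last by ring.
  by rewrite ler_wpM2l// ltW.
rewrite (_ : s * _ = (r `^ al * s) * G); last by ring.
by rewrite (_ : _ * G * r = (s `^ al * r) * G) ?ler_wpM2r//; ring.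
Qed.

(** As in [tnorm_sup], now with the profile t^(al - 2), which is decreasing too. *)
Lemma tnorm_Lip (s r h : R) : 0 < s -> s <= r -> 0 < h -> r + h <= T ->
  `|g (r + h) - g r| <= s `^ al * G / (eps * s) ^+ 2 * h.
Proof.
move=> s0 sr h0 rhT; have r0 : 0 < r by exact: lt_le_trans sr.
case: hg => _ _ _ /(_ r (r + h)); rewrite r0 ltrDl h0 rhT => /(_ isT isT isT).
rewrite (_ : r + h - r = h) => [H|]; last by ring.
rewrite mulrAC ler_pdivlMr ?exprn_gt0 ?mulr_gt0//.
have c := powR_concave al01 s0 sr.
rewrite -(ler_pM2r (exprn_gt0 2 r0)).
apply: (@le_trans _ _ (s ^+ 2 * (r `^ al * (G * h)))).
  rewrite (_ : `|_| * _ * _ = s ^+ 2 * (eps ^+ 2 * r ^+ 2 * `|g (r + h) - g r|)); last by ring.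
  by rewrite ler_wpM2l// sqr_ge0.
rewrite (_ : s ^+ 2 * _ = (r `^ al * s) * s * (G * h)); last by ring.
rewrite (_ : _ * h * r ^+ 2 = (s `^ al * r) * r * (G * h)); last by ring.
rewrite ler_wpM2r ?mulr_ge0 ?(ltW h0)// ler_pM ?mulr_ge0 ?powR_ge0 ?(ltW r0) ?(ltW s0)//.
Qed.


Variables (z kap : R).
Hypothesis z01 : 0 < z <= 1.
Hypothesis kap01 : 0 < kap < 1.
(* [kap] splits the Duhamel integral at time [kap * t]; letting [kap] tend to 1 and then [eps] to 0
   makes the norm of [g |-> a * duh a g] as close to 1 as needed. *)
Hypothesis par1 : eps / (1 - kap) + kap^-1 <= 1 + z.
Hypothesis par2 : 3 * eps / ((1 - kap) * kap) + kap ^- 2 <= 1 + z.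

Let k0 : 0 < kap. Proof. by case/andP: kap01. Qed.
Let k1 : kap < 1. Proof. by case/andP: kap01. Qed.
Let k1' : 0 < 1 - kap. Proof. by rewrite subr_gt0. Qed.

Lemma mul_expRN_le1 (x : R) : x * expR (- x) <= 1.
Proof.
rewrite expRN ler_pdivrMr ?expR_gt0// mul1r.
by apply: le_trans (expR_ge1Dx x); rewrite lerDr.
Qed.

Lemma rate_expR_le (t : R) : 0 < t -> a * expR (- (a * (t - kap * t))) <= ((1 - kap) * t)^-1.
Proof.
move=> t0; rewrite -[leRHS]mul1r ler_pdivlMr ?mulr_gt0//.
rewrite mulrAC (_ : t - kap * t = (1 - kap) * t); last by ring.
exact: mul_expRN_le1.
Qed.

(** Cut at [kap * t]. The earlier part has decayed: a exp(- a (1 - kap) t) <= 1 / ((1 - kap) t)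
    costs [eps / (1 - kap)] after multiplication by [eps * t]. On the later part g is bounded by its
    value allowed at [kap * t], which costs [kap^-1]. [par1] adds the two. *)
Lemma rate_duh_le (t : R) : 0 < t <= T ->
  eps * t * (a * `|duh a g t|) <= t `^ al * ((1 + z) * G).
Proof.
move=> tT; have t0 : 0 < t by case/andP: tT.
have s00 : 0 < kap * t by rewrite mulr_gt0.
have s0t : kap * t <= t by rewrite ger_pMl// ltW.
have tT2 : t <= T by case/andP: tT.
set Gam := (kap * t) `^ al * G / (eps * (kap * t)).
have Gam0 : 0 <= Gam by rewrite divr_ge0 ?mulr_ge0 ?powR_ge0// ltW.
have hG s : kap * t < s <= t -> `|g s| <= Gam.
  by move=> /andP[h1 h2]; apply: tnorm_sup => //; [exact: ltW|exact: le_trans tT2].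
have [_ tail] := duh_tail_le s0t Gam0 mg hG.
have hd : `|duh a g (kap * t)| <= t `^ al * G.
  have ks : 0 < kap * t <= T by rewrite s00 (le_trans s0t).
  apply: le_trans (norm_duh_le ks) _.
  by rewrite ler_wpM2r// powR_mono// ltW.
rewrite (duh_split s00 s0t tT2).
have H : a * `|expR (- (a * (t - kap * t))) * duh a g (kap * t) +
    \int[mu]_(s in `]kap * t, t]) (expR (- (a * (t - s))) * g s)| <=
    ((1 - kap) * t)^-1 * (t `^ al * G) + Gam.
  apply: (@le_trans _ _ (a * expR (- (a * (t - kap * t))) * `|duh a g (kap * t)| + Gam)).
    apply: le_trans (ler_wpM2l a0 (ler_normD _ _)) _.
    rewrite mulrDr lerD// normrM ger0_norm ?expR_ge0//.
    by rewrite mulrA.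
  rewrite lerD2r ler_pM ?mulr_ge0 ?expR_ge0//.
  exact: rate_expR_le.
apply: le_trans (ler_wpM2l _ H) _; first by rewrite ltW// mulr_gt0.
have Gam_le : eps * t * Gam <= t `^ al * G * kap^-1.
  rewrite /Gam.
  rewrite (_ : eps * t * _ = (kap * t) `^ al * G * kap^-1); last first.
    by field; rewrite !gt_eqF.
  rewrite ler_wpM2r ?invr_ge0 ?(ltW k0)// ler_wpM2r// powR_mono// ltW//.
rewrite mulrDr.
have -> : eps * t * (((1 - kap) * t)^-1 * (t `^ al * G)) = t `^ al * G * (eps / (1 - kap)).
  by field; rewrite !gt_eqF.
apply: le_trans (lerD (lexx _) Gam_le) _.
rewrite -mulrDr [(1 + z) * G]mulrC mulrA ler_wpM2l//.
by rewrite mulr_ge0// powR_ge0.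
Qed.

(** Seen from time s, the increment is a fresh Duhamel integral over a length h, minus the decay of
    the old value, which is at most a h times that value. The first costs 1, the second 1 + z <= 2
    by [rate_duh_le]; hence the 3. *)
Lemma duh_diff_le (s h : R) : 0 < s -> 0 < h -> s + h <= T ->
  `|duh a g (s + h) - duh a g s| <= 3 * (s `^ al * G / (eps * s)) * h.
Proof.
move=> s0 h0 shT.
have sT : 0 < s <= T by rewrite s0 (le_trans _ shT)// lerDl ltW.
have ssh : s <= s + h by rewrite lerDl ltW.
set Gam := s `^ al * G / (eps * s).
have es0 : 0 < eps * s by rewrite mulr_gt0.
have Gam0 : 0 <= Gam by rewrite divr_ge0 ?mulr_ge0 ?powR_ge0// ltW.
have hG r : s < r <= s + h -> `|g r| <= Gam.
  by move=> /andP[h1 h2]; apply: tnorm_sup => //; [exact: ltW|exact: le_trans shT].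
have [tail _] := duh_tail_le ssh Gam0 mg hG.
have hd : a * `|duh a g s| <= 2 * Gam.
  have H := rate_duh_le sT; rewrite /Gam mulrA ler_pdivlMr//.
  apply: le_trans (_ : eps * s * (a * `|duh a g s|) <= _); first by rewrite mulrC.
  apply: le_trans H _.
  rewrite mulrCA ler_wpM2r ?mulr_ge0 ?powR_ge0//.
  by case/andP: z01 => _; lra.
rewrite (duh_split s0 ssh shT).
move: tail; rewrite (_ : s + h - s = h); last by ring.
set J := \int[mu]_(r in _) _ => tail.
have -> : expR (- (a * h)) * duh a g s + J - duh a g s = J - (1 - expR (- (a * h))) * duh a g s.
  by ring.
apply: le_trans (ler_normB _ _) _; rewrite normrM.
have e1 : 0 <= 1 - expR (- (a * h)).
  by rewrite subr_ge0 -expR0 ler_expR oppr_le0 mulr_ge0// ltW.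
rewrite (ger0_norm e1).
have e2 : 1 - expR (- (a * h)) <= a * h.
  by have := expR_ge1Dx (- (a * h)); lra.
have e3 : (1 - expR (- (a * h))) * `|duh a g s| <= a * h * `|duh a g s| by rewrite ler_wpM2r.
have e4 : a * h * `|duh a g s| <= 2 * Gam * h by rewrite mulrAC ler_wpM2r// ltW.
lra.
Qed.

(** The value at s is cut at [kap * s], that at s + h at [kap * s + h]. Translation by h brings both
    later parts to the same interval and the same kernel, so only g (r + h) - g r remains, at the
    cost [kap ^- 2]. The earlier parts differ by [duh_diff_le], damped as in [rate_duh_le]; this is
    the first term of [par2]. *)
Lemma rate_duh_diff_le (s h : R) : 0 < s -> 0 < h -> s + h <= T ->
  eps ^+ 2 * s ^+ 2 * (a * `|duh a g (s + h) - duh a g s|) <= s `^ al * ((1 + z) * G * h).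
Proof.
move=> s0 h0 shT.
have ks0 : 0 < kap * s by rewrite mulr_gt0.
have kss : kap * s <= s by rewrite ger_pMl// ltW.
have sT : s <= T by rewrite (le_trans _ shT)// lerDl ltW.
have kshT : kap * s + h <= T by rewrite (le_trans _ shT)// lerD2r.
have ksh0 : 0 < kap * s + h by rewrite addr_gt0.
have ksh : kap * s + h <= s + h by rewrite lerD2r.
rewrite (duh_split ks0 kss sT).
rewrite (duh_split ksh0 ksh shT).
set d1 := duh a g (kap * s + h); set d0 := duh a g (kap * s).
have dd := duh_diff_le ks0 h0 kshT; rewrite -/d1 -/d0 in dd.
set Gam2 := (kap * s) `^ al * G / (eps * (kap * s)) ^+ 2 * h.
have Gam20 : 0 <= Gam2.
  by rewrite mulr_ge0 ?divr_ge0 ?mulr_ge0 ?powR_ge0 ?sqr_ge0// ltW.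
have mg2 : measurable_fun [set: R] (fun r => g (r + h) - g r).
  apply: measurable_funB => //; apply: measurableT_comp => //.
  exact: measurable_funD.
have hG r : kap * s < r <= s -> `|g (r + h) - g r| <= Gam2.
  move=> /andP[h1 h2]; apply: tnorm_Lip => //; first exact: ltW.
  by rewrite (le_trans _ shT)// lerD2r.
have [_ tail] := duh_tail_le kss Gam20 mg2 hG.
have kI r : `]kap * s + h, s + h]%classic (r + h) = `]kap * s, s]%classic r.
  by rewrite /= !in_itv/= ltrD2r lerD2r.
have hJ : \int[mu]_(r in `]kap * s + h, s + h]) (expR (- (a * (s + h - r))) * g r) =
    \int[mu]_(r in `]kap * s, s]) (expR (- (a * (s - r))) * g (r + h)).
  rewrite Rintegral_mkcond [RHS]Rintegral_mkcond -(Rintegral_shift h); last first.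
    by apply/(measurable_restrictT _ _).1 => //; exact: measurable_duh_kernel.
  apply: eq_Rintegral => r _; rewrite !patchE !mem_setE !in_itv/= ltrD2r lerD2r.
  by case: ifP => // _; congr (expR _ * _); ring.
rewrite hJ.
have int1 (q : R -> R) (t0 c : R) : measurable_fun [set: R] q -> (0 < t0) ->
    (forall r, kap * s < r <= s -> `|q r| <= c) ->
    mu.-integrable `]kap * s, s] (fun r => (expR (- (a * (s - r))) * q r)%:E).
  move=> mq _ qc; apply: measurable_bounded_integrable => //.
  - by rewrite /= lebesgue_measure_itv/=; case: ifP => // _; rewrite -EFinD ltey.
  - apply: measurable_funTS; apply: measurable_funM => //.
    apply: measurableT_comp => //; apply: measurableT_comp => //.
    by apply: measurable_funM => //; exact: measurable_funB.
  - exists c; split; first exact: num_real.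
    move=> y cy r; rewrite /= in_itv/= => rI.
    rewrite normrM ger0_norm ?expR_ge0//.
    apply: (@le_trans _ _ (`|q r|)); last by rewrite (le_trans (qc r rI))// ltW.
    rewrite ler_piMl// -expR0 ler_expR oppr_le0 mulr_ge0// subr_ge0.
    by case/andP: rI.
have i1 := int1 (fun r => g (r + h)) 1 ((kap * s) `^ al * G / (eps * (kap * s))).
have i2 := int1 g 1 ((kap * s) `^ al * G / (eps * (kap * s))).
have {}i1 : mu.-integrable `]kap * s, s] (fun r => (expR (- (a * (s - r))) * g (r + h))%:E).
  apply: i1 => //.
    by apply: measurableT_comp => //; exact: measurable_funD.
  move=> r /andP[h1 h2]; apply: tnorm_sup => //.
    by rewrite (le_trans (ltW h1))// lerDl ltW.
  by rewrite (le_trans _ shT)// lerD2r.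
have {}i2 : mu.-integrable `]kap * s, s] (fun r => (expR (- (a * (s - r))) * g r)%:E).
  apply: i2 => // r /andP[h1 h2]; apply: tnorm_sup => //; first exact: ltW.
  exact: le_trans sT.
have hd : \int[mu]_(r in `]kap * s, s]) (expR (- (a * (s - r))) * g (r + h)) -
    \int[mu]_(r in `]kap * s, s]) (expR (- (a * (s - r))) * g r) =
    \int[mu]_(r in `]kap * s, s]) (expR (- (a * (s - r))) * (g (r + h) - g r)).
  rewrite -RintegralB//; apply: eq_Rintegral => r _; ring.
rewrite (_ : s + h - (kap * s + h) = s - kap * s); last by ring.
set E := expR _; set J1 := \int[mu]_(r in _) _ in hd *; set J2 := \int[mu]_(r in _) _ in hd *.
rewrite (_ : _ - _ = E * (d1 - d0) + (J1 - J2)); last by ring.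
rewrite hd; set J := \int[mu]_(r in _) _ in tail *.
have H : a * `|E * (d1 - d0) + J| <=
    ((1 - kap) * s)^-1 * (3 * ((kap * s) `^ al * G / (eps * (kap * s))) * h) + Gam2.
  apply: le_trans (ler_wpM2l a0 (ler_normD _ _)) _.
  rewrite mulrDr lerD// normrM ger0_norm ?expR_ge0// mulrA ler_pM ?mulr_ge0 ?expR_ge0//.
  exact: rate_expR_le.
apply: le_trans (ler_wpM2l _ H) _; first by rewrite mulr_ge0 ?sqr_ge0.
rewrite /Gam2.
rewrite (_ : eps ^+ 2 * s ^+ 2 * _ =
  (kap * s) `^ al * ((3 * eps / ((1 - kap) * kap) + kap ^- 2) * (G * h))); last first.
  by field; rewrite !gt_eqF.
apply: ler_pM => //; first exact: powR_ge0.
- rewrite mulr_ge0 ?mulr_ge0 ?(ltW h0)// addr_ge0 ?invr_ge0 ?sqr_ge0//.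
  by rewrite divr_ge0 ?mulr_ge0// ltW.
- by rewrite powR_mono// ltW.
- by rewrite -[leRHS]mulrA ler_wpM2r// mulr_ge0// ltW.
Qed.


Lemma tnorm_rate_duh : tnorm al T eps (fun t => a * duh a g t) ((1 + z) * G).
Proof.
have z0 : 0 < z by case/andP: z01.
split.
- by apply: measurable_funM => //; exact: measurable_duh1.
- move=> t tT; apply: le_trans (integral_duh_le tT) _.
  case: hg => _ /(_ t tT) h _ _; apply: le_trans h _.
  by rewrite lee_fin ler_wpM2l ?powR_ge0// ler_peMl// lerDl ltW.
- by move=> t tT; rewrite normrM (ger0_norm a0); exact: rate_duh_le.
- move=> s t s0 st tT; rewrite -mulrBr normrM (ger0_norm a0).
  have := @rate_duh_diff_le s (t - s) s0; rewrite subr_gt0 addrC subrK; exact.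
Qed.

Variables (om : R).
Hypothesis om1 : 1 <= om.

(** From om + a <= 2 max (om, a), with 2^al <= 2 and om^al <= om. *)
Lemma rho_le : (om + a) `^ al <= 2 * (om + a `^ al).
Proof.
have om0 : 0 <= om by exact: le_trans om1.
have al_0 : 0 < al by case/andP: al01.
have m0 : 0 <= Num.max om a by rewrite le_max om0.
have h : om + a <= 2 * Num.max om a.
  have h1 : om <= Num.max om a by rewrite le_max lexx.
  have h2 : a <= Num.max om a by rewrite le_max lexx orbT.
  lra.
apply: le_trans (powR_mono al01 _ h) _; first by rewrite addr_ge0.
rewrite powRM//; apply: ler_pM; rewrite ?powR_ge0//.
  by apply: powR_le_ge1 => //; rewrite ler1n.
case: (leP om a) => _.
  by rewrite lerDr.
by apply: le_trans (powR_le_ge1 al01 om1) _; rewrite lerDl powR_ge0.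
Qed.

(** Large enough for two uses: [rho_duh_le] needs 2 om + 2 + 4 / eps, and the Lipschitz part of
    [tnorm_rho_duh] needs 4 om + 4. *)
Definition duh_cst : R := 4 * om + 4 + 4 / eps.

Let tau : R := T `^ (1 - al).

Lemma le_powR_tau (s : R) : 0 < s <= T -> s <= tau.
Proof.
move=> /andP[s0 sT].
have h : s <= tau * s `^ al by apply: (le_tau al01); rewrite sT ltW.
apply: le_trans h _; rewrite ler_piMr ?powR_ge0//.
apply: powR_le1 => //; rewrite (ltW s0) (le_trans sT)//; by case/andP: T01.
Qed.

(** An interpolation between |duh| <= t^al G, used when a t <= 1, and a |duh| <= 2 t^(al - 1) G /
    eps, used when a t > 1. In both cases the powers of t cancel against a^al, so the bound has no
    singularity at time 0. *)
Lemma rho_duh_le (t : R) : 0 <= t <= T -> (om + a) `^ al * `|duh a g t| <= duh_cst * G.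
Proof.
move=> /andP[]; rewrite le_eqVlt => /predU1P[<- _|t0 tT].
  rewrite /duh set_itv1 Rintegral_set1 normr0 mulr0 mulr_ge0//.
  by rewrite /duh_cst addr_ge0 ?divr_ge0 ?(ltW e0)//; move: om1; lra.
have tT' : 0 < t <= T by rewrite t0.
have om0 : 0 <= om by exact: le_trans om1.
have d1 := norm_duh_le tT'.
have d2 := rate_duh_le tT'.
have ta1 : t `^ al <= 1.
  apply: powR_le1 => //; rewrite (ltW t0) (le_trans tT)//; by case/andP: T01.
have d1' : `|duh a g t| <= G by apply: le_trans d1 _; rewrite ler_piMl.
have d3 : a `^ al * `|duh a g t| <= (1 + 2 / eps) * G.
  have [at1|at1] := leP (a * t) 1.
    apply: (@le_trans _ _ (a `^ al * (t `^ al * G))); first by rewrite ler_wpM2l ?powR_ge0.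
    rewrite mulrA -powRM//; last exact: ltW.
    apply: (@le_trans _ _ (1 * G)).
      rewrite ler_wpM2r//; apply: powR_le1 => //.
      by rewrite at1 mulr_ge0// ltW.
    by rewrite ler_wpM2r// lerDl divr_ge0// ltW.
  have at0 : 0 < a * t by rewrite (lt_trans _ at1).
  have a00 : 0 < a by move: at0; rewrite pmulr_lgt0.
  apply: (@le_trans _ _ (2 / eps * G)); last by rewrite ler_wpM2r// lerDr.
  have h : a `^ al * t `^ al <= a * t.
    by rewrite -powRM ?(ltW t0)//; apply: powR_le_ge1 => //; exact: ltW.
  rewrite -(ler_pM2l (mulr_gt0 e0 at0)).
  apply: (@le_trans _ _ (a `^ al * (eps * t * (a * `|duh a g t|)))).
    by rewrite le_eqVlt; apply/orP; left; apply/eqP; ring.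
  apply: (@le_trans _ _ (a `^ al * (t `^ al * ((1 + z) * G)))).
    by rewrite ler_wpM2l ?powR_ge0.
  rewrite mulrA (_ : eps * (a * t) * _ = a * t * (2 * G)); last by field; rewrite gt_eqF.
  apply: ler_pM => //; first by rewrite mulr_ge0 ?powR_ge0.
    by rewrite mulr_ge0//; case/andP: z01 => z0 _; rewrite addr_ge0// ltW.
  by rewrite ler_wpM2r//; case/andP: z01; lra.
apply: le_trans (ler_wpM2r (normr_ge0 _) rho_le) _.
apply: (@le_trans _ _ (2 * (om * G + (1 + 2 / eps) * G))).
  by rewrite -mulrA ler_wpM2l// mulrDl lerD// ler_wpM2l.
rewrite -mulrDl mulrA ler_wpM2r// /duh_cst.
by have : 0 <= om; [exact: om0|]; lra.
Qed.

(** As [rho * duh] is bounded up to time 0, its time integral is of order t instead of t^al, and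
    [le_tau] turns the difference into [tau]. This is what makes coagulation small on short
    intervals. *)
Lemma tnorm_rho_duh :
  tnorm al T eps (fun t => (om + a) `^ al * duh a g t) (tau * duh_cst * G).
Proof.
have om0 : 0 <= om by exact: le_trans om1.
have ei : 0 <= 4 / eps by rewrite divr_ge0// ltW.
have C0 : 0 <= duh_cst by rewrite /duh_cst; lra.
have tau0 : 0 <= tau by rewrite powR_ge0.
split.
- by apply: measurable_funM => //; exact: measurable_duh1.
- move=> t tT; have /andP[t0 tT2] := tT.
  apply: (@le_trans _ _ (\int[mu]_(s in `[0%R, t]) (duh_cst * G)%:E)%E).
    apply: ge0_le_integral => //.
    + apply: measurable_abs_EFin; apply: measurable_funM => //; exact: measurable_duh1.
    + move=> s; rewrite /= in_itv/= => /andP[s0 st].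
      rewrite lee_fin normrM ger0_norm ?powR_ge0// rho_duh_le// s0 (le_trans st)//.
  rewrite integral_cst//= lebesgue_measure_itv/= lte_fin t0 oppr0 adde0 -EFinM lee_fin.
  have h : t <= tau * t `^ al by apply: (le_tau al01); rewrite tT2 ltW.
  rewrite (_ : t `^ al * _ = duh_cst * G * (tau * t `^ al)); last by ring.
  by rewrite ler_wpM2l// mulr_ge0.
- move=> t tT; have /andP[t0 tT2] := tT.
  rewrite normrM ger0_norm ?powR_ge0//.
  have h : t <= tau * t `^ al by apply: (le_tau al01); rewrite tT2 ltW.
  rewrite (_ : t `^ al * _ = (tau * t `^ al) * (duh_cst * G)); last by ring.
  apply: ler_pM; rewrite ?mulr_ge0 ?powR_ge0 ?(ltW e0) ?(ltW t0)//.
    apply: le_trans h; rewrite ler_piMl ?(ltW t0)//.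
    by case/andP: eps01 => _; lra.
  by rewrite rho_duh_le// tT2 ltW.
- move=> s t s0 st tT.
  have h0 : 0 < t - s by rewrite subr_gt0.
  have sT : s <= T by rewrite (le_trans (ltW st)).
  have shT : s + (t - s) <= T by rewrite addrC subrK.
  have d1 := duh_diff_le s0 h0 shT; have d2 := rate_duh_diff_le s0 h0 shT.
  have sts : s + (t - s) = t by ring.
  rewrite sts in d1 d2.
  rewrite -mulrBr normrM ger0_norm ?powR_ge0//.
  set D := `|_ - _| in d1 d2 *; set h := t - s in h0 d1 d2 *.
  have s1 : s <= tau by apply: le_powR_tau; rewrite s0.
  have s2 : s <= tau * s `^ al by apply: (le_tau al01); rewrite sT ltW.
  have e12 : eps <= 2^-1 by case/andP: eps01.
  have Gh0 : 0 <= G * h by rewrite mulr_ge0// ltW.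
  have sal0 : 0 <= s `^ al by rewrite powR_ge0.
  have D0 : 0 <= D by exact: normr_ge0.
  have b1 : eps ^+ 2 * s ^+ 2 * D <= 3 * eps * s * (s `^ al * (G * h)).
    apply: (@le_trans _ _ (eps ^+ 2 * s ^+ 2 * (3 * (s `^ al * G / (eps * s)) * h))).
      by rewrite ler_wpM2l// mulr_ge0 ?sqr_ge0.
    by rewrite le_eqVlt; apply/orP; left; apply/eqP; field; rewrite !gt_eqF.
  have b2 : eps ^+ 2 * s ^+ 2 * D <= 2 * tau * (s `^ al * (G * h)).
    apply: le_trans b1 _; rewrite ler_wpM2r ?mulr_ge0//; nra.
  (* The alternative of [rho_duh_le] again: for a s <= 1 the factor s in [b1] absorbs a^al, and
     otherwise a^al s^al <= a s reduces the claim to the bound on [a * D]. *)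
  have b3 : a `^ al * (eps ^+ 2 * s ^+ 2 * D) <= 2 * tau * s `^ al * (G * h).
    have [as1|as1] := leP (a * s) 1.
      apply: (@le_trans _ _ (a `^ al * (3 * eps * s * (s `^ al * (G * h))))).
        by rewrite ler_wpM2l ?powR_ge0.
      rewrite (_ : _ * (3 * _ * _ * _) = 3 * eps * (a `^ al * s `^ al * s) * (G * h)); last by ring.
      rewrite ler_wpM2r// -powRM ?(ltW s0)//.
      have p1 : (a * s) `^ al <= 1.
        apply: powR_le1 => //.
        by rewrite as1 mulr_ge0// ltW.
      have p2 : (a * s) `^ al * s <= s by rewrite ler_piMl// ltW.
      have p3 : 0 <= (a * s) `^ al * s by rewrite mulr_ge0 ?powR_ge0// ltW.
      nra.
    have as0 : 0 < a * s by rewrite (lt_trans _ as1).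
    have a00 : 0 < a by move: as0; rewrite pmulr_lgt0.
    have p1 : a `^ al * s `^ al <= a * s.
      by rewrite -powRM ?(ltW s0)//; apply: powR_le_ge1 => //; exact: ltW.
    rewrite -(ler_pM2l a00).
    apply: (@le_trans _ _ (a `^ al * (s `^ al * ((1 + z) * G * h)))).
      rewrite mulrCA (_ : a * _ = eps ^+ 2 * s ^+ 2 * (a * D)); last by ring.
      by rewrite ler_wpM2l ?powR_ge0.
    have z0 : 0 < z by case/andP: z01.
    have zG : 0 <= (1 + z) * G * h by rewrite -mulrA mulr_ge0// addr_ge0// ltW.
    have zG2 : (1 + z) * G * h <= 2 * (G * h).
      by rewrite -mulrA ler_wpM2r//; case/andP: z01; lra.
    rewrite mulrA; apply: (@le_trans _ _ (a * s * ((1 + z) * G * h))).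
      by rewrite ler_wpM2r.
    rewrite -[leLHS]mulrA (_ : a * (2 * _ * _ * _) = a * (tau * s `^ al * (2 * (G * h)))); last by ring.
    by rewrite ler_wpM2l//; apply: ler_pM => //; exact: ltW.
  rewrite mulrCA.
  apply: (@le_trans _ _ (2 * (om + a `^ al) * (eps ^+ 2 * s ^+ 2 * D))).
    by apply: ler_wpM2r; [rewrite mulr_ge0// mulr_ge0 ?sqr_ge0|exact: rho_le].
  apply: (@le_trans _ _ (2 * (om * (2 * tau * (s `^ al * (G * h))) + 2 * tau * s `^ al * (G * h)))).
    by rewrite -mulrA ler_wpM2l// mulrDl lerD// ler_wpM2l.
  rewrite (_ : 2 * _ = (4 * om + 4) * (tau * (s `^ al * (G * h)))); last by ring.
  rewrite [leRHS](_ : _ = duh_cst * (tau * (s `^ al * (G * h)))); last by ring.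
  by rewrite ler_wpM2r ?mulr_ge0// /duh_cst; lra.
Qed.

End fixed_rate.

Section exponential.
Variables (al T eps a om c : R).
Hypothesis al01 : 0 < al < 1.
Hypothesis T01 : 0 < T <= 1.
Hypothesis eps01 : 0 < eps <= 2^-1.
Hypothesis a0 : 0 <= a.
Hypothesis om1 : 1 <= om.

Let e0 : 0 < eps. Proof. by case/andP: eps01. Qed.
Let e12 : eps <= 2^-1. Proof. by case/andP: eps01. Qed.
Let esq : eps ^+ 2 * 2 <= 1.
Proof.
have h : eps * eps <= 2^-1 * 2^-1 by apply: ler_pM => //; exact: ltW.
by rewrite expr2; lra.
Qed.

Let rho := (om + a) `^ al.
Let tau := T `^ (1 - al).

Lemma powR_le_rho : a `^ al <= rho.
Proof. by apply: powR_mono => //; rewrite lerDr (le_trans _ om1). Qed.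

Lemma expR_diff_le (s t : R) : s <= t ->
  `|expR (- (a * t)) - expR (- (a * s))| <= a * expR (- (a * s)) * (t - s).
Proof.
move=> st.
have -> : expR (- (a * t)) = expR (- (a * s)) * expR (- (a * (t - s))).
  by rewrite -expRD; congr expR; ring.
rewrite -{2}[expR (- (a * s))]mulr1 -mulrBr normrM (ger0_norm (expR_ge0 _)).
rewrite (_ : a * _ * _ = expR (- (a * s)) * (a * (t - s))); last by ring.
rewrite ler_wpM2l ?expR_ge0// distrC.
have h0 : 0 <= a * (t - s) by rewrite mulr_ge0// subr_ge0.
have := expR_ge1Dx (- (a * (t - s))).
rewrite ger0_norm; first by lra.
by rewrite subr_ge0 -expR0 ler_expR oppr_le0.
Qed.

Let measurable_exp : measurable_fun [set: R] (fun t => expR (- (a * t))).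
Proof.
by apply: measurableT_comp => //; apply: measurableT_comp.
Qed.

(** Here the datum is required to have its al-th power of a: each bound leads to (a t)^al = t^al
    a^al, and a^al <= rho. *)
Lemma tnorm_rate_exp : tnorm al T eps (fun t => a * (expR (- (a * t)) * c)) (rho * `|c|).
Proof.
have K t : 0 <= t -> t `^ al * a `^ al <= t `^ al * rho.
  by move=> t0; rewrite ler_wpM2l ?powR_ge0// powR_le_rho.
split.
- by apply: measurable_funM => //; exact: measurable_funM.
- move=> t /andP[t0 tT].
  under eq_integral do rewrite normrM (ger0_norm a0) normrM (ger0_norm (expR_ge0 _)) mulrA mulrC EFinM.
  rewrite ge0_integralZl_EFin//; last 2 first.
  + by move=> s _; rewrite lee_fin mulr_ge0// expR_ge0.
  + by apply/measurable_EFinP; apply: measurable_funTS; exact: measurable_funM.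
  have -> : (\int[mu]_(s in `[0%R, t]) (a * expR (- (a * s)))%:E = (1 - expR (- (a * t)))%:E)%E.
    have := @integral_expR_affine R (- a) 0 0 t (ltW t0).
    rewrite (_ : (fun s => _) = (fun s => - (a * expR (- (a * s)))%:E)%E); last first.
      by apply/funext => s; rewrite addr0 mulNr -EFinN; congr (- (a * expR _))%:E; ring.
    rewrite integral_ge0N; last by move=> s _; rewrite lee_fin mulr_ge0// expR_ge0.
    move/(congr1 (fun x => - x)%E); rewrite oppeK => ->.
    by rewrite -EFinN mulr0 !addr0 expR0 opprB mulNr.
  rewrite -EFinM lee_fin mulrA [leRHS]mulrC ler_wpM2l//.
  apply: le_trans (one_sub_expRN_le_powR al01 (mulr_ge0 a0 (ltW t0))) _.
  by rewrite mulrC powRM// ?(ltW t0)// K// ltW.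
- move=> t /andP[t0 tT].
  rewrite normrM (ger0_norm a0) normrM (ger0_norm (expR_ge0 _)) !mulrA ler_wpM2r//.
  rewrite (_ : _ * _ * _ * _ = eps * (a * t * expR (- (a * t)))); last by ring.
  have h := mul_expRN_le_powR al01 (mulr_ge0 a0 (ltW t0)).
  apply: (@le_trans _ _ ((a * t) `^ al)).
    apply: le_trans h; apply: ler_piMl; first by rewrite !mulr_ge0 ?expR_ge0 ?(ltW t0).
    by apply: le_trans e12 _; lra.
  by rewrite mulrC powRM// ?(ltW t0)// K// ltW.
- move=> s t s0 st tT.
  rewrite -mulrBr -mulrBl normrM (ger0_norm a0) normrM.
  have h := expR_diff_le (ltW st).
  have h2 := sqr_expRN_le_powR al01 (mulr_ge0 a0 (ltW s0)).
  have ts0 : 0 <= t - s by rewrite subr_ge0 ltW.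
  apply: (@le_trans _ _ (eps ^+ 2 * s ^+ 2 * (a * (a * expR (- (a * s)) * (t - s) * `|c|)))).
    apply: ler_wpM2l; first by rewrite mulr_ge0 ?sqr_ge0.
    by apply: ler_wpM2l => //; exact: ler_wpM2r.
  rewrite (_ : eps ^+ 2 * _ * _ = eps ^+ 2 * ((a * s) ^+ 2 * expR (- (a * s))) * (`|c| * (t - s))); last by ring.
  rewrite (_ : s `^ al * _ = s `^ al * rho * (`|c| * (t - s))); last by ring.
  rewrite ler_wpM2r ?mulr_ge0//.
  apply: (@le_trans _ _ ((a * s) `^ al)).
    have p0 : 0 <= (a * s) `^ al by rewrite powR_ge0.
    apply: (@le_trans _ _ (eps ^+ 2 * (2 * (a * s) `^ al))).
      by rewrite ler_wpM2l ?sqr_ge0.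
    by rewrite mulrA ler_piMl.
  by rewrite mulrC powRM// ?(ltW s0)// K// ltW.
Qed.

Lemma rho_exp_le (t : R) : 0 <= t -> rho * `|expR (- (a * t)) * c| <= rho * `|c|.
Proof.
move=> t0; rewrite ler_wpM2l ?powR_ge0// normrM ler_piMl// ger0_norm ?expR_ge0//.
by rewrite -expR0 ler_expR oppr_le0 mulr_ge0.
Qed.

Lemma tnorm_rho_exp : tnorm al T eps (fun t => rho * (expR (- (a * t)) * c)) (tau * (rho * `|c|)).
Proof.
have rho0 : 0 <= rho by rewrite powR_ge0.
have rc0 : 0 <= rho * `|c| by rewrite mulr_ge0.
split.
- by apply: measurable_funM => //; exact: measurable_funM.
- move=> t /andP[t0 tT].
  apply: (@le_trans _ _ (\int[mu]_(s in `[0%R, t]) (rho * `|c|)%:E)%E).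
    apply: ge0_le_integral => //.
    + by apply: measurable_abs_EFin; apply: measurable_funM => //; exact: measurable_funM.
    + move=> s; rewrite /= in_itv/= => /andP[s0 st].
      by rewrite lee_fin normrM ger0_norm// rho_exp_le.
  rewrite integral_cst//= lebesgue_measure_itv/= lte_fin t0 oppr0 adde0 -EFinM lee_fin.
  have h : t <= tau * t `^ al by apply: (le_tau al01); rewrite tT ltW.
  rewrite (_ : t `^ al * _ = rho * `|c| * (tau * t `^ al)); last by ring.
  by rewrite ler_wpM2l.
- move=> t /andP[t0 tT].
  have h : t <= tau * t `^ al by apply: (le_tau al01); rewrite tT ltW.
  rewrite normrM ger0_norm// (_ : t `^ al * _ = (tau * t `^ al) * (rho * `|c|)); last by ring.
  apply: ler_pM; rewrite ?mulr_ge0 ?powR_ge0 ?(ltW e0) ?(ltW t0)//.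
    apply: le_trans h; apply: ler_piMl; first exact: ltW.
    by apply: le_trans e12 _; lra.
  by rewrite rho_exp_le// ltW.
- move=> s t s0 st tT.
  have sT : s <= T by rewrite (le_trans (ltW st)).
  have h : s <= tau * s `^ al by apply: (le_tau al01); rewrite sT ltW.
  have ts0 : 0 <= t - s by rewrite subr_ge0 ltW.
  have hd := expR_diff_le (ltW st).
  rewrite -mulrBr -mulrBl normrM (ger0_norm rho0) normrM.
  apply: (@le_trans _ _ (eps ^+ 2 * s ^+ 2 * (rho * (a * expR (- (a * s)) * (t - s) * `|c|)))).
    apply: ler_wpM2l; first by rewrite mulr_ge0 ?sqr_ge0.
    by apply: ler_wpM2l => //; exact: ler_wpM2r.
  rewrite (_ : eps ^+ 2 * _ * _ = eps ^+ 2 * s * (a * s * expR (- (a * s))) * (rho * `|c| * (t - s))); last by ring.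
  rewrite (_ : s `^ al * _ = tau * s `^ al * (rho * `|c| * (t - s))); last by ring.
  rewrite ler_wpM2r ?mulr_ge0//.
  have m1 := mul_expRN_le1 (a * s).
  have m0 : 0 <= a * s * expR (- (a * s)) by rewrite !mulr_ge0 ?expR_ge0// ltW.
  apply: le_trans h; apply: (@le_trans _ _ (eps ^+ 2 * s * 1)).
    by rewrite ler_wpM2l// mulr_ge0 ?sqr_ge0// ltW.
  rewrite mulr1; apply: ler_piMl; first exact: ltW.
  by have := sqr_ge0 eps; have := esq; lra.
Qed.

End exponential.
End duhamel.

(** * Comparison of integrals almost everywhere, and Minkowski's inequality for the time seminorm *)

Section integral_ae.
Context {R : realType}.
Local Notation mu := (@lebesgue_measure R).

Lemma aeS (P Q : R -> Prop) : (forall x, P x -> Q x) ->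
  {ae mu, forall x, P x} -> {ae mu, forall x, Q x}.
Proof. by move=> PQ; apply: negligibleS => x /= nQ /PQ. Qed.

Lemma aeI (P Q : R -> Prop) : {ae mu, forall x, P x} -> {ae mu, forall x, Q x} ->
  {ae mu, forall x, P x /\ Q x}.
Proof.
move=> hP hQ; have := negligibleU hP hQ; apply: negligibleS => x /= /not_andP[]; [by left|by right].
Qed.

Lemma ge0_integralZ (c : R) (f : R -> R) : 0 <= c -> measurable_fun [set: R] f ->
  (forall x, 0 <= f x) -> (\int[mu]_x (c * f x)%:E = c%:E * \int[mu]_x (f x)%:E)%E.
Proof.
move=> c0 mf f0; under eq_integral do rewrite EFinM.
rewrite ge0_integralZl_EFin//.
- by move=> x _; rewrite lee_fin.
- by apply/measurable_EFinP; exact: mf.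
Qed.

Lemma ge0_integral_add (f g : R -> R) : measurable_fun [set: R] f -> measurable_fun [set: R] g ->
  (forall x, 0 <= f x) -> (forall x, 0 <= g x) ->
  (\int[mu]_x (f x + g x)%:E = \int[mu]_x (f x)%:E + \int[mu]_x (g x)%:E)%E.
Proof.
move=> mf mg f0 g0; under eq_integral do rewrite EFinD.
rewrite ge0_integralD//.
- by move=> x _; rewrite lee_fin.
- by apply/measurable_EFinP; exact: mf.
- by move=> x _; rewrite lee_fin.
- by apply/measurable_EFinP; exact: mg.
Qed.

Lemma tonelli_EFin (F : R * R -> R) : measurable_fun [set: R * R] F -> (forall p, 0 <= F p) ->
  (\int[mu]_x \int[mu]_y (F (x, y))%:E = \int[mu]_y \int[mu]_x (F (x, y))%:E)%E.
Proof.
move=> mF F0.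
apply: (@fubini_tonelli _ _ (measurableTypeR R) (measurableTypeR R) R mu mu (fun p => (F p)%:E)) => //.
- by apply/measurable_EFinP; exact: mF.
Qed.

Lemma measurable_integral_param d (A : measurableType d) (F : A * R -> R) :
  measurable_fun [set: A * R] F -> (forall p, 0 <= F p) ->
  measurable_fun [set: A] (fun x => \int[mu]_y (F (x, y))%:E)%E.
Proof.
move=> mF F0.
apply: (@measurable_fun_fubini_tonelli_F _ _ A (measurableTypeR R) R mu (fun p => (F p)%:E)) => //.
- by apply/measurable_EFinP; exact: mF.
Qed.

Lemma ae_fine_integral (F : R * R -> R) : measurable_fun [set: R * R] F -> (forall p, 0 <= F p) ->
  (\int[mu]_x \int[mu]_y (F (x, y))%:E < +oo)%E ->
  {ae mu, forall x, (\int[mu]_y (F (x, y))%:E < +oo)%E}.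
Proof.
move=> mF F0 fin.
have mI := measurable_integral_param mF F0.
have hI : mu.-integrable [set: R] (fun x => \int[mu]_y (F (x, y))%:E)%E.
  apply/integrableP; split => //.
  apply: le_lt_trans fin; apply: ge0_le_integral => //.
  - exact: measurableT_comp.
  - move=> x _; rewrite gee0_abs//; apply: integral_ge0 => y _; by rewrite lee_fin.
have := integrable_ae measurableT hI.
apply: aeS => x /(_ I); rewrite ge0_fin_numE//.
by apply: integral_ge0 => y _; rewrite lee_fin.
Qed.

Lemma ae_integral_le (f g : R -> R) : measurable_fun [set: R] f -> measurable_fun [set: R] g ->
  (forall x, 0 <= f x) -> (forall x, 0 <= g x) -> {ae mu, forall x, f x <= g x} ->
  (\int[mu]_x (f x)%:E <= \int[mu]_x (g x)%:E)%E.
Proof.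
move=> mf mg f0 g0 fg; apply: ae_ge0_le_integral => //.
- by move=> x _; rewrite lee_fin.
- exact/measurable_EFinP.
- by move=> x _; rewrite lee_fin.
- exact/measurable_EFinP.
- by apply: aeS fg => x h _; rewrite lee_fin.
Qed.

Lemma norm_Rintegral_ae_le (f h : R -> R) (c C : R) :
  measurable_fun [set: R] f -> measurable_fun [set: R] h -> (forall x, 0 <= h x) ->
  0 <= c -> {ae mu, forall x, c * `|f x| <= h x} ->
  (\int[mu]_x (h x)%:E <= C%:E)%E -> c * `|\int[mu]_x f x| <= C.
Proof.
move=> mf mh h0 c0 fh hC; rewrite -lee_fin; apply: le_trans hC.
have mE : measurable_fun [set: R] (EFin \o f) by exact/measurable_EFinP.
rewrite /Rintegral EFinM.
apply: (@le_trans _ _ (c%:E * `|\int[mu]_x (f x)%:E|))%E.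
  rewrite lee_wpmul2l ?lee_fin//.
  by case: (\int[mu]_x (f x)%:E)%E => //= *; rewrite ?normr0 ?leey.
apply: (@le_trans _ _ (c%:E * \int[mu]_x `|(f x)%:E|))%E.
  by rewrite lee_wpmul2l ?lee_fin//; exact: le_abse_integral.
rewrite -ge0_integralZl_EFin//; last exact: measurableT_comp.
under eq_integral do rewrite abse_EFin -EFinM.
apply: ae_integral_le => //.
- by apply: measurable_funM => //; exact: measurableT_comp.
- by move=> x; rewrite mulr_ge0.
Qed.

Lemma Rintegral_itv_param (F : R * R -> R) (t : R) : measurable_fun [set: R * R] F ->
  measurable_fun [set: R] (fun y => (\int[mu]_(s in `[0%R, t]) `|F (s, y)|%:E))%E.
Proof.
move=> mF.
have -> : (fun y => (\int[mu]_(s in `[0%R, t]) `|F (s, y)|%:E))%E =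
  (fun y => \int[mu]_s ((fun q => (if (0 <= q.1) && (q.1 <= t) then `|F q| else 0)%:E) (s, y)))%E.
  apply/funext => y; rewrite integral_mkcond; apply: eq_integral => s _.
  by rewrite patchE mem_setE in_itv/=; case: ifP.
apply: (@measurable_fun_fubini_tonelli_G _ _ (measurableTypeR R) R R mu
  (fun q => (if (0 <= q.1) && (q.1 <= t) then `|F q| else 0)%:E)).
- apply/measurable_EFinP; apply: measurable_fun_ifT => //.
  + by apply: measurable_and; exact: measurable_fun_ler.
  + exact: measurableT_comp.
- by move=> q; rewrite lee_fin; case: ifP.
Qed.

Section minkowski.
Variables (al T eps : R).
Hypothesis al01 : 0 < al < 1.
Hypothesis T01 : 0 < T <= 1.
Hypothesis eps01 : 0 < eps <= 2^-1.
Variables (p : R * R -> R) (gam : R -> R).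
Hypothesis mp : measurable_fun [set: R * R] p.
Hypothesis mgam : measurable_fun [set: R] gam.
Hypothesis gam0 : forall y, 0 <= gam y.
Hypothesis hp : {ae mu, forall y, tnorm al T eps (fun t => p (t, y)) (gam y)}.
Hypothesis fgam : (\int[mu]_y (gam y)%:E < +oo)%E.

Let e0 : 0 < eps. Proof. by case/andP: eps01. Qed.

Let mpt (t : R) : measurable_fun [set: R] (fun y => p (t, y)).
Proof. exact: measurableT_comp mp (@pair1_measurable _ _ _ _ t). Qed.

Let fin_gam : (\int[mu]_y (gam y)%:E)%E \is a fin_num.
Proof. by rewrite ge0_fin_numE//; apply: integral_ge0 => y _; rewrite lee_fin. Qed.

Lemma minkowski_integrable (t : R) : 0 < t <= T -> mu.-integrable [set: R] (fun y => (p (t, y))%:E).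
Proof.
move=> tT; have /andP[t0 _] := tT.
have et : 0 < eps * t by rewrite mulr_gt0.
apply/integrableP; split; first by apply/measurable_EFinP; exact: mpt.
apply: (@le_lt_trans _ _ (\int[mu]_y (((eps * t)^-1 * t `^ al) * gam y)%:E)%E).
  apply: ae_integral_le => //.
  - exact: measurableT_comp.
  - exact: measurable_funM.
  - by move=> y; rewrite !mulr_ge0 ?invr_ge0 ?(ltW et) ?powR_ge0.
  - apply: aeS hp => y [_ _ /(_ t tT) h _].
    by rewrite -mulrA ler_pdivlMl.
rewrite ge0_integralZ//; first by rewrite -(fineK fin_gam) -EFinM ltey.
by rewrite mulr_ge0 ?powR_ge0 ?invr_ge0 ?(ltW et).
Qed.

(** Integration over y passes inside the seminorm. The integrated bound is Tonelli; the other two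
    hold at fixed times, where [minkowski_integrable] makes the integral of a difference the
    difference of the integrals. *)
Lemma tnorm_minkowski :
  tnorm al T eps (fun t => \int[mu]_y p (t, y)) (fine (\int[mu]_y (gam y)%:E)).
Proof.
have gamZ (c : R) : 0 <= c ->
    (\int[mu]_y (c * gam y)%:E = (c * fine (\int[mu]_y (gam y)%:E))%:E)%E.
  by move=> c0; rewrite ge0_integralZ// EFinM fineK.
have gamZ0 (c : R) : 0 <= c -> forall y, 0 <= c * gam y by move=> c0 y; rewrite mulr_ge0.
have mgamZ (c : R) : measurable_fun [set: R] (fun y => c * gam y) by exact: measurable_funM.
split.
- exact: measurable_Rintegral_param.
- move=> t tT; have tal : 0 <= t `^ al by rewrite powR_ge0.
  apply: (@le_trans _ _ (\int[mu]_(s in `[0%R, t]) \int[mu]_y `|p (s, y)|%:E)%E).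
    apply: ge0_le_integral => //.
    + apply: measurable_abs_EFin; exact: measurable_Rintegral_param.
    + apply: measurable_funTS.
      apply: (@measurable_fun_fubini_tonelli_F _ _ R (measurableTypeR R) R mu (fun q => `|p q|%:E)) => //.
      by apply/measurable_EFinP; exact: measurableT_comp.
    + move=> s _; rewrite /Rintegral.
      have h := @le_abse_integral _ _ _ mu setT (fun y => (p (s, y))%:E) measurableT.
      apply: le_trans (h _); last by apply/measurable_EFinP; exact: mpt.
      by case: (\int[mu]_y (p (s, y))%:E)%E => //= *; rewrite ?normr0 ?leey.
  rewrite integral_mkcond.
  apply: (@le_trans _ _ (\int[mu]_s \int[mu]_y
      ((fun q => (if (0 <= q.1) && (q.1 <= t) then `|p q| else 0)%:E) (s, y)))%E).
    rewrite le_eqVlt; apply/orP; left; apply/eqP.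
    apply: eq_integral => s _; rewrite patchE mem_setE in_itv/=; case: ifP => // sI.
    by rewrite integral0.
  rewrite (@fubini_tonelli _ _ (measurableTypeR R) (measurableTypeR R) R mu mu
     (fun q => (if (0 <= q.1) && (q.1 <= t) then `|p q| else 0)%:E)); last 2 first.
  + apply/measurable_EFinP; apply: measurable_fun_ifT => //.
      by apply: measurable_and; exact: measurable_fun_ler.
    exact: measurableT_comp.
  + by move=> q; rewrite lee_fin; case: ifP.
  rewrite -gamZ//.
  have E y : (\int[mu]_s (if (0 <= s) && (s <= t) then `|p (s, y)| else 0)%:E =
    \int[mu]_(s in `[0%R, t]) `|p (s, y)|%:E)%E.
    rewrite [RHS]integral_mkcond; apply: eq_integral => s _.
    by rewrite patchE mem_setE in_itv/=; case: ifP.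
  apply: ae_ge0_le_integral => //.
  + by move=> y _; apply: integral_ge0 => s _; rewrite lee_fin; case: ifP.
  + under eq_fun do rewrite /= E; exact: Rintegral_itv_param.
  + by move=> y _; rewrite lee_fin gamZ0.
  + by apply/measurable_EFinP; exact: mgamZ.
  + apply: aeS hp => y [_ /(_ t tT) h _ _] _.
    by rewrite /= E.
- move=> t tT; have /andP[t0 _] := tT.
  apply: (@norm_Rintegral_ae_le _ (fun y => t `^ al * gam y)) => //.
  + by apply: gamZ0; rewrite powR_ge0.
  + by rewrite ltW// mulr_gt0.
  + by apply: aeS hp => y [_ _ /(_ t tT) h _].
  + by rewrite gamZ ?powR_ge0.
- move=> s t s0 st tT.
  have ts : 0 <= t - s by rewrite subr_ge0 ltW.
  rewrite -RintegralB//; last 2 first.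
  + by apply: minkowski_integrable; rewrite tT andbT (lt_trans s0).
  + by apply: minkowski_integrable; rewrite s0 (le_trans (ltW st)).
  have c0 : 0 <= s `^ al * (t - s) by rewrite mulr_ge0 ?powR_ge0.
  apply: (@norm_Rintegral_ae_le _ (fun y => s `^ al * (t - s) * gam y)) => //.
  + exact: measurable_funB.
  + exact: gamZ0.
  + by rewrite mulr_ge0 ?sqr_ge0.
  + apply: aeS hp => y [_ _ _ /(_ s t s0 st tT) h].
    by rewrite -[leRHS]mulrA [(t - s) * _]mulrC.
  + by rewrite gamZ// -mulrA [(t - s) * _]mulrC.
Qed.

End minkowski.
End integral_ae.

(** * The coagulation-fragmentation kernel in weighted L1 spaces *)

Section weighted_norm.
Context {R : realType}.
Local Notation mu := (@lebesgue_measure R).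
Variable w : R -> R.
Hypothesis mw : measurable_fun [set: R] w.
Hypothesis w1 : forall x, 1 <= w x.

Let w0 x : 0 <= w x. Proof. exact: le_trans (w1 x). Qed.

Definition nw (G : R -> R) : \bar R := (\int[mu]_x (G x * w x)%:E)%E.

Lemma nw_ge0 G : (forall x, 0 <= G x) -> (0 <= nw G)%E.
Proof. by move=> G0; apply: integral_ge0 => x _; rewrite lee_fin mulr_ge0. Qed.

Lemma nwD (G H : R -> R) : measurable_fun [set: R] G -> measurable_fun [set: R] H ->
  (forall x, 0 <= G x) -> (forall x, 0 <= H x) ->
  (nw (fun x => G x + H x)%R = nw G + nw H)%E.
Proof.
move=> mG mH G0 H0; rewrite /nw -ge0_integral_add.
- by under eq_integral do rewrite mulrDl.
- exact: measurable_funM.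
- exact: measurable_funM.
- by move=> x; rewrite mulr_ge0.
- by move=> x; rewrite mulr_ge0.
Qed.

Lemma nwZ (c : R) (G : R -> R) : 0 <= c -> measurable_fun [set: R] G -> (forall x, 0 <= G x) ->
  (nw (fun x => c * G x)%R = c%:E * nw G)%E.
Proof.
move=> c0 mG G0; rewrite /nw -ge0_integralZ//.
- by under eq_integral do rewrite -mulrA.
- exact: measurable_funM.
- by move=> x; rewrite mulr_ge0.
Qed.

Lemma nw_le (G H : R -> R) : measurable_fun [set: R] G -> measurable_fun [set: R] H ->
  (forall x, 0 <= G x) -> (forall x, 0 <= H x) -> {ae mu, forall x, G x <= H x} ->
  (nw G <= nw H)%E.
Proof.
move=> mG mH G0 H0 GH; apply: ae_integral_le.
- exact: measurable_funM.
- exact: measurable_funM.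
- by move=> x; rewrite mulr_ge0.
- by move=> x; rewrite mulr_ge0.
- by apply: aeS GH => x h; rewrite ler_wpM2r.
Qed.

Lemma integral_le_nw (G : R -> R) : measurable_fun [set: R] G -> (forall x, 0 <= G x) ->
  (\int[mu]_x (G x)%:E <= nw G)%E.
Proof.
move=> mG G0; apply: ae_integral_le => //.
- exact: measurable_funM.
- by move=> x; rewrite mulr_ge0.
- by apply: aeW => x; rewrite ler_peMr.
Qed.

Variables (Cw : R).
Hypothesis Cw0 : 0 <= Cw.
Hypothesis wadd : forall x y, w (x + y) <= Cw * (w x * w y).

Lemma measurable_prod2 (G H : R -> R) : measurable_fun [set: R] G -> measurable_fun [set: R] H ->
  measurable_fun [set: R * R] (fun p => G p.1 * H p.2).
Proof. by move=> mG mH; apply: measurable_funM; exact: measurableT_comp. Qed.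

Lemma measurable_conv2 (G H : R -> R) : measurable_fun [set: R] G -> measurable_fun [set: R] H ->
  measurable_fun [set: R * R] (fun p => G (p.1 - p.2) * H p.2).
Proof.
move=> mG mH; apply: measurable_funM; last exact: measurableT_comp.
by apply: (measurableT_comp mG); exact: measurable_funB.
Qed.

(** Only one factor carries the weight; the other is bounded by its weighted norm because w >= 1. *)
Lemma nw_prod (G H : R -> R) (cG cH : R) : measurable_fun [set: R] G -> measurable_fun [set: R] H ->
  (forall x, 0 <= G x) -> (forall x, 0 <= H x) -> (nw G <= cG%:E)%E -> (nw H <= cH%:E)%E ->
  (\int[mu]_x \int[mu]_y (G x * H y * w x)%:E <= (cG * cH)%:E)%E.
Proof.
move=> mG mH G0 H0 hG hH.
have cH0 : 0 <= cH by rewrite -lee_fin; apply: le_trans hH; exact: nw_ge0.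
have cG0 : 0 <= cG by rewrite -lee_fin; apply: le_trans hG; exact: nw_ge0.
apply: (@le_trans _ _ (\int[mu]_x (cH * (G x * w x))%:E)%E); last first.
  rewrite ge0_integralZ//; last 2 first.
  - exact: measurable_funM.
  - by move=> x; rewrite mulr_ge0.
  by rewrite mulrC EFinM lee_wpmul2l ?lee_fin.
apply: ge0_le_integral => //.
- by move=> x _; apply: integral_ge0 => y _; rewrite lee_fin !mulr_ge0.
- apply: (@measurable_integral_param _ _ _ (fun p => G p.1 * H p.2 * w p.1)).
    by apply: measurable_funM; [exact: measurable_prod2|exact: measurableT_comp].
  by move=> p; rewrite !mulr_ge0.
- by apply/measurable_EFinP; apply: measurable_funM => //; exact: measurable_funM.
- move=> x _; under eq_integral do rewrite mulrAC.
  rewrite (ge0_integralZ (mulr_ge0 (G0 x) (w0 x)) mH H0) [leRHS](_ : _ = (G x * w x)%:E * cH%:E)%E; last by rewrite -EFinM mulrC.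
  apply: lee_wpmul2l; first by rewrite lee_fin mulr_ge0.
  by apply: le_trans hH; exact: integral_le_nw.
Qed.

(** Young's inequality for convolutions, with the weight distributed over both factors by [wadd];
    then Tonelli and translation invariance. *)
Lemma nw_conv (G H : R -> R) (cG cH : R) : measurable_fun [set: R] G -> measurable_fun [set: R] H ->
  (forall x, 0 <= G x) -> (forall x, 0 <= H x) -> (nw G <= cG%:E)%E -> (nw H <= cH%:E)%E ->
  (\int[mu]_x \int[mu]_y (G (x - y) * H y * w x)%:E <= (Cw * (cG * cH))%:E)%E.
Proof.
move=> mG mH G0 H0 hG hH.
have cH0 : 0 <= cH by rewrite -lee_fin; apply: le_trans hH; exact: nw_ge0.
have cG0 : 0 <= cG by rewrite -lee_fin; apply: le_trans hG; exact: nw_ge0.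
have mGw : measurable_fun [set: R] (fun x => G x * w x) by exact: measurable_funM.
have mHw : measurable_fun [set: R] (fun x => H x * w x) by exact: measurable_funM.
have Gw0 x : 0 <= G x * w x by rewrite mulr_ge0.
have Hw0 x : 0 <= H x * w x by rewrite mulr_ge0.
pose F (p : R * R) := Cw * ((G (p.1 - p.2) * w (p.1 - p.2)) * (H p.2 * w p.2)).
have mF : measurable_fun [set: R * R] F.
  by apply: measurable_funM => //; exact: (measurable_conv2 mGw mHw).
have F0 p : 0 <= F p by rewrite mulr_ge0// mulr_ge0.
apply: (@le_trans _ _ (\int[mu]_x \int[mu]_y (F (x, y))%:E)%E).
  have mL : measurable_fun [set: R * R] (fun p => G (p.1 - p.2) * H p.2 * w p.1).
    by apply: measurable_funM; [exact: measurable_conv2|exact: measurableT_comp].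
  apply: ge0_le_integral => //.
  - by move=> x _; apply: integral_ge0 => y _; rewrite lee_fin !mulr_ge0.
  - by apply: (@measurable_integral_param _ _ _ _ mL) => p; rewrite !mulr_ge0.
  - exact: measurable_integral_param.
  - move=> x _; apply: ae_integral_le.
    + exact: measurableT_comp mL (@pair1_measurable _ _ _ _ x).
    + exact: measurableT_comp mF (@pair1_measurable _ _ _ _ x).
    + by move=> y; rewrite !mulr_ge0.
    + by move=> y; exact: F0.
    + apply: aeW => y; rewrite /F/=.
      rewrite (_ : Cw * _ = G (x - y) * H y * (Cw * (w (x - y) * w y))); last by ring.
      rewrite ler_wpM2l ?mulr_ge0//.
      by have := wadd (x - y) y; rewrite subrK.
rewrite tonelli_EFin//.
apply: (@le_trans _ _ (\int[mu]_y ((Cw * cG) * (H y * w y))%:E)%E); last first.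
  rewrite (ge0_integralZ (mulr_ge0 Cw0 cG0) mHw Hw0) mulrA [leRHS]EFinM.
  by apply: lee_wpmul2l; first by rewrite lee_fin mulr_ge0.
have mFy y : measurable_fun [set: R] (fun x => F (x, y)).
  exact: measurableT_comp mF (@pair2_measurable _ _ _ _ y).
apply: ge0_le_integral => //.
- by move=> y _; apply: integral_ge0 => x _; rewrite lee_fin.
- apply: (@measurable_integral_param _ _ _ (fun p => F (p.2, p.1))) => //.
  exact: measurableT_comp mF (@measurable_swap _ _ _ _).
- by apply/measurable_EFinP; exact: measurable_funM.
- move=> y _; rewrite /F/=.
  under eq_integral do rewrite [X in Cw * X]mulrC mulrA.
  have mGs : measurable_fun [set: R] (fun x => G (x - y) * w (x - y)).
    by apply: (measurableT_comp mGw); exact: measurable_funB.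
  rewrite (ge0_integralZ (mulr_ge0 Cw0 (Hw0 y)) mGs (fun x => Gw0 (x - y))).
  rewrite (@ge0_integral_shift _ (- y) (fun x => (G x * w x)%:E)); last 2 first.
  + by apply/measurable_EFinP.
  + by move=> x; rewrite lee_fin.
  rewrite (_ : Cw * cG * _ = (Cw * (H y * w y)) * cG); last by ring.
  by rewrite [leRHS]EFinM; apply: lee_wpmul2l; first by rewrite lee_fin mulr_ge0.
Qed.

End weighted_norm.

Section double_integral.
Context {R : realType}.
Local Notation mu := (@lebesgue_measure R).

Lemma measurable_section1 (F : R * R -> R) (x : R) : measurable_fun [set: R * R] F ->
  measurable_fun [set: R] (fun y => F (x, y)).
Proof. by move=> mF; exact: measurableT_comp mF (@pair1_measurable _ _ _ _ x). Qed.

Lemma measurable_section2 (F : R * R -> R) (y : R) : measurable_fun [set: R * R] F ->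
  measurable_fun [set: R] (fun x => F (x, y)).
Proof. by move=> mF; exact: measurableT_comp mF (@pair2_measurable _ _ _ _ y). Qed.

Lemma dint_add (F G : R * R -> R) : measurable_fun [set: R * R] F -> measurable_fun [set: R * R] G ->
  (forall p, 0 <= F p) -> (forall p, 0 <= G p) ->
  (\int[mu]_x \int[mu]_y (F (x, y) + G (x, y))%:E =
   \int[mu]_x \int[mu]_y (F (x, y))%:E + \int[mu]_x \int[mu]_y (G (x, y))%:E)%E.
Proof.
move=> mF mG F0 G0; rewrite -ge0_integralD//.
- apply: eq_integral => x _; apply: ge0_integral_add => //; exact: measurable_section1.
- by move=> x _; apply: integral_ge0 => y _; rewrite lee_fin.
- exact: measurable_integral_param.
- by move=> x _; apply: integral_ge0 => y _; rewrite lee_fin.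
- exact: measurable_integral_param.
Qed.

Lemma dintZ (c : R) (F : R * R -> R) : 0 <= c -> measurable_fun [set: R * R] F ->
  (forall p, 0 <= F p) ->
  (\int[mu]_x \int[mu]_y (c * F (x, y))%:E = c%:E * \int[mu]_x \int[mu]_y (F (x, y))%:E)%E.
Proof.
move=> c0 mF F0; rewrite -ge0_integralZl_EFin//.
- apply: eq_integral => x _; apply: ge0_integralZ => //; exact: measurable_section1.
- by move=> x _; apply: integral_ge0 => y _; rewrite lee_fin.
- exact: measurable_integral_param.
Qed.

End double_integral.

(** * The gain-loss rate, its dominating functions and their weighted norms *)

Section coagulation_fragmentation_kernel.
Context {R : realType}.
Local Notation mu := (@lebesgue_measure R).
Variables (al T eps om K Cw q M : R) (a w : R -> R) (b k : R * R -> R).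
Hypothesis al01 : 0 < al < 1.
Hypothesis T01 : 0 < T <= 1.
Hypothesis eps01 : 0 < eps <= 2^-1.
Hypothesis om1 : 1 <= om.
Hypothesis ma : measurable_fun [set: R] a.
Hypothesis a0 : forall x, 0 <= a x.
Hypothesis mw : measurable_fun [set: R] w.
Hypothesis w1 : forall x, 1 <= w x.
Hypothesis Cw0 : 0 <= Cw.
Hypothesis wadd : forall x y, w (x + y) <= Cw * (w x * w y).
Hypothesis mb : measurable_fun [set: R * R] b.
Hypothesis b0 : forall p, 0 <= b p.
Hypothesis mk : measurable_fun [set: R * R] k.
Hypothesis K0 : 0 <= K.
Let rho x := (om + a x) `^ al.
Hypothesis kle : forall x y, `|k (x, y)| <= K * (rho x * rho y).
Hypothesis q0 : 0 <= q.
Hypothesis M1 : 1 <= M.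
Hypothesis q1 : q <= 1.
(* for large particles fragmentation is dominated by absorption, for small ones its rate is bounded *)
Hypothesis bw : {ae mu, forall y,
  (\int[mu]_x (b (x, y) * w x)%:E <= (q * w y)%:E)%E \/
  (\int[mu]_x (b (x, y) * w x)%:E <= (M * w y)%:E)%E /\ a y <= M}.

Let tau := T `^ (1 - al).
Let w0 x : 0 <= w x. Proof. exact: le_trans (w1 x). Qed.
Let tau0 : 0 <= tau. Proof. exact: powR_ge0. Qed.

(** The argument is ((t, x), y). Integration over all y gives the fragmentation gain, half the
    coagulation gain and the coagulation loss; the absorption - a u is left out, being part of
    Duhamel's exponential. The domains of integration are encoded in the vanishing of b and k
    outside their cones. *)
Definition rker (u : R * R -> R) (r : (R * R) * R) : R :=
  b (r.1.2, r.2) * (a r.2 * u (r.1.1, r.2)) +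
  2^-1 * (k (r.1.2 - r.2, r.2) * (u (r.1.1, r.1.2 - r.2) * u (r.1.1, r.2))) -
  k (r.1.2, r.2) * (u (r.1.1, r.1.2) * u (r.1.1, r.2)).

(** The pair of bounds that [tnormM] asks of each factor: the supremum, and the seminorm with the
    gain [tau]. *)
Definition good (v : R -> R) (x : R) (Q : R) : Prop :=
  (forall t : R, 0 <= t <= T -> `|rho x * v t| <= Q) /\
  tnorm al T eps (fun t => rho x * v t) (tau * Q).

(* [A], [Q] and [dQ] bound, uniformly in time, [a * (u' - u)], [rho * u] and [rho * (u' - u)]. *)
Definition rdom (A Q dQ : R -> R) (p : R * R) : R :=
  b p * A p.2 + K * tau * (dQ (p.1 - p.2) * Q p.2 + Q (p.1 - p.2) * dQ p.2) +
  2 * K * tau * (dQ p.1 * Q p.2 + Q p.1 * dQ p.2).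

Lemma rho_gt0 x : 0 < rho x.
Proof. by rewrite powR_gt0// (lt_le_trans ltr01)// (le_trans om1)// lerDl. Qed.

Lemma good_ge0 v x Q : good v x Q -> 0 <= Q.
Proof.
case=> h _; apply: le_trans (h 0 _) => //.
by case/andP: T01 => T0 _; rewrite lexx ltW.
Qed.

(** The two factors rho that bound the kernel are handed over to the two densities. *)
Lemma tnorm_kprod (v1 v2 : R -> R) (x1 x2 Q1 Q2 c : R) :
  `|c| <= K * (rho x1 * rho x2) -> good v1 x1 Q1 -> good v2 x2 Q2 ->
  tnorm al T eps (fun t => c * (v1 t * v2 t)) (2 * K * tau * (Q1 * Q2)).
Proof.
move=> hc g1 g2; have Q10 := good_ge0 g1; have Q20 := good_ge0 g2.
case: g1 g2 => [s1 t1] [s2 t2].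
have r1 := rho_gt0 x1; have r2 := rho_gt0 x2.
have h := tnormZ (c / (rho x1 * rho x2)) (tnormM T01 eps01 s1 s2 t1 t2).
apply: (@tnorm_eq _ al T eps (fun t => c / (rho x1 * rho x2) * (rho x1 * v1 t * (rho x2 * v2 t)))).
  by move=> t /=; field; rewrite !gt_eqF.
apply: tnorm_le h.
rewrite (_ : 2 * K * tau * _ = K * (2 * tau * Q1 * Q2)); last by ring.
rewrite ler_wpM2r ?mulr_ge0//.
by rewrite normrM normfV (ger0_norm (mulr_ge0 (ltW r1) (ltW r2))) ler_pdivrMr ?mulr_gt0.
Qed.

Section difference.
Variables (u u' : R * R -> R) (A Q dQ : R -> R).
Hypothesis mu_u : measurable_fun [set: R * R] u.
Hypothesis mu_u' : measurable_fun [set: R * R] u'.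
Hypothesis mA : measurable_fun [set: R] A.
Hypothesis A0 : forall x, 0 <= A x.
Hypothesis mQ : measurable_fun [set: R] Q.
Hypothesis Q0 : forall x, 0 <= Q x.
Hypothesis mdQ : measurable_fun [set: R] dQ.
Hypothesis dQ0 : forall x, 0 <= dQ x.
Hypothesis hu : {ae mu, forall y,
  tnorm al T eps (fun t => a y * (u' (t, y) - u (t, y))) (A y) /\
  (good (fun t => u (t, y)) y (Q y) /\ good (fun t => u' (t, y)) y (Q y)) /\
  good (fun t => u' (t, y) - u (t, y)) y (dQ y)}.
Hypothesis fin : (\int[mu]_x \int[mu]_y (rdom A Q dQ (x, y) * w x)%:E < +oo)%E.

(** The quadratic terms are expanded as (v1' - v1) v2' + v1 (v2' - v2). The factor 1/2 of the gain
    cancels the 2 of [tnorm_kprod], so in [rdom] the loss weighs twice as much. *)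
Lemma rker_diff_tnorm : {ae mu, forall x, {ae mu, forall y,
  tnorm al T eps (fun t => rker u' ((t, x), y) - rker u ((t, x), y)) (rdom A Q dQ (x, y))}}.
Proof.
move: (hu); apply: aeS => x hx.
(* The hypothesis is needed at the three sizes x, y and [x - y]. *)
have h2 := aeI hu (ae_reflect x hu); move: h2; apply: aeS => y [hy hxy].
case: hx => _ [[ux u'x] dx]; case: hy => ay [[uy u'y] dy].
case: hxy => _ [[uxy u'xy] dxy].
rewrite /rdom /=.
have H1 := tnormZ (b (x, y)) ay.
rewrite (ger0_norm (b0 _)) in H1.
have H2 := tnormZ (2^-1) (tnormD eps01 (tnorm_kprod (kle (x - y) y) dxy u'y) (tnorm_kprod (kle (x - y) y) uxy dy)).
have H3 := tnormD eps01 (tnorm_kprod (kle x y) dx u'y) (tnorm_kprod (kle x y) ux dy).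
have H := tnormB eps01 (tnormD eps01 H1 H2) H3.
apply: tnorm_eq (tnorm_le _ H).
  by move=> t; rewrite /rker/=; field.
have h2 : `|2^-1 : R| = 2^-1 by rewrite ger0_norm// invr_ge0.
by rewrite h2 le_eqVlt; apply/orP; left; apply/eqP; field.
Qed.

Lemma measurable_rker (v : R * R -> R) : measurable_fun [set: R * R] v ->
  measurable_fun [set: (R * R) * R] (rker v).
Proof.
move=> mv.
have m11 : measurable_fun [set: (R * R) * R] (fun q => q.1.1).
  exact: (measurableT_comp (@measurable_fst _ _ _ _) (@measurable_fst _ _ _ _)).
have m12 : measurable_fun [set: (R * R) * R] (fun q => q.1.2).
  exact: (measurableT_comp (@measurable_snd _ _ _ _) (@measurable_fst _ _ _ _)).
have m2 : measurable_fun [set: (R * R) * R] (fun q => q.2) by exact: measurable_snd.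
have m122 : measurable_fun [set: (R * R) * R] (fun q => q.1.2 - q.2) by exact: measurable_funB.
have P (g : R * R -> R) (f1 f2 : (R * R) * R -> R) : measurable_fun [set: R * R] g ->
    measurable_fun [set: (R * R) * R] f1 -> measurable_fun [set: (R * R) * R] f2 ->
    measurable_fun [set: (R * R) * R] (fun q => g (f1 q, f2 q)).
  by move=> mg m1 m2'; apply: (measurableT_comp mg); exact: measurable_fun_pair.
apply: measurable_funB; [apply: measurable_funD|].
- apply: measurable_funM; first exact: P.
  by apply: measurable_funM; [exact: measurableT_comp|exact: P].
- apply: measurable_funM => //; apply: measurable_funM; first exact: P.
  by apply: measurable_funM; exact: P.
- apply: measurable_funM; first exact: P.
  by apply: measurable_funM; exact: P.
Qed.

Lemma measurable_rdom : measurable_fun [set: R * R] (rdom A Q dQ).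
Proof.
apply: measurable_funD; [apply: measurable_funD|].
- by apply: measurable_funM => //; exact: measurableT_comp.
- by apply: measurable_funM => //; apply: measurable_funD; exact: measurable_conv2.
- by apply: measurable_funM => //; apply: measurable_funD; exact: measurable_prod2.
Qed.

Lemma rdom_ge0 p : 0 <= rdom A Q dQ p.
Proof. by rewrite /rdom !addr_ge0 ?mulr_ge0 ?addr_ge0 ?mulr_ge0. Qed.

Definition rdomint (x : R) : R := fine (\int[mu]_y (rdom A Q dQ (x, y))%:E).

Lemma ae_rdom_fin : {ae mu, forall x, (\int[mu]_y (rdom A Q dQ (x, y))%:E < +oo)%E}.
Proof.
have mF : measurable_fun [set: R * R] (fun p => rdom A Q dQ p * w p.1).
  by apply: measurable_funM; [exact: measurable_rdom|exact: measurableT_comp].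
have := ae_fine_integral mF (fun p => mulr_ge0 (rdom_ge0 p) (w0 p.1)) fin.
apply: aeS => x; apply: le_lt_trans.
have mrx : measurable_fun [set: R] (fun y => rdom A Q dQ (x, y)).
  exact: measurableT_comp measurable_rdom (@pair1_measurable _ _ _ _ x).
apply: ae_integral_le => //.
- exact: (measurable_funM mrx (measurable_cst (w x))).
- by move=> y; exact: rdom_ge0.
- by move=> y; rewrite mulr_ge0// rdom_ge0.
- by apply: aeW => y; rewrite ler_peMr// rdom_ge0.
Qed.

Lemma measurable_rdomint : measurable_fun [set: R] rdomint.
Proof.
apply: (measurableT_comp (fine_measurable measurableT)).
exact: (measurable_integral_param measurable_rdom rdom_ge0).
Qed.

Lemma rdomint_ge0 x : 0 <= rdomint x.
Proof. by apply: fine_ge0; apply: integral_ge0 => y _; rewrite lee_fin rdom_ge0. Qed.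

(** Only an inequality, since [fine] replaces an infinite inner integral by 0. *)
Lemma nw_rdomint_le : (nw w rdomint <= \int[mu]_x \int[mu]_y (rdom A Q dQ (x, y) * w x)%:E)%E.
Proof.
have mF : measurable_fun [set: R * R] (fun p => rdom A Q dQ p * w p.1).
  by apply: measurable_funM; [exact: measurable_rdom|exact: measurableT_comp].
apply: ge0_le_integral => //.
- by move=> x _; rewrite lee_fin mulr_ge0// rdomint_ge0.
- by apply/measurable_EFinP; apply: measurable_funM => //; exact: measurable_rdomint.
- exact: (measurable_integral_param mF (fun p => mulr_ge0 (rdom_ge0 p) (w0 p.1))).
- move=> x _; under [leRHS]eq_integral do rewrite mulrC.
  have mrx : measurable_fun [set: R] (fun y => rdom A Q dQ (x, y)).
    exact: measurableT_comp measurable_rdom (@pair1_measurable _ _ _ _ x).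
  rewrite (ge0_integralZ (w0 x) mrx (fun y => rdom_ge0 (x, y))).
  rewrite mulrC EFinM; apply: lee_wpmul2l; first by rewrite lee_fin.
  rewrite /rdomint.
  have : (0 <= \int[mu]_y (rdom A Q dQ (x, y))%:E)%E.
    by apply: integral_ge0 => y _; rewrite lee_fin rdom_ge0.
  by case: (\int[mu]_y _)%E => [r|//|//] /=; rewrite ?leey.
Qed.

Lemma rker_diff_int : {ae mu, forall x,
  (forall t : R, 0 < t <= T ->
    mu.-integrable [set: R] (fun y => (rker u' ((t, x), y) - rker u ((t, x), y))%:E)) /\
  tnorm al T eps (fun t => \int[mu]_y (rker u' ((t, x), y) - rker u ((t, x), y))) (rdomint x)}.
Proof.
have := aeI rker_diff_tnorm ae_rdom_fin; apply: aeS => x [hx fx].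
have mx (v : R * R -> R) : measurable_fun [set: R * R] v ->
    measurable_fun [set: R * R] (fun p => rker v ((p.1, x), p.2)).
  move=> mv; apply: (measurableT_comp (measurable_rker mv)).
  apply: measurable_fun_pair => //; apply: measurable_fun_pair => //.
have mp : measurable_fun [set: R * R] (fun p => rker u' ((p.1, x), p.2) - rker u ((p.1, x), p.2)).
  by apply: measurable_funB; exact: mx.
have mrx : measurable_fun [set: R] (fun y => rdom A Q dQ (x, y)).
  exact: measurableT_comp measurable_rdom (@pair1_measurable _ _ _ _ x).
split.
- move=> t tT.
  exact: (minkowski_integrable eps01 mp mrx (fun y => rdom_ge0 (x, y)) hx fx tT).
- exact: (tnorm_minkowski eps01 mp mrx (fun y => rdom_ge0 (x, y)) hx fx).
Qed.

End difference.


Section bound.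
Variables (Q dQ dP : R -> R) (S N NP : R).
Hypothesis mQ : measurable_fun [set: R] Q.
Hypothesis Q0 : forall x, 0 <= Q x.
Hypothesis mdQ : measurable_fun [set: R] dQ.
Hypothesis dQ0 : forall x, 0 <= dQ x.
Hypothesis mdP : measurable_fun [set: R] dP.
Hypothesis dP0 : forall x, 0 <= dP x.
Hypothesis hQ : (nw w Q <= S%:E)%E.
Hypothesis hdQ : (nw w dQ <= N%:E)%E.
Hypothesis hdP : (nw w dP <= NP%:E)%E.

(** For bounded a, multiplication by a costs no more than M times multiplication by rho, so the
    bound with the small factor is preferred. *)
Definition ratedom (y : R) : R := if a y <= M then M * tau * dQ y else dP y.

Let M0 : 0 <= M. Proof. exact: le_trans M1. Qed.

Lemma measurable_ratedom : measurable_fun [set: R] ratedom.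
Proof.
apply: measurable_fun_ifT => //; first exact: measurable_fun_ler.
exact: measurable_funM.
Qed.

Lemma ratedom_ge0 y : 0 <= ratedom y.
Proof. by rewrite /ratedom; case: ifP => // _; rewrite !mulr_ge0. Qed.

(** After Tonelli the inner integral of b w is at most q w(y), or at most M w(y) with a(y) <= M. In
    the second case [ratedom] takes its small value, and the two factors M give M^2 tau; the same
    term covers a(y) <= M in the first case, as q <= 1 <= M. *)
Lemma frag_bound :
  (\int[mu]_x \int[mu]_y (b (x, y) * ratedom y * w x)%:E <= (q * NP + M ^+ 2 * tau * N)%:E)%E.
Proof.
have mF : measurable_fun [set: R * R] (fun p => b p * ratedom p.2 * w p.1).
  apply: measurable_funM; last exact: measurableT_comp.
  by apply: measurable_funM => //; apply: measurableT_comp => //; exact: measurable_ratedom.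
have F0 p : 0 <= b p * ratedom p.2 * w p.1 by rewrite !mulr_ge0// ratedom_ge0.
rewrite (tonelli_EFin mF F0).
apply: (@le_trans _ _ (\int[mu]_y (q * (dP y * w y) + M ^+ 2 * tau * (dQ y * w y))%:E)%E); last first.
  have m1 : measurable_fun [set: R] (fun y => dP y * w y) by exact: measurable_funM.
  have m2 : measurable_fun [set: R] (fun y => dQ y * w y) by exact: measurable_funM.
  have n1 y : 0 <= dP y * w y by rewrite mulr_ge0.
  have n2 y : 0 <= dQ y * w y by rewrite mulr_ge0.
  have M2 : 0 <= M ^+ 2 * tau by rewrite mulr_ge0// sqr_ge0.
  rewrite ge0_integral_add; last 4 first.
  - exact: measurable_funM.
  - exact: measurable_funM.
  - by move=> y; rewrite mulr_ge0.
  - by move=> y; rewrite mulr_ge0.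
  rewrite !ge0_integralZ// EFinD [(q * NP)%:E]EFinM [(_ * N)%:E]EFinM.
  by apply: leeD; apply: lee_wpmul2l; rewrite ?lee_fin.
apply: ae_ge0_le_integral => //.
- by move=> y _; apply: integral_ge0 => x _; rewrite lee_fin; exact: (F0 (x, y)).
- apply: (@measurable_integral_param _ _ _ (fun p => b (p.2, p.1) * ratedom p.1 * w p.2)).
    exact: measurableT_comp mF (@measurable_swap _ _ _ _).
  by move=> p; exact: (F0 (p.2, p.1)).
- by move=> y _; rewrite lee_fin addr_ge0 ?mulr_ge0 ?sqr_ge0.
- apply/measurable_EFinP; apply: measurable_funD; apply: measurable_funM => //;
  exact: measurable_funM.
- move: bw; apply: aeS => y hy _.
  have mby : measurable_fun [set: R] (fun x => b (x, y) * w x).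
    by apply: measurable_funM => //; exact: measurable_section2.
  have -> : (\int[mu]_x (b (x, y) * ratedom y * w x)%:E =
      (ratedom y)%:E * \int[mu]_x (b (x, y) * w x)%:E)%E.
    rewrite -ge0_integralZ ?ratedom_ge0//; last by move=> x; rewrite mulr_ge0.
    by apply: eq_integral => x _; congr EFin; ring.
  have P0 := ratedom_ge0 y.
  have n2 : 0 <= tau * dQ y * w y by rewrite !mulr_ge0.
  have n1 : 0 <= dP y * w y by rewrite mulr_ge0.
  case: hy => [h|[h aM]].
  + apply: (@le_trans _ _ ((ratedom y)%:E * (q * w y)%:E)%E).
      by apply: lee_wpmul2l; rewrite ?lee_fin.
    rewrite -EFinM lee_fin /ratedom; case: ifP => _.
      have e1 : M * tau * dQ y * (q * w y) = q * M * (tau * dQ y * w y) by ring.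
      have e2 : M ^+ 2 * tau * (dQ y * w y) = M * M * (tau * dQ y * w y) by ring.
      rewrite e1 e2; apply: (@le_trans _ _ (M * M * (tau * dQ y * w y))).
        by rewrite ler_wpM2r// ler_wpM2r// (le_trans q1).
      by rewrite lerDr mulr_ge0.
    rewrite mulrCA [X in _ <= X + _]mulrCA -[X in _ <= X + _]mulrCA.
    by rewrite lerDl mulr_ge0 ?mulr_ge0 ?sqr_ge0.
  + apply: (@le_trans _ _ ((ratedom y)%:E * (M * w y)%:E)%E).
      by apply: lee_wpmul2l; rewrite ?lee_fin.
    rewrite -EFinM lee_fin /ratedom aM.
    have e2 : M ^+ 2 * tau * (dQ y * w y) = M * tau * dQ y * (M * w y) by ring.
    by rewrite e2 lerDr mulr_ge0.
Qed.

(** Origin of the constant: two convolutions with factor K tau give 2 Cw K, and two plain products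
    with factor 2 K tau give 4 K. *)
Lemma rdom_bound :
  (\int[mu]_x \int[mu]_y (rdom ratedom Q dQ (x, y) * w x)%:E <=
   (q * NP + (M ^+ 2 + K * (2 * Cw + 4) * S) * tau * N)%:E)%E.
Proof.
have mF1 : measurable_fun [set: R * R] (fun p => b p * ratedom p.2 * w p.1).
  apply: measurable_funM; last exact: measurableT_comp.
  by apply: measurable_funM => //; apply: measurableT_comp => //; exact: measurable_ratedom.
have F1 p : 0 <= b p * ratedom p.2 * w p.1 by rewrite !mulr_ge0// ratedom_ge0.
have mw1 : measurable_fun [set: R * R] (fun p => w p.1) by exact: measurableT_comp.
have mF2 : measurable_fun [set: R * R] (fun p => dQ (p.1 - p.2) * Q p.2 * w p.1).
  by apply: measurable_funM => //; exact: measurable_conv2.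
have mF3 : measurable_fun [set: R * R] (fun p => Q (p.1 - p.2) * dQ p.2 * w p.1).
  by apply: measurable_funM => //; exact: measurable_conv2.
have mF4 : measurable_fun [set: R * R] (fun p => dQ p.1 * Q p.2 * w p.1).
  by apply: measurable_funM => //; exact: measurable_prod2.
have mF5 : measurable_fun [set: R * R] (fun p => Q p.1 * dQ p.2 * w p.1).
  by apply: measurable_funM => //; exact: measurable_prod2.
have Kt : 0 <= K * tau by rewrite mulr_ge0.
have Kt2 : 0 <= 2 * K * tau by rewrite !mulr_ge0.
pose G2 (p : R * R) := dQ (p.1 - p.2) * Q p.2 * w p.1 + Q (p.1 - p.2) * dQ p.2 * w p.1.
pose G3 (p : R * R) := dQ p.1 * Q p.2 * w p.1 + Q p.1 * dQ p.2 * w p.1.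
have mG2 : measurable_fun [set: R * R] G2 by exact: measurable_funD.
have mG3 : measurable_fun [set: R * R] G3 by exact: measurable_funD.
have G20 p : 0 <= G2 p by rewrite /G2 addr_ge0 ?mulr_ge0.
have G30 p : 0 <= G3 p by rewrite /G3 addr_ge0 ?mulr_ge0.
pose H1 (p : R * R) := b p * ratedom p.2 * w p.1.
pose H2 (p : R * R) := (K * tau) * G2 p.
pose H12 (p : R * R) := H1 p + H2 p.
pose H3 (p : R * R) := (2 * K * tau) * G3 p.
pose f2 (p : R * R) := dQ (p.1 - p.2) * Q p.2 * w p.1.
pose f3 (p : R * R) := Q (p.1 - p.2) * dQ p.2 * w p.1.
pose f4 (p : R * R) := dQ p.1 * Q p.2 * w p.1.
pose f5 (p : R * R) := Q p.1 * dQ p.2 * w p.1.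
have mH2 : measurable_fun [set: R * R] H2 by exact: measurable_funM.
have mH3 : measurable_fun [set: R * R] H3 by exact: measurable_funM.
have mH12 : measurable_fun [set: R * R] H12 by exact: measurable_funD.
have H20 p : 0 <= H2 p by rewrite /H2 mulr_ge0.
have H30 p : 0 <= H3 p by rewrite /H3 mulr_ge0.
have H120 p : 0 <= H12 p by rewrite /H12 addr_ge0// F1.
have E1 := dint_add mH12 mH3 H120 H30.
have E2 := dint_add (mF1 : measurable_fun _ H1) mH2 F1 H20.
have E3 := dintZ Kt mG2 G20; have E4 := dintZ Kt2 mG3 G30.
have f20 p : 0 <= f2 p by rewrite /f2 !mulr_ge0.
have f30 p : 0 <= f3 p by rewrite /f3 !mulr_ge0.
have f40 p : 0 <= f4 p by rewrite /f4 !mulr_ge0.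
have f50 p : 0 <= f5 p by rewrite /f5 !mulr_ge0.
have E5 := dint_add (mF2 : measurable_fun _ f2) (mF3 : measurable_fun _ f3) f20 f30.
have E6 := dint_add (mF4 : measurable_fun _ f4) (mF5 : measurable_fun _ f5) f40 f50.
have -> : (\int[mu]_x \int[mu]_y (rdom ratedom Q dQ (x, y) * w x)%:E =
  \int[mu]_x \int[mu]_y (H12 (x, y) + H3 (x, y))%:E)%E.
  apply: eq_integral => x _; apply: eq_integral => y _; congr EFin.
  by rewrite /rdom /H12 /H1 /H2 /H3 /G2 /G3/=; ring.
rewrite E1 E2 /H2 /H3 E3 E4 /G2 /G3 E5 E6.
have B1 := frag_bound.
have B2 := nw_conv mw w1 Cw0 wadd mdQ mQ dQ0 Q0 hdQ hQ.
have B3 := nw_conv mw w1 Cw0 wadd mQ mdQ Q0 dQ0 hQ hdQ.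
have B4 := nw_prod mw w1 mdQ mQ dQ0 Q0 hdQ hQ.
have B5 := nw_prod mw w1 mQ mdQ Q0 dQ0 hQ hdQ.
apply: (@le_trans _ _ ((q * NP + M ^+ 2 * tau * N)%:E +
  (K * tau)%:E * ((Cw * (N * S))%:E + (Cw * (S * N))%:E) +
  (2 * K * tau)%:E * ((N * S)%:E + (S * N)%:E))%E).
  apply: leeD; [apply: leeD => //|]; apply: lee_wpmul2l; rewrite ?lee_fin//; exact: leeD.
rewrite [leLHS](_ : _ = (q * NP + M ^+ 2 * tau * N + (K * tau) * (Cw * (N * S) + Cw * (S * N)) +
  (2 * K * tau) * (N * S + S * N))%:E)%E// lee_fin.
by rewrite le_eqVlt; apply/orP; left; apply/eqP; ring.
Qed.

End bound.

End coagulation_fragmentation_kernel.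

(** * Picard iteration *)

Section tnorm_on_interval.
Context {R : realType} (al T eps : R).
Local Notation mu := (@lebesgue_measure R).

Lemma tnorm_eq_on (p q : R -> R) (G : R) : measurable_fun [set: R] q ->
  (forall t : R, 0 < t <= T -> p t = q t) -> tnorm al T eps p G -> tnorm al T eps q G.
Proof.
move=> mq pq [mp p0 p1 p2]; split => //.
- move=> t tT; apply: le_trans (p0 t tT).
  rewrite -(@integral_itv_obnd_cbnd _ 0); last exact: measurable_abs_EFin.
  rewrite -[leRHS](@integral_itv_obnd_cbnd _ 0); last exact: measurable_abs_EFin.
  rewrite le_eqVlt; apply/orP; left; apply/eqP; apply: eq_integral => s.
  rewrite inE/= in_itv/= => /andP[s0 st]; rewrite pq// s0 (le_trans st)//.
  by case/andP: tT.
- by move=> t tT; rewrite -pq// p1.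
- move=> s t s0 st tT; rewrite -!pq ?p2//.
    by rewrite s0 (le_trans (ltW st)).
  by rewrite tT andbT (lt_trans s0).
Qed.

Lemma duhB (a : R) (g g' : R -> R) (G G' t : R) : 0 < al < 1 -> 0 < T <= 1 -> 0 <= a ->
  tnorm al T eps g G -> tnorm al T eps g' G' -> 0 <= t <= T ->
  duh a (fun s => g' s - g s) t = duh a g' t - duh a g t.
Proof.
move=> al01 T01 a0 hg hg' /andP[]; rewrite le_eqVlt => /predU1P[<- _|t0 tT].
  by rewrite /duh set_itv1 !Rintegral_set1 subrr.
have tT' : 0 < t <= T by rewrite t0.
rewrite /duh -RintegralB//.
- by apply: eq_Rintegral => s _; ring.
- exact: duh_kernel_integrable hg' _ _.
- exact: duh_kernel_integrable hg _ _.
Qed.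

End tnorm_on_interval.

Section weighted_limits.
Context {R : realType}.
Local Notation mu := (@lebesgue_measure R).
Variable w : R -> R.
Hypothesis mw : measurable_fun [set: R] w.
Hypothesis w1 : forall x, 1 <= w x.

Let w0 x : 0 <= w x. Proof. exact: le_trans (w1 x). Qed.

Lemma nw_ae_fin (E : R -> \bar R) : measurable_fun [set: R] E -> (forall x, 0 <= E x)%E ->
  (\int[mu]_x (E x * (w x)%:E) < +oo)%E -> {ae mu, forall x, E x \is a fin_num}.
Proof.
move=> mE E0 hE.
have hI : mu.-integrable [set: R] (fun x => E x * (w x)%:E)%E.
  apply/integrableP; split; first by apply: emeasurable_funM => //; apply/measurable_EFinP; exact: mw.
  apply: le_lt_trans hE; rewrite le_eqVlt; apply/orP; left; apply/eqP.
  by apply: eq_integral => x _; rewrite gee0_abs// mule_ge0// lee_fin.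
have := integrable_ae measurableT hI; apply: aeS => x /(_ I).
have wx : 0 < w x by exact: lt_le_trans (w1 x).
have := E0 x; case: (E x) => //= _.
by rewrite mulyr gtr0_sg// mul1e.
Qed.

(** Monotone convergence in extended reals. The limit has finite weighted integral, hence is finite
    almost everywhere, and [fine] makes it a real function without raising its norm. *)
Lemma nw_mono_lim (h : nat -> R -> R) (c : R) : (forall j, measurable_fun [set: R] (h j)) ->
  (forall j x, 0 <= h j x) -> (forall x, nondecreasing_seq (fun j => h j x)) ->
  (forall j, nw w (h j) <= c%:E)%E ->
  exists H : R -> R, [/\ measurable_fun [set: R] H, forall x, 0 <= H x, (nw w H <= c%:E)%E &
    {ae mu, forall x, forall j, h j x <= H x}].
Proof.
move=> mh h0 hnd hc.
pose E x := (limn (fun j => (h j x)%:E))%E.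
have nd x : {homo (fun j => (h j x)%:E) : m n / (m <= n)%N >-> (m <= n)%E}.
  by move=> m n mn; rewrite lee_fin hnd.
have cE x : cvgn (fun j => (h j x)%:E) by exact: ereal_nondecreasing_is_cvgn.
have E0 x : (0 <= E x)%E.
  by apply: lime_ge => //; near=> n; rewrite lee_fin.
have hE x j : ((h j x)%:E <= E x)%E.
  apply: lime_ge; first exact: cE.
  by exists j => // n /= jn; rewrite lee_fin hnd.
have mE : measurable_fun [set: R] E.
  apply: (@emeasurable_fun_cvg _ _ _ _ (fun j x => (h j x)%:E)) => //.
  - by move=> j; apply/measurable_EFinP; exact: mh.
have hI : (\int[mu]_x (E x * (w x)%:E) <= c%:E)%E.
  have -> : (\int[mu]_x (E x * (w x)%:E) = \int[mu]_x limn (fun j => (h j x * w x)%:E))%E.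
    apply: eq_integral => x _; rewrite /E.
    transitivity (limn (fun j => ((h j x)%:E * (w x)%:E)%E)); last by [].
    by rewrite limeMr.
  rewrite monotone_convergence//.
  - apply: lime_le.
      apply: ereal_nondecreasing_is_cvgn => m n mn; apply: ge0_le_integral => //.
      + by move=> x _; rewrite lee_fin mulr_ge0.
      + by apply/measurable_EFinP; apply: measurable_funM => //; exact: mh.
      + by apply/measurable_EFinP; apply: measurable_funM => //; exact: mh.
      + by move=> x _; rewrite lee_fin ler_wpM2r// hnd.
    by near=> n; exact: hc.
  - by move=> j; apply/measurable_EFinP; apply: measurable_funM => //; exact: mh.
  - by move=> j x _; rewrite lee_fin mulr_ge0.
  - by move=> x _ m n mn; rewrite lee_fin ler_wpM2r// hnd.
have fE : {ae mu, forall x, E x \is a fin_num}.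
  by apply: nw_ae_fin => //; apply: le_lt_trans hI _; rewrite ltey.
exists (fine \o E); split.
- exact: (measurableT_comp (fine_measurable measurableT)).
- by move=> x; exact: fine_ge0.
- apply: le_trans hI; apply: ae_ge0_le_integral => //.
  + by move=> x _; rewrite lee_fin mulr_ge0// fine_ge0.
  + apply/measurable_EFinP; apply: measurable_funM => //.
    exact: (measurableT_comp (fine_measurable measurableT)).
  + by move=> x _; rewrite mule_ge0// lee_fin.
  + by apply: emeasurable_funM => //; apply/measurable_EFinP; exact: mw.
  + by apply: aeS fE => x fx _; rewrite EFinM fineK.
- by apply: aeS fE => x fx j; rewrite -lee_fin fineK.
Unshelve. all: by end_near.
Qed.

(** The infimum over j is below each [h j], so its integral is at most th^j c for every j, hence 0.
    A single small index at each size is enough for the convergence proofs, as the later differences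
    are controlled by the same function. *)
Lemma nw_inf_ae0 (h : nat -> R -> R) (c th : R) : (forall j, measurable_fun [set: R] (h j)) ->
  (forall j x, 0 <= h j x) -> 0 <= th < 1 -> (forall j, nw w (h j) <= (th ^+ j * c)%:E)%E ->
  {ae mu, forall x, forall e : R, 0 < e -> exists j, h j x < e}.
Proof.
move=> mh h0 /andP[th0 th1] hc.
pose E x := (ereal_inf (range (fun j => (h j x)%:E))).
have mE : measurable_fun [set: R] E.
  have := @measurable_fun_einfs _ _ R setT (fun j x => (h j x)%:E) _ 0%N.
  rewrite /einfs/= => H; have {}H := H _.
  have : measurable_fun [set: R] (fun x => ereal_inf (sdrop (fun j => (h j x)%:E) 0)).
    by apply: H => j; apply/measurable_EFinP; exact: mh.
  congr (measurable_fun _ _); apply/funext => x; rewrite /E; congr ereal_inf.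
  by apply/seteqP; split=> y [j]/=; [move=> _ <-; exists j|move=> _ <-; exists j].
have E0 x : (0 <= E x)%E.
  by apply: le_ereal_inf_tmp => y [j _ <-]; rewrite lee_fin.
have hI : (\int[mu]_x E x = 0)%E.
  apply/eqP; rewrite eq_le; apply/andP; split; last exact: integral_ge0.
  have hj j : (\int[mu]_x E x <= (th ^+ j * c)%:E)%E.
    apply: le_trans (hc j); apply: ge0_le_integral => //.
    - by apply/measurable_EFinP; apply: measurable_funM => //; exact: mh.
    - move=> x _; apply: (@le_trans _ _ (h j x)%:E); first by apply: ereal_inf_lbound; exists j.
      by rewrite lee_fin ler_peMr.
  have cv : (fun j => (th ^+ j * c)%:E) @ \oo --> (0 : \bar R)%E.
    apply: cvg_EFin; first by near=> n.
    rewrite -[X in _ --> X](mul0r c); apply: cvgMl; apply: cvg_expr.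
    by rewrite ger0_norm.
  rewrite -(cvg_lim _ cv)//; apply: lime_ge; first by apply: cvgP cv.
  by near=> n; exact: hj.
have : ae_eq mu setT E (cst 0)%E.
  apply/(@ae_eq_integral_abs _ _ _ mu setT measurableT E mE).
  by rewrite -[RHS]hI; apply: eq_integral => x _; rewrite gee0_abs.
apply: aeS => x /(_ I) Ex e e0.
apply: contrapT => /forallNP nj.
have : (e%:E <= E x)%E.
  apply: le_ereal_inf_tmp => y [j _ <-]; rewrite lee_fin leNgt; apply/negP; exact: nj.
by rewrite Ex lee_fin leNgt e0.
Unshelve. all: by end_near.
Qed.

Lemma cauchy_seq_cvg (u : nat -> R) :
  (forall e : R, 0 < e -> exists n, forall j, `|u (n + j)%N - u n| <= e) -> cvgn u.
Proof.
move=> hu; suff : cauchy (u @ \oo) by exact: cauchy_cvg.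
suff : cauchy_ex (u @ \oo) by exact: cauchy_exP.
move=> e e0; have e2 : 0 < e / 2 by rewrite divr_gt0.
have [n hn] := hu _ e2; exists (u n).
exists n => // j /= nj; rewrite -ball_normE /ball_/= distrC.
apply: le_lt_trans (_ : e / 2 < e); last by rewrite ltr_pdivrMr// ltr_pMr// ltr1n.
by have := hn (j - n)%N; rewrite subnKC.
Qed.

End weighted_limits.

Section picard.
Context {R : realType}.
Local Notation mu := (@lebesgue_measure R).
Variables (al T eps z kap om K Cw q M th S F : R) (a w f : R -> R) (b k : R * R -> R).
Hypothesis al01 : 0 < al < 1.
Hypothesis T01 : 0 < T <= 1.
Hypothesis eps01 : 0 < eps <= 2^-1.
Hypothesis z01 : 0 < z <= 1.
Hypothesis kap01 : 0 < kap < 1.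
Hypothesis par1 : eps / (1 - kap) + kap^-1 <= 1 + z.
Hypothesis par2 : 3 * eps / ((1 - kap) * kap) + kap ^- 2 <= 1 + z.
Hypothesis om1 : 1 <= om.
Hypothesis ma : measurable_fun [set: R] a.
Hypothesis a0 : forall x, 0 <= a x.
Hypothesis mw : measurable_fun [set: R] w.
Hypothesis w1 : forall x, 1 <= w x.
Hypothesis Cw0 : 0 <= Cw.
Hypothesis wadd : forall x y, w (x + y) <= Cw * (w x * w y).
Hypothesis mb : measurable_fun [set: R * R] b.
Hypothesis b0 : forall p, 0 <= b p.
Hypothesis mk : measurable_fun [set: R * R] k.
Hypothesis K0 : 0 <= K.
Let rho x := (om + a x) `^ al.
Hypothesis kle : forall x y, `|k (x, y)| <= K * (rho x * rho y).
Hypothesis q0 : 0 <= q.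
Hypothesis M1 : 1 <= M.
Hypothesis q1 : q <= 1.
Hypothesis bw : {ae mu, forall y,
  (\int[mu]_x (b (x, y) * w x)%:E <= (q * w y)%:E)%E \/
  (\int[mu]_x (b (x, y) * w x)%:E <= (M * w y)%:E)%E /\ a y <= M}.
Hypothesis mf : measurable_fun [set: R] f.
Hypothesis hF : (nw w (fun x => rho x * `|f x|)%R <= F%:E)%E.

Let tau := T `^ (1 - al).
Let Cd := duh_cst eps om.
Let cst := M ^+ 2 + K * (2 * Cw + 4) * S.
Hypothesis hth : q * (1 + z) + cst * tau * Cd <= th.
Hypothesis th1 : th < 1.
Hypothesis hS : F + Cd * (F / (1 - th)) <= S.

Let w0 x : 0 <= w x. Proof. exact: le_trans (w1 x). Qed.
Let tau0 : 0 <= tau. Proof. exact: powR_ge0. Qed.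
Let Cd1 : 1 <= Cd.
Proof.
rewrite /Cd /duh_cst; have ei : 0 <= 4 / eps.
  by rewrite divr_ge0//; case/andP: eps01 => e0 _; exact: ltW.
by have := om1; lra.
Qed.
Let Cd0 : 0 <= Cd. Proof. exact: le_trans Cd1. Qed.
Let T0 : 0 < T. Proof. by case/andP: T01. Qed.
Let z0 : 0 < z. Proof. by case/andP: z01. Qed.

Lemma rho_ge1 x : 1 <= rho x.
Proof. by apply: powR_ge1 => //; rewrite (le_trans om1)// lerDl. Qed.

Let rho0 x : 0 < rho x. Proof. exact: lt_le_trans (rho_ge1 x). Qed.

Lemma measurable_rho : measurable_fun [set: R] rho.
Proof.
apply: (measurableT_comp (measurable_powR al)).
exact: measurable_funD.
Qed.

Definition fdom (x : R) : R := rho x * `|f x|.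

Lemma measurable_fdom : measurable_fun [set: R] fdom.
Proof. by apply: measurable_funM; [exact: measurable_rho|exact: measurableT_comp]. Qed.

Lemma fdom_ge0 x : 0 <= fdom x. Proof. by rewrite mulr_ge0// ltW. Qed.

Definition mildu (g : R * R -> R) (p : R * R) : R :=
  expR (- (a p.2 * p.1)) * f p.2 + duh (a p.2) (fun s => g (s, p.2)) p.1.

Lemma measurable_mildu g : measurable_fun [set: R * R] g -> measurable_fun [set: R * R] (mildu g).
Proof.
move=> mg; apply: measurable_funD; last exact: measurable_duh.
apply: measurable_funM; last exact: measurableT_comp.
apply: measurableT_comp => //; apply: measurableT_comp => //.
by apply: measurable_funM => //; exact: measurableT_comp.
Qed.

Lemma good_mildu (g : R * R -> R) (x D : R) : tnorm al T eps (fun t => g (t, x)) D ->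
  good al T eps om a (fun t => mildu g (t, x)) x (fdom x + Cd * D).
Proof.
move=> hg; split.
- move=> t tT; rewrite normrM (ger0_norm (powR_ge0 _ _)).
  apply: le_trans (ler_wpM2l (powR_ge0 _ _) (ler_normD _ _)) _.
  rewrite mulrDr lerD//.
    by apply: rho_exp_le => //; case/andP: tT.
  exact: (rho_duh_le al01 T01 eps01 (a0 x) hg z01 kap01 par1 om1 tT).
- have H := tnormD eps01 (tnorm_rho_exp T om (f x) al01 eps01 (a0 x))
    (tnorm_rho_duh al01 T01 eps01 (a0 x) hg z01 kap01 par1 par2 om1).
  rewrite mulrDr mulrA; apply: tnorm_eq H => t.
  by rewrite /mildu/= mulrDr.
Qed.

(** The datum cancels, so the difference is a Duhamel integral of g' - g. This holds only on the
    time interval where both integrals converge, hence the recourse to [tnorm_eq_on]. *)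
Lemma good_mildu_diff (g g' : R * R -> R) (x D D' dl : R) :
  measurable_fun [set: R * R] g -> measurable_fun [set: R * R] g' ->
  tnorm al T eps (fun t => g (t, x)) D -> tnorm al T eps (fun t => g' (t, x)) D' ->
  tnorm al T eps (fun t => g' (t, x) - g (t, x)) dl ->
  good al T eps om a (fun t => mildu g' (t, x) - mildu g (t, x)) x (Cd * dl) /\
  tnorm al T eps (fun t => a x * (mildu g' (t, x) - mildu g (t, x))) ((1 + z) * dl).
Proof.
move=> mg mg' hg hg' hd.
have E t : 0 <= t <= T -> mildu g' (t, x) - mildu g (t, x) =
    duh (a x) (fun s => g' (s, x) - g (s, x)) t.
  by move=> tT; rewrite (duhB al01 T01 (a0 x) hg hg' tT) /mildu/=; ring.
have mm : measurable_fun [set: R] (fun t => mildu g' (t, x) - mildu g (t, x)).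
  by apply: measurable_funB; apply: measurable_section2; exact: measurable_mildu.
have E2 t : 0 < t <= T -> duh (a x) (fun s => g' (s, x) - g (s, x)) t = mildu g' (t, x) - mildu g (t, x).
  by move=> /andP[t0 tT]; rewrite E// ltW.
split; [split|].
- move=> t tT; rewrite E// normrM (ger0_norm (powR_ge0 _ _)).
  exact: (rho_duh_le al01 T01 eps01 (a0 x) hd z01 kap01 par1 om1 tT).
- rewrite mulrA; apply: (@tnorm_eq_on _ _ _ _ (fun t => rho x * duh (a x) (fun s => g' (s, x) - g (s, x)) t)).
  + exact: measurable_funM.
  + by move=> t tT; rewrite E2.
  + exact: (tnorm_rho_duh al01 T01 eps01 (a0 x) hd z01 kap01 par1 par2 om1).
- apply: (@tnorm_eq_on _ _ _ _ (fun t => a x * duh (a x) (fun s => g' (s, x) - g (s, x)) t)).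
  + exact: measurable_funM.
  + by move=> t tT; rewrite E2.
  + exact: (tnorm_rate_duh al01 T01 eps01 (a0 x) hd z01 kap01 par1 par2).
Qed.

Lemma tnorm_rate_mildu (g : R * R -> R) (x D : R) : tnorm al T eps (fun t => g (t, x)) D ->
  tnorm al T eps (fun t => a x * mildu g (t, x)) (fdom x + (1 + z) * D).
Proof.
move=> hg.
have H := tnormD eps01 (tnorm_rate_exp T (f x) al01 eps01 (a0 x) om1)
  (tnorm_rate_duh al01 T01 eps01 (a0 x) hg z01 kap01 par1 par2).
by apply: tnorm_eq H => t; rewrite /mildu/= mulrDr.
Qed.

(* where [a x <= M] the small factor [T `^ (1 - al)] of [good] is gained at the price of [M] *)
Lemma ratedomP (v : R -> R) (x P Q : R) (dP dQ : R -> R) : dP x = P -> dQ x = Q ->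
  tnorm al T eps (fun t => a x * v t) P -> good al T eps om a v x Q ->
  tnorm al T eps (fun t => a x * v t) (ratedom al T M a dQ dP x).
Proof.
move=> <- <- hP hQ; rewrite /ratedom; case: ifP => // aM.
have Q0 := good_ge0 T01 hQ.
case: hQ => _ /(tnormZ (a x / rho x)) H.
apply: tnorm_eq (tnorm_le _ H).
  by move=> t /=; rewrite -/(rho x); field; rewrite gt_eqF.
rewrite normrM normfV (ger0_norm (a0 x)) (ger0_norm (ltW (rho0 x))) -[leRHS]mulrA.
rewrite ler_wpM2r ?mulr_ge0// ler_pdivrMr// (le_trans aM)//.
by rewrite ler_peMr ?rho_ge1// (le_trans _ M1).
Qed.

Definition stepdom (Q dQ dP : R -> R) : R -> R := rdomint al T K b (ratedom al T M a dQ dP) Q dQ.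

Section step.
Variables (u u' : R * R -> R) (Q dQ dP : R -> R) (N NP : R).
Hypothesis mu_u : measurable_fun [set: R * R] u.
Hypothesis mu_u' : measurable_fun [set: R * R] u'.
Hypothesis mQ : measurable_fun [set: R] Q.
Hypothesis Q0 : forall x, 0 <= Q x.
Hypothesis mdQ : measurable_fun [set: R] dQ.
Hypothesis dQ0 : forall x, 0 <= dQ x.
Hypothesis mdP : measurable_fun [set: R] dP.
Hypothesis dP0 : forall x, 0 <= dP x.
Hypothesis hQ : (nw w Q <= S%:E)%E.
Hypothesis hdQ : (nw w dQ <= N%:E)%E.
Hypothesis hdP : (nw w dP <= NP%:E)%E.

Let M0 : 0 <= M. Proof. exact: le_trans M1. Qed.
Let mA := measurable_ratedom al T M ma mdQ mdP.
Let A0 := ratedom_ge0 al T a M1 dQ0 dP0.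
Let bnd := rdom_bound al T ma mw w1 Cw0 wadd mb b0 K0 q0 M1 q1 bw mQ Q0 mdQ dQ0 mdP dP0 hQ hdQ hdP.

Lemma measurable_stepdom : measurable_fun [set: R] (stepdom Q dQ dP).
Proof. exact: (measurable_rdomint al T mb b0 K0 mA A0 mQ Q0 mdQ dQ0). Qed.

Lemma stepdom_ge0 x : 0 <= stepdom Q dQ dP x.
Proof. exact: rdomint_ge0. Qed.

Lemma nw_stepdom : (nw w (stepdom Q dQ dP) <= (q * NP + cst * tau * N)%:E)%E.
Proof.
exact: (le_trans (nw_rdomint_le al T mw w1 mb b0 K0 mA A0 mQ Q0 mdQ dQ0) bnd).
Qed.

Lemma rker_step :
  {ae mu, forall y, tnorm al T eps (fun t => a y * (u' (t, y) - u (t, y))) (dP y) /\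
    (good al T eps om a (fun t => u (t, y)) y (Q y) /\
     good al T eps om a (fun t => u' (t, y)) y (Q y)) /\
    good al T eps om a (fun t => u' (t, y) - u (t, y)) y (dQ y)} ->
  {ae mu, forall x,
    (forall t : R, 0 < t <= T ->
      mu.-integrable [set: R] (fun y => (rker a b k u' ((t, x), y) - rker a b k u ((t, x), y))%:E)) /\
    tnorm al T eps (fun t => \int[mu]_y (rker a b k u' ((t, x), y) - rker a b k u ((t, x), y)))
      (stepdom Q dQ dP x)}.
Proof.
move=> hu.
apply: (rker_diff_int T01 eps01 om1 ma a0 mw w1 mb b0 mk K0 kle mu_u mu_u' mA A0 mQ Q0 mdQ dQ0).
- apply: aeS hu => y [h1 [h2 h3]]; split=> //.
  exact: (ratedomP (erefl (dP y)) (erefl (dQ y))).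
- by apply: le_lt_trans bnd _; rewrite ltey.
Qed.

End step.


Let mfd := measurable_fdom.
Let fd0 := fdom_ge0.

Let F0 : 0 <= F.
Proof. by rewrite -lee_fin; apply: le_trans hF; apply: nw_ge0. Qed.

Let th1' : 0 < 1 - th. Proof. by rewrite subr_gt0. Qed.

Let S0 : 0 <= S.
Proof. by apply: le_trans hS; rewrite addr_ge0// mulr_ge0// divr_ge0// ltW. Qed.

Let cst0 : 0 <= cst.
Proof. by rewrite /cst addr_ge0 ?sqr_ge0// !mulr_ge0// addr_ge0// mulr_ge0. Qed.

Let ct0 : 0 <= cst * tau. Proof. exact: mulr_ge0. Qed.

Let th0 : 0 <= th.
Proof.
apply: le_trans hth; rewrite addr_ge0 ?mulr_ge0//.
by rewrite addr_ge0// ltW.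
Qed.

Definition Psi (g : R * R -> R) (p : R * R) : R := \int[mu]_y rker a b k (mildu g) (p, y).

Lemma measurable_Psi g : measurable_fun [set: R * R] g -> measurable_fun [set: R * R] (Psi g).
Proof.
move=> mg; apply: measurable_Rintegral_param.
by apply: measurable_rker => //; exact: measurable_mildu.
Qed.

Lemma nw_affine (c cD : R) (D : R -> R) : 0 <= c -> measurable_fun [set: R] D ->
  (forall x, 0 <= D x) -> (nw w D <= cD%:E)%E ->
  (nw w (fun x => fdom x + c * D x)%R <= (F + c * cD)%:E)%E.
Proof.
move=> c0 mD D0 hD; rewrite nwD//; last 2 first.
- exact: measurable_funM.
- by move=> x; rewrite mulr_ge0.
rewrite nwZ// EFinD EFinM leeD//.
by apply: lee_wpmul2l; rewrite ?lee_fin.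
Qed.

Lemma good_zero (x Q : R) : 0 <= Q -> good al T eps om a (fun=> 0) x Q.
Proof.
move=> Q0; split; first by move=> t _; rewrite mulr0 normr0.
apply: (@tnorm_eq _ _ _ _ (fun=> 0)); first by move=> t; rewrite mulr0.
by apply: tnorm_le (tnorm0 _ _ _); rewrite mulr_ge0.
Qed.

Lemma rker_zero r : rker a b k (fun=> 0) r = 0.
Proof. by rewrite /rker !mulr0 addr0 subr0. Qed.

Section Psi_bounds.
Variables (g : R * R -> R) (D : R -> R) (ND : R).
Hypothesis mg : measurable_fun [set: R * R] g.
Hypothesis mD : measurable_fun [set: R] D.
Hypothesis D0 : forall x, 0 <= D x.
Hypothesis hD : (nw w D <= ND%:E)%E.
Hypothesis hND : ND <= F / (1 - th).
Hypothesis gD : {ae mu, forall x, tnorm al T eps (fun t => g (t, x)) (D x)}.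

Definition Qdom (x : R) : R := fdom x + Cd * D x.
Definition Pdom (x : R) : R := fdom x + (1 + z) * D x.

Lemma measurable_Qdom : measurable_fun [set: R] Qdom.
Proof. by apply: measurable_funD => //; exact: measurable_funM. Qed.

Lemma Qdom_ge0 x : 0 <= Qdom x. Proof. by rewrite addr_ge0// mulr_ge0. Qed.

Let z1 : 0 <= 1 + z. Proof. by rewrite addr_ge0// ltW. Qed.

Lemma measurable_Pdom : measurable_fun [set: R] Pdom.
Proof. by apply: measurable_funD => //; exact: measurable_funM. Qed.

Lemma Pdom_ge0 x : 0 <= Pdom x. Proof. by rewrite addr_ge0// mulr_ge0. Qed.

Lemma nw_Qdom : (nw w Qdom <= S%:E)%E.
Proof.
apply: le_trans (nw_affine Cd0 mD D0 hD) _; rewrite lee_fin.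
by apply: le_trans hS; rewrite lerD2l ler_wpM2l.
Qed.

Lemma nw_Pdom : (nw w Pdom <= (F + (1 + z) * ND)%:E)%E.
Proof. exact: nw_affine. Qed.

(** The case u = 0 of [rker_step], because [rker] vanishes at u = 0. *)
Lemma Psi_bound : {ae mu, forall x,
  (forall t : R, 0 < t <= T ->
    mu.-integrable [set: R] (fun y => (rker a b k (mildu g) ((t, x), y))%:E)) /\
  tnorm al T eps (fun t => Psi g (t, x)) (stepdom Qdom Qdom Pdom x)}.
Proof.
have H := @rker_step (fun=> 0) (mildu g) Qdom Qdom Pdom S _ (measurable_cst _)
  (measurable_mildu mg) measurable_Qdom Qdom_ge0 measurable_Qdom Qdom_ge0
  measurable_Pdom Pdom_ge0 nw_Qdom nw_Qdom nw_Pdom.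
have {}H := H _.
have : {ae mu, forall y,
    tnorm al T eps (fun t => a y * (mildu g (t, y) - 0)) (Pdom y) /\
    (good al T eps om a (fun=> 0) y (Qdom y) /\
     good al T eps om a (fun t => mildu g (t, y)) y (Qdom y)) /\
    good al T eps om a (fun t => mildu g (t, y) - 0) y (Qdom y)}.
  apply: aeS gD => y gy.
  have E : (fun t => mildu g (t, y) - 0) = (fun t => mildu g (t, y)).
    by apply/funext => t; rewrite subr0.
  split.
    apply: tnorm_eq (tnorm_rate_mildu gy) => t; by rewrite subr0.
  split; [split|].
  - exact/good_zero/Qdom_ge0.
  - exact: good_mildu.
  - by rewrite E; exact: good_mildu.
move/H; apply: aeS => x [h1 h2]; split.
- move=> t tT; have := h1 t tT.
  by under eq_fun do rewrite rker_zero subr0.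
- apply: tnorm_eq h2 => t; rewrite /Psi.
  by apply: eq_Rintegral => y _; rewrite rker_zero subr0.
Qed.

End Psi_bounds.

Section Psi_contraction.
Variables (g g' : R * R -> R) (D dl : R -> R) (ND N : R).
Hypothesis mg : measurable_fun [set: R * R] g.
Hypothesis mg' : measurable_fun [set: R * R] g'.
Hypothesis mD : measurable_fun [set: R] D.
Hypothesis D0 : forall x, 0 <= D x.
Hypothesis mdl : measurable_fun [set: R] dl.
Hypothesis dl0 : forall x, 0 <= dl x.
Hypothesis hD : (nw w D <= ND%:E)%E.
Hypothesis hND : ND <= F / (1 - th).
Hypothesis hdl : (nw w dl <= N%:E)%E.
Hypothesis gD : {ae mu, forall x, tnorm al T eps (fun t => g (t, x)) (D x)}.
Hypothesis gD' : {ae mu, forall x, tnorm al T eps (fun t => g' (t, x)) (D x)}.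
Hypothesis gdl : {ae mu, forall x, tnorm al T eps (fun t => g' (t, x) - g (t, x)) (dl x)}.

Definition contr : R -> R := stepdom (Qdom D) (fun x => Cd * dl x) (fun x => (1 + z) * dl x).

Let z1 : 0 <= 1 + z. Proof. by rewrite addr_ge0// ltW. Qed.
Let mdQ : measurable_fun [set: R] (fun x => Cd * dl x). Proof. exact: measurable_funM. Qed.
Let mdP : measurable_fun [set: R] (fun x => (1 + z) * dl x). Proof. exact: measurable_funM. Qed.
Let dQ0 x : 0 <= Cd * dl x. Proof. exact: mulr_ge0. Qed.
Let dP0 x : 0 <= (1 + z) * dl x. Proof. exact: mulr_ge0. Qed.

Let N0 : 0 <= N.
Proof. by rewrite -lee_fin; apply: le_trans hdl; apply: nw_ge0. Qed.

Let hdQ : (nw w (fun x => Cd * dl x)%R <= (Cd * N)%:E)%E.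
Proof. by rewrite nwZ// EFinM; apply: lee_wpmul2l; rewrite ?lee_fin. Qed.

Let hdP : (nw w (fun x => (1 + z) * dl x)%R <= ((1 + z) * N)%:E)%E.
Proof. by rewrite nwZ// EFinM; apply: lee_wpmul2l; rewrite ?lee_fin. Qed.

Lemma measurable_contr : measurable_fun [set: R] contr.
Proof. exact: (measurable_stepdom (measurable_Qdom mD) (Qdom_ge0 D0) mdQ dQ0 mdP dP0). Qed.

Lemma contr_ge0 x : 0 <= contr x.
Proof. exact: (stepdom_ge0 (Qdom_ge0 D0) dQ0 dP0). Qed.

(** With [(1 + z) * N] for the rate and [Cd * N] for the density, [nw_stepdom] gives exactly the
    left side of [hth] times N. *)
Lemma nw_contr : (nw w contr <= (th * N)%:E)%E.
Proof.
apply: le_trans (nw_stepdom (measurable_Qdom mD) (Qdom_ge0 D0) mdQ dQ0 mdP dP0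
  (nw_Qdom mD D0 hD hND) hdQ hdP) _.
by rewrite lee_fin !mulrA -mulrDl ler_wpM2r.
Qed.

Lemma Psi_contr : {ae mu, forall x,
  tnorm al T eps (fun t => Psi g' (t, x) - Psi g (t, x)) (contr x)}.
Proof.
have H := @rker_step (mildu g) (mildu g') (Qdom D) (fun x => Cd * dl x) (fun x => (1 + z) * dl x) (Cd * N) _
  (measurable_mildu mg) (measurable_mildu mg') (measurable_Qdom mD) (Qdom_ge0 D0) mdQ dQ0 mdP dP0
  (nw_Qdom mD D0 hD hND) hdQ hdP.
have {}H := H _.
have : {ae mu, forall y,
    tnorm al T eps (fun t => a y * (mildu g' (t, y) - mildu g (t, y))) ((1 + z) * dl y) /\
    (good al T eps om a (fun t => mildu g (t, y)) y (Qdom D y) /\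
     good al T eps om a (fun t => mildu g' (t, y)) y (Qdom D y)) /\
    good al T eps om a (fun t => mildu g' (t, y) - mildu g (t, y)) y (Cd * dl y)}.
  move: (aeI gD (aeI gD' gdl)); apply: aeS => y [h [h' hd]].
  have [G1 G2] := good_mildu_diff mg mg' h h' hd.
  by split => //; split => //; split; exact: good_mildu.
move/H => {}H.
move: (aeI H (aeI (Psi_bound mg mD D0 hD hND gD) (Psi_bound mg' mD D0 hD hND gD'))).
apply: aeS => x [[_ h] [[i _] [i' _]]].
apply: tnorm_eq_on h.
- by apply: measurable_funB; apply: measurable_section2; exact: measurable_Psi.
- move=> t tT; rewrite /Psi RintegralB//; [exact: i'|exact: i].
Qed.

End Psi_contraction.


Fixpoint pic (n : nat) : R * R -> R := if n is m.+1 then Psi (pic m) else fun=> 0.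

(** The first component is to dominate [pic n], the second [pic n.+1 - pic n]. The contraction is
    run on these explicit functions of x, which are measurable by construction, and not on optimal
    seminorms. *)
Fixpoint pst (n : nat) : (R -> R) * (R -> R) :=
  if n is m.+1 then
    let D := fun x => (pst m).1 x + (pst m).2 x in (D, contr D (pst m).2)
  else (fun=> 0, stepdom (Qdom (fun=> 0)) (Qdom (fun=> 0)) (Pdom (fun=> 0))).

Let ND := F / (1 - th).
Let ND0 : 0 <= ND. Proof. by rewrite divr_ge0// ltW. Qed.

Let thn (n : nat) : 0 <= th ^+ n <= 1.
Proof. by rewrite exprn_ge0// exprn_ile1// ltW. Qed.

Lemma nw_zero : (nw w (fun=> 0%R) <= 0%:E)%E.
Proof. by rewrite /nw; under eq_integral do rewrite mul0r; rewrite integral0. Qed.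

(** The factor (1 - th^n) / (1 - th) is the partial sum of the geometric series: each increment has
    norm at most th times the previous one, and the first at most F. *)
Lemma pic_inv n :
  [/\ measurable_fun [set: R * R] (pic n),
     measurable_fun [set: R] (pst n).1 /\ measurable_fun [set: R] (pst n).2,
     (forall x, 0 <= (pst n).1 x) /\ (forall x, 0 <= (pst n).2 x),
     (nw w (pst n).1 <= ((1 - th ^+ n) * ND)%:E)%E /\ (nw w (pst n).2 <= (th ^+ n * F)%:E)%E &
     {ae mu, forall x, tnorm al T eps (fun t => pic n (t, x)) ((pst n).1 x) /\
       tnorm al T eps (fun t => pic n.+1 (t, x) - pic n (t, x)) ((pst n).2 x)}].
Proof.
elim: n => [|n [mp [mD md] [D0 d0] [nD nd] hae]].
- have m0 : measurable_fun [set: R] (fun _ : R => 0 : R) by exact: measurable_cst.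
  have z_0 (x : R) : 0 <= (fun _ : R => 0 : R) x by [].
  have g0 : {ae mu, forall x : R, tnorm al T eps (fun t => (fun _ : R * R => 0 : R) (t, x)) 0}.
    by apply: aeW => x; exact: tnorm0.
  have PB := Psi_bound (measurable_cst (0 : R)) m0 z_0 nw_zero ND0 g0.
  have mQ := measurable_Qdom m0; have Q0 := Qdom_ge0 z_0.
  have mP := measurable_Pdom m0; have P0 := Pdom_ge0 z_0.
  have nQ : (nw w (Qdom (fun=> 0%R)) <= F%:E)%E.
    by apply: le_trans (nw_affine Cd0 m0 z_0 nw_zero) _; rewrite mulr0 addr0.
  have nP : (nw w (Pdom (fun=> 0%R)) <= F%:E)%E.
    by apply: le_trans (nw_Pdom m0 z_0 nw_zero) _; rewrite mulr0 addr0.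
  have nQS : (nw w (Qdom (fun=> 0%R)) <= S%:E)%E by exact: (nw_Qdom m0 z_0 nw_zero ND0).
  split.
  + exact: measurable_cst.
  + by split => //=; exact: (measurable_stepdom mQ Q0 mQ Q0 mP P0).
  + by split => //= x; exact: (stepdom_ge0 Q0 Q0 P0).
  + split; first by rewrite /= expr0 subrr mul0r; exact: nw_zero.
    apply: le_trans (nw_stepdom mQ Q0 mQ Q0 mP P0 nQS nQ nP) _.
    rewrite lee_fin expr0 -mulrDl ler_wpM2r//.
    (* The first increment only has to be bounded by F, for which q + cst tau <= th < 1 suffices. *)
    have h1 : q <= q * (1 + z) by rewrite ler_peMr// lerDl ltW.
    have h2 : cst * tau <= cst * tau * Cd by rewrite ler_peMr.
    exact: le_trans (lerD h1 h2) (le_trans hth (ltW th1)).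
  + move: PB; apply: aeS => x [_ h]; split; first exact: tnorm0.
    by apply: tnorm_eq h => t /=; rewrite subr0.
- have mD1 : measurable_fun [set: R] (fun x => (pst n).1 x + (pst n).2 x) by exact: measurable_funD.
  have D10 x : 0 <= (pst n).1 x + (pst n).2 x by rewrite addr_ge0.
  have nD1 : (nw w (fun x => (pst n).1 x + (pst n).2 x)%R <= ((1 - th ^+ n.+1) * ND)%:E)%E.
    rewrite nwD//; apply: le_trans (leeD nD nd) _.
    rewrite -EFinD lee_fin exprS /ND le_eqVlt; apply/orP; left; apply/eqP.
    by field; rewrite gt_eqF.
  have nle : (1 - th ^+ n.+1) * ND <= ND.
    by rewrite ler_piMl// gerDl oppr_le0; case/andP: (thn n.+1).
  have h1 : {ae mu, forall x, tnorm al T eps (fun t => pic n (t, x)) ((pst n).1 x + (pst n).2 x)}.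
    by move: hae; apply: aeS => x [h _]; apply: tnorm_le h; rewrite lerDl.
  have h2 : {ae mu, forall x, tnorm al T eps (fun t => pic n.+1 (t, x)) ((pst n).1 x + (pst n).2 x)}.
    move: hae; apply: aeS => x [h h']; apply: tnorm_eq (tnormD eps01 h h') => t.
    by rewrite addrC subrK.
  have h3 : {ae mu, forall x, tnorm al T eps (fun t => pic n.+1 (t, x) - pic n (t, x)) ((pst n).2 x)}.
    by move: hae; apply: aeS => x [].
  have mp1 : measurable_fun [set: R * R] (pic n.+1) by exact: measurable_Psi.
  have PC := Psi_contr mp mp1 mD1 D10 md d0 nD1 nle nd h1 h2 h3.
  split => //.
  + by split => //=; exact: measurable_contr.
  + by split => //= x; exact: contr_ge0.
  + split => //=; apply: le_trans (nw_contr mD1 D10 md d0 nD1 nle nd) _.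
    by rewrite exprS mulrA.
  + move: (aeI h2 PC); exact: aeS.
Qed.

Let E_ n x := (pst n).1 x.

Lemma pst_incr n j x : E_ n x <= E_ (n + j)%N x.
Proof.
elim: j => [|j IH]; first by rewrite addn0.
rewrite addnS; apply: le_trans IH _; rewrite /E_/= lerDl.
by case: (pic_inv (n + j)) => _ _ [].
Qed.

Lemma nw_pst_diff n j : (nw w (fun x => E_ (n + j) x - E_ n x)%R <= ((th ^+ n - th ^+ (n + j)) * ND)%:E)%E.
Proof.
elim: j => [|j IH].
  rewrite addn0 subrr mul0r /nw.
  by under eq_integral do rewrite subrr mul0r; rewrite integral0.
have [_ [mD md] [D0 d0] [_ nd] _] := pic_inv (n + j).
have [_ [mDn _] _ _ _] := pic_inv n.
rewrite addnS.
have -> : (fun x => E_ (n + j).+1 x - E_ n x) = (fun x => (E_ (n + j) x - E_ n x) + (pst (n + j)).2 x).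
  by apply/funext => x; rewrite /E_/=; ring.
rewrite nwD//.
- apply: le_trans (leeD IH nd) _.
  rewrite -EFinD lee_fin exprS /ND le_eqVlt; apply/orP; left; apply/eqP.
  by field; rewrite gt_eqF.
- exact: measurable_funB.
- by move=> x; rewrite subr_ge0 pst_incr.
Qed.

Lemma pic_diff n j : {ae mu, forall x,
  tnorm al T eps (fun t => pic (n + j) (t, x) - pic n (t, x)) (E_ (n + j) x - E_ n x)}.
Proof.
elim: j => [|j IH].
  apply: aeW => x; rewrite addn0 subrr; apply: tnorm_eq (tnorm0 _ _ _) => t.
  by rewrite subrr.
have [_ _ _ _ h] := pic_inv (n + j).
move: (aeI IH h); apply: aeS => x [h1 [_ h2]]; rewrite addnS.
rewrite (_ : E_ (n + j).+1 x - E_ n x = (E_ (n + j) x - E_ n x) + (pst (n + j)).2 x); last first.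
  by rewrite /E_/=; ring.
apply: tnorm_eq (tnormD eps01 h1 h2) => t; ring.
Qed.

(** The limit is taken size by size: almost every x has dominating functions of the remainders that
    become arbitrarily small, and there the iterates converge at all times of the interval at once.
    The fixed point equation thus holds for every t outside one null set of sizes. *)
Theorem picard : exists (g : R * R -> R) (D : R -> R),
  [/\ measurable_fun [set: R * R] g, measurable_fun [set: R] D, forall x, 0 <= D x,
     (nw w D <= ND%:E)%E &
     {ae mu, forall x, tnorm al T eps (fun t => g (t, x)) (D x) /\
       forall t : R, 0 < t <= T ->
         mu.-integrable [set: R] (fun y => (rker a b k (mildu g) ((t, x), y))%:E) /\
         Psi g (t, x) = g (t, x)}].
Proof.
(* The dominating function [r n] of all differences [pic (n + j) - pic n], with norm at most th^n
   ND. *)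
have rex n : exists H : R -> R, [/\ measurable_fun [set: R] H, forall x, 0 <= H x,
    (nw w H <= (th ^+ n * ND)%:E)%E &
    {ae mu, forall x, forall j, E_ (n + j)%N x - E_ n x <= H x}].
  apply: (nw_mono_lim mw w1 (h := fun j x => E_ (n + j) x - E_ n x)).
  - move=> j; apply: measurable_funB.
      by case: (pic_inv (n + j)) => _ [].
    by case: (pic_inv n) => _ [].
  - by move=> j x; rewrite subr_ge0 pst_incr.
  - by move=> x; apply/nondecreasing_seqP => j; rewrite lerD2r -addn1 addnA pst_incr.
  - move=> j; apply: le_trans (nw_pst_diff n j) _; rewrite lee_fin ler_wpM2r//.
    by rewrite lerBlDr lerDl; case/andP: (thn (n + j)).
have [r hr] := choice rex.
have mr n : measurable_fun [set: R] (r n) by case: (hr n).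
have r0 n x : 0 <= r n x by case: (hr n).
have nr n : (nw w (r n) <= (th ^+ n * ND)%:E)%E by case: (hr n).
have ra : {ae mu, forall x, forall n j, E_ (n + j)%N x - E_ n x <= r n x}.
  by apply: ae_foralln => n; case: (hr n).
have pa : {ae mu, forall x, forall n j,
    tnorm al T eps (fun t => pic (n + j) (t, x) - pic n (t, x)) (E_ (n + j) x - E_ n x)}.
  by apply: ae_foralln => n; apply: ae_foralln => j; exact: pic_diff.
have th01 : 0 <= th < 1 by rewrite th0.
have ri := nw_inf_ae0 mw w1 mr r0 th01 nr.
(* An upper limit is measurable everywhere, including on the sizes where the iterates may
   diverge. *)
pose g (p : R * R) : R := fine (limn_esup (fun n => (pic n p)%:E)).
have mg : measurable_fun [set: R * R] g.
  apply: (measurableT_comp (fine_measurable measurableT)).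
  apply: measurable_fun_limn_esup => n; apply/measurable_EFinP.
  by case: (pic_inv n).
have gcv : {ae mu, forall x, forall t : R, 0 < t <= T ->
    (fun n => pic n (t, x)) @ \oo --> (g (t, x) : R)}.
  move: (aeI ra (aeI pa ri)); apply: aeS => x [hra [hpa hri]] t tT.
  have e0 : 0 < eps by case/andP: eps01.
  have t0 : 0 < t by case/andP: tT.
  have tal : 0 < t `^ al by rewrite powR_gt0.
  have et : 0 < eps * t by rewrite mulr_gt0.
  have /cvg_ex[/= l hl] : cvgn (fun n => pic n (t, x)).
    apply: cauchy_seq_cvg => e e_gt0.
    have [|n hn] := hri (eps * t * e / t `^ al); first by rewrite divr_gt0// mulr_gt0.
    exists n => j; case: (hpa n j) => _ _ /(_ t tT) h _.
    rewrite -(ler_pM2l et); apply: le_trans h _.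
    rewrite mulrC -ler_pdivlMr//; apply: le_trans (hra n j) _.
    exact: ltW.
  suff -> : g (t, x) = l by [].
  have hc : (fun n => (pic n (t, x))%:E) @ \oo --> l%:E.
    by apply: cvg_EFin; [near=> n|exact: hl].
  by rewrite /g; have [_ ->] := cvg_limn_einf_sup hc.
have gn n : {ae mu, forall x, tnorm al T eps (fun t => g (t, x) - pic n (t, x)) (r n x)}.
  move: (aeI gcv (aeI pa ra)); apply: aeS => x [hg [hpa hra]].
  apply: (@tnorm_lim _ al T eps (fun j t => pic (n + j) (t, x) - pic n (t, x))).
  - apply: measurable_funB; apply: measurable_section2 => //.
    by case: (pic_inv n).
  - by move=> j; apply: tnorm_le (hpa n j).
  - move=> t tT; apply: cvgB; last exact: cvg_cst.
    have := hg t tT; rewrite -(cvg_shiftn n) => h.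
    by apply: cvg_trans h; apply: near_eq_cvg; near=> j; rewrite addnC.
have g0 : {ae mu, forall x, tnorm al T eps (fun t => g (t, x)) (r 0%N x)}.
  by move: (gn 0%N); apply: aeS => x; apply: tnorm_eq => t /=; rewrite subr0.
have nr0 : (nw w (r 0%N) <= ND%:E)%E by have := nr 0%N; rewrite expr0 mul1r.
have gp n : {ae mu, forall x, tnorm al T eps (fun t => pic n (t, x)) (r 0%N x)}.
  move: (aeI pa ra); apply: aeS => x [hpa hra].
  by apply: tnorm_eq (tnorm_le (hra 0%N n) (hpa 0%N n)) => t /=; rewrite add0n subr0.
have mpic n : measurable_fun [set: R * R] (pic n) by case: (pic_inv n).
(* Psi g - g is (Psi g - Psi (pic n)) - (g - pic n.+1): the first term is controlled by the
   contraction applied to [r n], the second by [r n.+1]. *)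
pose H n x := contr (r 0%N) (r n) x + r n.+1 x.
have mH n : measurable_fun [set: R] (H n).
  by apply: measurable_funD => //; exact: (measurable_contr (mr 0%N) (r0 0%N) (mr n) (r0 n)).
have H0 n x : 0 <= H n x by rewrite addr_ge0//; exact: contr_ge0.
have nH n : (nw w (H n) <= (th ^+ n * (2 * ND))%:E)%E.
  have mc := measurable_contr (mr 0%N) (r0 0%N) (mr n) (r0 n).
  have c0 := contr_ge0 (r0 0%N) (r0 n).
  rewrite nwD//.
  apply: le_trans (leeD (nw_contr (mr 0%N) (r0 0%N) (mr n) (r0 n) nr0 (lexx _) (nr n)) (nr n.+1)) _.
  rewrite -EFinD lee_fin exprS mulrA.
  have /andP[a1 a2] := thn n.
  have : th * th ^+ n * ND <= th ^+ n * ND by rewrite ler_wpM2r// ler_piMl// ltW.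
  lra.
have HS n : {ae mu, forall x, tnorm al T eps (fun t => Psi g (t, x) - g (t, x)) (H n x)}.
  have PC := Psi_contr (mpic n) mg (mr 0%N) (r0 0%N) (mr n) (r0 n) nr0 (lexx _) (nr n) (gp n) g0 (gn n).
  move: (aeI PC (gn n.+1)); apply: aeS => x [h1 h2].
  by apply: tnorm_eq (tnormB eps01 h1 h2) => t /=; rewrite opprB addrA subrK.
have Hi := nw_inf_ae0 mw w1 mH H0 th01 nH.
have HSa := ae_foralln HS.
exists g, (r 0%N); split => //.
move: (aeI (aeI Hi HSa) (aeI g0 (Psi_bound mg (mr 0%N) (r0 0%N) nr0 (lexx _) g0))).
apply: aeS => x [[hi hs] [hg [hint _]]]; split => // t tT; split; first exact: hint.
have e0 : 0 < eps by case/andP: eps01.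
have t0 : 0 < t by case/andP: tT.
have tal : 0 < t `^ al by rewrite powR_gt0.
have et : 0 < eps * t by rewrite mulr_gt0.
(* A nonzero value at time t would contradict the pointwise bound of [tnorm] for an n with [H n x]
   small enough. *)
apply/eqP; rewrite -subr_eq0 -normr_le0 leNgt; apply/negP => pos.
have [|n hn] := hi (eps * t * `|Psi g (t, x) - g (t, x)| / t `^ al).
  by rewrite divr_gt0// mulr_gt0.
case: (hs n) => _ _ /(_ t tT); rewrite leNgt; move: hn.
by rewrite ltr_pdivlMr// mulrC => ->.
Unshelve. all: by end_near.
Qed.

End picard.

(** * Regularity of mild solutions *)

Section dominated_continuity.
Context {R : realType}.
Local Notation mu := (@lebesgue_measure R).

(** Two separate demands: a domination that is integrable in x, and a Hoelder modulus whose constant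
    V may depend on x in any way. The second only supplies pointwise convergence. The exponent al is
    what is available at time 0. *)
Lemma dct_small (al d0 t : R) (W Dom : R -> R) (I : set R) (phi : R -> R -> R) :
  0 < al -> 0 < d0 -> measurable_fun [set: R] W -> (forall x, 0 <= W x) ->
  measurable_fun [set: R] Dom -> (forall x, 0 <= Dom x) ->
  (\int[mu]_x (Dom x)%:E < +oo)%E ->
  (forall s : R, I s -> measurable_fun [set: R] (phi s)) ->
  {ae mu, forall x, (forall s : R, I s -> `|s - t| < d0 -> `|phi s x| * W x <= Dom x) /\
    exists2 V : R, 0 <= V & forall s : R, I s -> `|s - t| < d0 -> `|phi s x| <= V * `|s - t| `^ al} ->
  forall e : R, 0 < e -> exists2 d : R, 0 < d & forall s : R, I s -> `|s - t| < d ->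
    (\int[mu]_x (`|phi s x| * W x)%:E < e%:E)%E.
Proof.
move=> al0 d00 mW W0 mDom Dom0 fDom mphi hae e e0.
apply: contrapT => /forall2NP nh.
have pick_s (n : nat) : exists s : R, [/\ I s, `|s - t| < d0, `|s - t| `^ al <= n.+1%:R^-1 &
    (e%:E <= \int[mu]_x (`|phi s x| * W x)%:E)%E].
  (* Chosen so that |s - t| < d gives |s - t|^al <= 1 / (n + 1). *)
  pose d := Num.min d0 ((n.+1%:R^-1) `^ al^-1).
  have dpos : 0 < d by rewrite lt_min d00 powR_gt0// invr_gt0 ltr0n.
  case: (nh d) => [//|/existsNP[s]/not_implyP[Is]/not_implyP[sd]/negP].
  rewrite -leNgt => he; exists s; split => //.
  - by apply: lt_le_trans sd _; rewrite ge_min lexx.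
  - apply: (@le_trans _ _ ((n.+1%:R^-1 `^ al^-1) `^ al)).
      apply: ge0_ler_powR; rewrite ?nnegrE ?powR_ge0 ?(ltW al0)//.
      by apply: ltW; apply: lt_le_trans sd _; rewrite ge_min lexx orbT.
    by rewrite -powRrM mulVf ?gt_eqF// powRr1// invr_ge0.
have [s hs] := choice pick_s.
have mf n : measurable_fun [set: R] (fun x => (`|phi (s n) x| * W x)%:E).
  apply/measurable_EFinP; apply: measurable_funM => //.
  by apply: measurableT_comp => //; apply: mphi; case: (hs n).
have iDom : mu.-integrable [set: R] (fun x => (Dom x)%:E).
  apply/integrableP; split; first by apply/measurable_EFinP; exact: mDom.
  by under eq_integral do rewrite gee0_abs ?lee_fin//.
have c1 : {ae mu, forall x, [set: R] x -> (fun n => (`|phi (s n) x| * W x)%:E) @ \oo --> (0 : \bar R)%E}.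
  move: hae; apply: aeS.
  move=> x [hD [V V0 hV]] _.
    apply: cvg_EFin; first by near=> n.
    apply: (@squeeze_cvgr _ _ _ _ (fun=> 0) (fun n => V * W x * n.+1%:R^-1)).
    + near=> n; rewrite mulr_ge0//=.
      case: (hs n) => Is sd0 sn _.
      rewrite mulrAC ler_wpM2r//; apply: le_trans (hV _ Is sd0) _.
      by rewrite ler_wpM2l.
    + exact: cvg_cst.
    + rewrite -[X in _ --> X](mulr0 (V * W x)); apply: cvgMr; exact: cvg_harmonic.
have c2 : {ae mu, forall x n, [set: R] x -> (`|(`|phi (s n) x| * W x)%:E| <= (Dom x)%:E)%E}.
  move: hae; apply: aeS => x [hD _] n _; case: (hs n) => Is sd0 _ _.
  by rewrite gee0_abs lee_fin ?mulr_ge0// hD.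
have [_ _ cv] := @dominated_convergence _ _ _ mu [set: R] measurableT
  (fun n x => (`|phi (s n) x| * W x)%:E) (fun=> 0%E) (fun x => (Dom x)%:E) mf (measurable_cst _) c1 iDom c2.
have {}cv : (fun n => \int[mu]_x (`|phi (s n) x| * W x)%:E)%E @ \oo --> (0 : \bar R)%E.
  by move: cv; rewrite integral0.
have : (e%:E <= (0 : \bar R))%E.
  rewrite -(cvg_lim _ cv)//; apply: lime_ge; first by apply: cvgP cv.
  by near=> n; case: (hs n).
by rewrite lee_fin leNgt e0.
Unshelve. all: by end_near.
Qed.

End dominated_continuity.

Section mild_regularity.
Context {R : realType}.
Local Notation mu := (@lebesgue_measure R).
Variables (al T eps a c : R) (g : R -> R) (G t1 : R).
Hypothesis al01 : 0 < al < 1.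
Hypothesis T01 : 0 < T <= 1.
Hypothesis eps01 : 0 < eps <= 2^-1.
Hypothesis a0 : 0 <= a.
Hypothesis hg : tnorm al T eps g G.
Hypothesis t10 : 0 < t1.

(** [supc] and [lipc] are the factors of [tnorm_sup] and [tnorm_Lip] at the time t1 > 0, beyond
    which the rates are regular. *)
Definition supc : R := t1 `^ al / (eps * t1).
Definition lipc : R := t1 `^ al / (eps * t1) ^+ 2.

Let e0 : 0 < eps. Proof. by case/andP: eps01. Qed.
Let mg : measurable_fun [set: R] g. Proof. by case: hg. Qed.
Let G0 : 0 <= G. Proof. exact: tnorm_ge0 hg. Qed.

Lemma lipc_ge0 : 0 <= lipc.
Proof. by rewrite divr_ge0 ?powR_ge0 ?sqr_ge0. Qed.

Lemma supc_ge0 : 0 <= supc.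
Proof. by rewrite divr_ge0 ?powR_ge0// mulr_ge0// ltW. Qed.

Lemma tnorm_supc (p : R -> R) (P t : R) : tnorm al T eps p P -> t1 <= t -> t <= T ->
  `|p t| <= supc * P.
Proof.
move=> hp t1t tT; have := tnorm_sup al01 T01 eps01 hp t10 t1t tT.
by rewrite /supc mulrAC.
Qed.

Lemma tnorm_lipc (p : R -> R) (P s t : R) : tnorm al T eps p P ->
  t1 <= s <= T -> t1 <= t <= T -> `|p s - p t| <= lipc * P * `|s - t|.
Proof.
move=> hp.
have main (r r' : R) : t1 <= r -> r < r' -> r' <= T -> `|p r' - p r| <= lipc * P * (r' - r).
  move=> tr rr' rT.
  have E : r + (r' - r) = r' by ring.
  have h0 : 0 < r' - r by rewrite subr_gt0.
  have := @tnorm_Lip _ al T eps p P al01 T01 eps01 hp t1 r (r' - r) t10 tr h0.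
  rewrite E => /(_ rT).
  by rewrite /lipc (_ : t1 `^ al * P / _ = t1 `^ al / (eps * t1) ^+ 2 * P)// mulrAC.
move=> /andP[ts sT] /andP[tt tT].
have [st|ts'|->] := ltgtP s t; last by rewrite !subrr normr0 mulr0.
- have h : 0 <= t - s by rewrite subr_ge0 ltW.
  by rewrite distrC [`|s - t|]distrC (ger0_norm h) main.
- have h : 0 <= s - t by rewrite subr_ge0 ltW.
  by rewrite (ger0_norm h) main.
Qed.

Definition mild (t : R) : R := expR (- (a * t)) * c + duh a g t.

Lemma mild_split (s t : R) : 0 < s -> s <= t -> t <= T ->
  mild t = expR (- (a * (t - s))) * mild s +
    \int[mu]_(r in `]s, t]) (expR (- (a * (t - r))) * g r).
Proof.
move=> s0 st tT; rewrite /mild (duh_split a0 hg s0 st tT).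
have -> : expR (- (a * t)) = expR (- (a * (t - s))) * expR (- (a * s)).
  by rewrite -expRD; congr expR; ring.
set X := expR (- (a * (t - s))); ring.
Qed.

Definition mild_der (t : R) : R := - (a * mild t) + g t.

Lemma expRN_quad (x : R) : 0 <= x -> `|expR (- x) - 1 + x| <= x ^+ 2.
Proof.
move=> x0; have h1 := expR_ge1Dx (- x); have h2 := expR_ge1Dx x.
rewrite ger0_norm; last by lra.
have e1 : expR (- x) <= (1 + x)^-1.
  by rewrite expRN lef_pV2// posrE ?expR_gt0//; lra.
have e2 : (1 + x)^-1 <= 1 - x + x ^+ 2.
  rewrite -[leLHS]mul1r ler_pdivrMr; last by lra.
  nra.
lra.
Qed.

(** A Taylor expansion forward in time. The constant contains a^2 and is not meant to be integrated
    over sizes: it only yields pointwise convergence of the difference quotients. *)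
Lemma mild_quad (s t U : R) : t1 <= s -> s < t -> t <= T -> `|mild s| <= U ->
  `|mild t - mild s - (t - s) * mild_der s| <=
    (a ^+ 2 * U + lipc * G + a * (supc * G)) * (t - s) ^+ 2.
Proof.
move=> t1s st tT hU; have s0 : 0 < s by exact: lt_le_trans t1s.
have ts0 : 0 < t - s by rewrite subr_gt0.
rewrite (mild_split s0 (ltW st) tT) /mild_der.
set h := t - s; set E := expR _.
set J := \int[mu]_(r in _) _.
have hI : \int[mu]_(r in `]s, t]) (g s) = h * g s.
  rewrite /Rintegral integral_cst//= lebesgue_measure_itv/= lte_fin st -EFinD -EFinM/=.
  by rewrite mulrC.
have sup r : s < r <= t -> `|g r| <= supc * G.
  move=> /andP[sr rt]; apply: tnorm_supc hg _ _; last exact: le_trans tT.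
  by rewrite (le_trans t1s)// ltW.
have mE : measurable_fun [set: R] (fun r => expR (- (a * (t - r)))).
  apply: measurableT_comp => //; apply: measurableT_comp => //.
  by apply: measurable_funM => //; exact: measurable_funB.
have eI r : r <= t -> 0 <= 1 - expR (- (a * (t - r))) <= a * (t - r).
  move=> rt; have := expR_ge1Dx (- (a * (t - r))).
  have : expR (- (a * (t - r))) <= 1 by rewrite -expR0 ler_expR oppr_le0 mulr_ge0// subr_ge0.
  by lra.
have mfin : (mu `]s, t] < +oo)%E by rewrite /= lebesgue_measure_itv/= lte_fin st -EFinD ltey.
have i1 : mu.-integrable `]s, t] (fun r => (expR (- (a * (t - r))) * g r)%:E).
  apply: measurable_bounded_integrable => //.
  - by apply: measurable_funTS; exact: measurable_funM.
  - exists (supc * G); split; first exact: num_real.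
    move=> y cy r; rewrite /= in_itv/= => rI.
    apply: le_trans (_ : `|g r| <= _); last by apply: le_trans (sup _ rI) _; exact: ltW.
    have rt : r <= t by case/andP: rI.
    rewrite normrM ger0_norm ?expR_ge0// ler_piMl//.
    by case/andP: (eI _ rt) => h1 _; rewrite -subr_ge0.
have i2 : mu.-integrable `]s, t] (fun r => (g s)%:E).
  apply: measurable_bounded_integrable => //.
  exists `|g s|; split; first exact: num_real.
  by move=> y cy r _; exact: ltW.
have HJ : `|J - h * g s| <= (lipc * G * h + a * h * (supc * G)) * h.
  rewrite -hI /J -RintegralB// -[leLHS]mul1r.
  apply: (@norm_Rintegral_le _ _ _ (fun=> lipc * G * h + a * h * (supc * G))) => //.
  - apply: measurable_funTS; apply: measurable_funB => //; exact: measurable_funM.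
  - move=> r; rewrite /= in_itv/= => rI; rewrite mul1r.
    have /andP[sr rt] := rI.
    have -> : expR (- (a * (t - r))) * g r - g s =
      (g r - g s) - (1 - expR (- (a * (t - r)))) * g r by ring.
    apply: le_trans (ler_normB _ _) _; apply: lerD.
      have h1 : t1 <= r <= T by rewrite (le_trans t1s (ltW sr)) (le_trans rt).
      have h2 : t1 <= s <= T by rewrite t1s (le_trans (ltW st)).
      apply: le_trans (tnorm_lipc hg h1 h2) _.
      have rs : 0 <= r - s by rewrite subr_ge0 ltW.
      rewrite ger0_norm//; apply: ler_wpM2l; first exact: mulr_ge0 lipc_ge0 G0.
      by rewrite /h lerD2r.
    rewrite normrM; have /andP[e1 e2] := eI _ rt.
    rewrite (ger0_norm e1); apply: ler_pM => //; last exact: sup.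
    apply: le_trans e2 _; rewrite ler_wpM2l// /h lerD2l lerN2 ltW//.
  - rewrite integral_cst//= lebesgue_measure_itv/= lte_fin st -EFinD -EFinM lee_fin.
    by [].
have HE : `|E - 1 + a * h| <= (a * h) ^+ 2 by apply: expRN_quad; rewrite mulr_ge0// ltW.
have -> : E * mild s + J - mild s - h * (- (a * mild s) + g s) =
  (E - 1 + a * h) * mild s + (J - h * g s) by ring.
apply: le_trans (ler_normD _ _) _; rewrite normrM.
apply: (@le_trans _ _ ((a * h) ^+ 2 * U + (lipc * G * h + a * h * (supc * G)) * h)).
  by apply: lerD => //; apply: ler_pM.
by rewrite le_eqVlt; apply/orP; left; apply/eqP; ring.
Qed.

Variables (om Q P : R).
Hypothesis om1 : 1 <= om.
Let rho : R := (om + a) `^ al.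
Let tau : R := T `^ (1 - al).
Hypothesis hQ : forall t : R, 0 <= t <= T -> `|rho * mild t| <= Q.
Hypothesis hQt : tnorm al T eps (fun t => rho * mild t) (tau * Q).
Hypothesis hP : tnorm al T eps (fun t => a * mild t) P.

Let rho1 : 1 <= rho.
Proof.
apply: powR_ge1 => //; apply: le_trans om1 _; by rewrite lerDl.
Qed.
Let rho0 : 0 <= rho. Proof. exact: le_trans rho1. Qed.
Let Q0 : 0 <= Q.
Proof. by apply: le_trans (hQ (t := 0) _) => //; rewrite lexx; case/andP: T01 => /ltW. Qed.

Lemma mild_der_tnorm : tnorm al T eps mild_der (P + G).
Proof. by apply: tnormD => //; exact: tnormN. Qed.

Lemma mild_le (t : R) : 0 <= t <= T -> `|mild t| <= Q.
Proof.
move=> tT; apply: le_trans (hQ tT); rewrite normrM (ger0_norm rho0) ler_peMl//.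
Qed.

Lemma mild_rho_lip (s t : R) : t1 <= s <= T -> t1 <= t <= T ->
  `|mild s - mild t| * rho <= lipc * (tau * Q) * `|s - t|.
Proof.
move=> sT tT; have := tnorm_lipc hQt sT tT.
by rewrite -mulrBr normrM (ger0_norm rho0) mulrC.
Qed.

Lemma mild_rate_lip (s t : R) : t1 <= s <= T -> t1 <= t <= T ->
  `|mild s - mild t| * a <= lipc * P * `|s - t|.
Proof.
move=> sT tT; have := tnorm_lipc hP sT tT.
by rewrite -mulrBr normrM (ger0_norm a0) mulrC.
Qed.

Definition quadc : R := a ^+ 2 * Q + lipc * G + a * (supc * G) + lipc * (P + G).

Lemma quadc_ge0 : 0 <= quadc.
Proof.
have l0 := lipc_ge0; have s0 := supc_ge0.
have P0 := tnorm_ge0 T01 eps01 hP.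
have PG : 0 <= P + G by exact: addr_ge0.
by rewrite /quadc; do 3 ?apply: addr_ge0; do ?[apply: mulr_ge0 => //]; rewrite ?sqr_ge0.
Qed.

(** [mild_quad] expands at the earlier time. If that is s, the derivative has to be moved from s to
    t, which accounts for the last term of [quadc]. *)
Lemma mild_quot (s t : R) : t1 <= s <= T -> t1 <= t <= T -> s != t ->
  `|(mild s - mild t) / (s - t) - mild_der t| <= quadc * `|s - t|.
Proof.
have t1p := ltW t10.
have U (r : R) : t1 <= r <= T -> `|mild r| <= Q.
  by case/andP=> h1 h2; apply: mild_le; rewrite h2 (le_trans t1p).
have P0 := tnorm_ge0 T01 eps01 hP.
have lip0 := lipc_ge0.
move=> sT tT; have /andP[ts sT'] := sT; have /andP[tt tT'] := tT.
case: (ltgtP s t) => // st _.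
- have h : 0 < t - s by rewrite subr_gt0.
  have q := mild_quad ts st tT' (U _ sT).
  have d := tnorm_lipc mild_der_tnorm tT sT.
  have hn : s - t != 0 by rewrite subr_eq0 lt_eqF.
  have -> : (mild s - mild t) / (s - t) - mild_der t =
    (mild t - mild s - (t - s) * mild_der s) / (t - s) - (mild_der t - mild_der s).
    have hn' : t - s != 0 by rewrite gt_eqF.
    move: (mild s) (mild t) (mild_der s) (mild_der t) => A B C D.
    by field; rewrite hn hn'.
  apply: le_trans (ler_normB _ _) _.
  rewrite [`|s - t|]distrC (ger0_norm (ltW h)) /quadc [leRHS]mulrDl.
  apply: lerD; last by move: d; rewrite (ger0_norm (ltW h)).
  rewrite normrM normfV (ger0_norm (ltW h)) ler_pdivrMr//.
  by apply: le_trans q _; rewrite expr2 !mulrA.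
- have h : 0 < s - t by rewrite subr_gt0.
  have q := mild_quad tt st sT' (U _ tT).
  have -> : (mild s - mild t) / (s - t) - mild_der t =
    (mild s - mild t - (s - t) * mild_der t) / (s - t).
    have hn : s - t != 0 by rewrite gt_eqF.
    move: (mild s) (mild t) (mild_der t) hn => A B C hn.
    by field.
  rewrite normrM normfV (ger0_norm (ltW h)) ler_pdivrMr//.
  rewrite -mulrA -expr2; apply: le_trans q _; apply: ler_wpM2r; first exact: sqr_ge0.
  by rewrite /quadc lerDl mulr_ge0// addr_ge0.
Qed.

Lemma mild_quot_rho (s t : R) : t1 <= s <= T -> t1 <= t <= T -> s != t ->
  `|(mild s - mild t) / (s - t)| * rho <= lipc * (tau * Q).
Proof.
move=> sT tT st; have h : 0 < `|s - t| by rewrite normr_gt0 subr_eq0.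
rewrite normrM normfV mulrAC ler_pdivrMr//; exact: mild_rho_lip.
Qed.

(** Neither [rho * (a * mild)] nor [rho * g] is controlled separately. Their combination is a limit
    of difference quotients of [rho * mild], which is Lipschitz, and inherits the Lipschitz
    constant; t < T leaves room for a step to the right. *)
Lemma mild_der_rho (t : R) : t1 <= t < T -> `|mild_der t| * rho <= lipc * (tau * Q).
Proof.
move=> /andP[tt tT]; apply/ler_addgt0Pr => e e_gt0.
have qr : 0 < quadc * rho + 1.
  by rewrite addrC ltr_pwDl// mulr_ge0// quadc_ge0.
(* With this step the error [quadc * h * rho] of the quotient is at most e; the added 1 keeps the
   denominator positive. *)
pose h := Num.min (T - t) (e / (quadc * rho + 1)).
have h0 : 0 < h by rewrite lt_min subr_gt0 tT divr_gt0.
have hT : t1 <= t + h <= T.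
  rewrite (le_trans tt) ?lerDl ?(ltW h0)//= -lerBrDl.
  by rewrite ge_min lexx.
have tT' : t1 <= t <= T by rewrite tt ltW.
have ne : t + h != t by rewrite -subr_eq0 addrAC subrr add0r gt_eqF.
have q1 := mild_quot_rho hT tT' ne; have q2 := mild_quot hT tT' ne.
move: q1 q2; rewrite (_ : t + h - t = h); last by ring.
rewrite (ger0_norm (ltW h0)); set X := (_ / _); move=> q1 q2.
have -> : mild_der t = X - (X - mild_der t) by ring.
apply: (@le_trans _ _ ((`|X| + `|X - mild_der t|) * rho)).
  by apply: ler_wpM2r => //; exact: ler_normB.
rewrite mulrDl lerD//.
apply: (@le_trans _ _ (quadc * h * rho)); first exact: ler_wpM2r.
apply: (@le_trans _ _ ((quadc * rho + 1) * h)).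
  by rewrite mulrAC [leRHS]mulrDl mul1r lerDl ltW.
rewrite -ler_pdivlMl// mulrC.
by rewrite ge_min lexx orbT.
Qed.

Lemma mild_0 : mild 0 = c.
Proof.
rewrite /mild mulr0 oppr0 expR0 mul1r /duh set_itv1.
by rewrite /Rintegral integral_set1//= addr0.
Qed.

(** At time 0 only Hoelder continuity of order al remains, from |duh| <= s^al G; the free part is
    Lipschitz, and s <= s^al. *)
Lemma mild_cont0 (s : R) : 0 <= s <= T -> `|mild s - mild 0| <= (a * `|c| + G) * s `^ al.
Proof.
case/andP=> s0 sT; rewrite mild_0.
have al0 : 0 < al by case/andP: al01.
move: s0; rewrite le_eqVlt => /predU1P[<-|s0].
  by rewrite mild_0 subrr normr0 mulr_ge0 ?powR_ge0// addr_ge0// mulr_ge0.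
have -> : mild s - c = (expR (- (a * s)) - 1) * c + duh a g s by rewrite /mild; ring.
apply: le_trans (ler_normD _ _) _; rewrite [leRHS]mulrDl; apply: lerD; last first.
  rewrite [leRHS]mulrC; apply: norm_duh_le => //; first exact: hg.
  by rewrite s0.
have as0 : 0 <= a * s by rewrite mulr_ge0// ltW.
rewrite normrM mulrAC; apply: ler_wpM2r => //.
have h1 := expR_ge1Dx (- (a * s)).
have h2 : expR (- (a * s)) <= 1 by rewrite -expR0 ler_expR oppr_le0.
have h3 : s <= s `^ al.
  apply: le_powR_le1 => //; rewrite (ltW s0)/=; apply: le_trans sT _; by case/andP: T01.
rewrite ler0_norm; last by lra.
apply: (@le_trans _ _ (a * s)); first by lra.
exact: ler_wpM2l.
Qed.

End mild_regularity.

Section regularity.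
Context {R : realType}.
Local Notation mu := (@lebesgue_measure R).
Variables (al T eps om : R) (a w f : R -> R) (g : R * R -> R) (D Q P : R -> R).
Hypothesis al01 : 0 < al < 1.
Hypothesis T01 : 0 < T <= 1.
Hypothesis eps01 : 0 < eps <= 2^-1.
Hypothesis om1 : 1 <= om.
Hypothesis ma : measurable_fun [set: R] a.
Hypothesis a0 : forall x, 0 <= a x.
Hypothesis mw : measurable_fun [set: R] w.
Hypothesis w1 : forall x, 1 <= w x.
Hypothesis mf : measurable_fun [set: R] f.
Hypothesis mg : measurable_fun [set: R * R] g.
Hypothesis mQ : measurable_fun [set: R] Q.
Hypothesis Q0 : forall x, 0 <= Q x.
Hypothesis hQ : (nw w Q < +oo)%E.
Hypothesis mP : measurable_fun [set: R] P.
Hypothesis P0 : forall x, 0 <= P x.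
Hypothesis hP : (nw w P < +oo)%E.
Let rho x := (om + a x) `^ al.
Let tau := T `^ (1 - al).
Let U t x := mildu a f g (t, x).
Hypothesis hx : {ae mu, forall x, [/\ tnorm al T eps (fun t => g (t, x)) (D x),
  good al T eps om a (fun t => U t x) x (Q x) &
  tnorm al T eps (fun t => a x * U t x) (P x)]}.

Definition mildu_der (t x : R) : R := - (a x * U t x) + g (t, x).

Let w0 x : 0 <= w x. Proof. exact: le_trans (w1 x). Qed.
Let rho0 x : 0 <= rho x. Proof. exact: powR_ge0. Qed.
Let tau0 : 0 <= tau. Proof. exact: powR_ge0. Qed.
Let e0 : 0 < eps. Proof. by case/andP: eps01. Qed.
Let T0 : 0 < T. Proof. by case/andP: T01. Qed.
Let T1 : T <= 1. Proof. by case/andP: T01. Qed.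
Let al0 : 0 < al. Proof. by case/andP: al01. Qed.
Let mrho : measurable_fun [set: R] rho. Proof. exact: measurable_rho. Qed.

Lemma measurable_mildu_at t : measurable_fun [set: R] (U t).
Proof. exact: (measurable_section1 t (measurable_mildu ma mf mg)). Qed.

Lemma measurable_mildu_der t : measurable_fun [set: R] (mildu_der t).
Proof.
apply: measurable_funD; last exact: (measurable_section1 t mg).
apply: measurableT_comp => //; apply: measurable_funM => //; exact: measurable_mildu_at.
Qed.

Lemma dct_nw (d0 t C : R) (W1 Dm : R -> R) (I : set R) (phi : R -> R -> R) :
  0 < d0 -> measurable_fun [set: R] W1 -> (forall x, 0 <= W1 x) ->
  measurable_fun [set: R] Dm -> (forall x, 0 <= Dm x) -> (nw w Dm < +oo)%E -> 0 <= C ->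
  (forall s : R, I s -> measurable_fun [set: R] (phi s)) ->
  {ae mu, forall x, (forall s : R, I s -> `|s - t| < d0 -> `|phi s x| * W1 x <= C * Dm x) /\
    exists2 V : R, 0 <= V & forall s : R, I s -> `|s - t| < d0 -> `|phi s x| <= V * `|s - t| `^ al} ->
  forall e : R, 0 < e -> exists2 d : R, 0 < d & forall s : R, I s -> `|s - t| < d ->
    (\int[mu]_x (`|phi s x| * (W1 x * w x))%:E < e%:E)%E.
Proof.
move=> d00 mW1 W10 mDm Dm0 hDm C0 mphi hae.
apply: (@dct_small _ al d0 t (fun x => W1 x * w x) (fun x => C * (Dm x * w x))) => //.
- exact: measurable_funM.
- by move=> x; exact: mulr_ge0.
- by apply: measurable_funM => //; exact: measurable_funM.
- by move=> x; rewrite mulr_ge0// mulr_ge0.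
- rewrite ge0_integralZ//; last 2 first.
  + exact: measurable_funM.
  + by move=> x; exact: mulr_ge0.
  by rewrite lte_mul_pinfty.
- apply: aeS hae => x [h1 h2]; split => // s Is st.
  by rewrite !mulrA; apply: ler_wpM2r => //; exact: h1.
Qed.

Let near_pow (s t : R) : `|s - t| <= 1 -> `|s - t| <= `|s - t| `^ al.
Proof. by move=> h; apply: le_powR_le1 => //; rewrite normr_ge0. Qed.

(** Times closer than t / 2 to t stay beyond t / 2, so all constants of the mild solution are taken
    at [t1 = t / 2]. *)
Let half (s t : R) : `|s - t| < t / 2 -> t / 2 <= s.
Proof. by move=> h; have := ltr_norml (s - t) (t / 2); rewrite h => /esym/andP[]; lra. Qed.

Lemma mildu_cont0 (e : R) : 0 < e -> exists2 d : R, 0 < d & forall s : R, 0 <= s < T -> `|s - 0| < d ->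
  (\int[mu]_x (`|U s x - U 0 x| * (rho x * w x))%:E < e%:E)%E.
Proof.
apply: (@dct_nw 1 0 2 rho Q (fun s => 0 <= s < T)) => //.
  by move=> s _; apply: measurable_funB; exact: measurable_mildu_at.
apply: aeS hx => x [hg [hu _] _].
have hc := mild_cont0 (f x) al01 T01 eps01 (a0 x) hg; split.
  move=> s /andP[s0 sT] _.
  have h1 : `|rho x * U s x| <= Q x by apply: hu; rewrite s0 ltW.
  have h2 : `|rho x * U 0 x| <= Q x by apply: hu; rewrite lexx ltW.
  rewrite mulrC -{1}(ger0_norm (rho0 x)) -normrM mulrBr.
  have -> : 2 * Q x = Q x + Q x by ring.
  exact: le_trans (ler_normB _ _) (lerD h1 h2).
exists (a x * `|f x| + D x).
  by rewrite addr_ge0// ?(tnorm_ge0 T01 eps01 hg)// mulr_ge0.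
move=> s /andP[s0 sT] _; rewrite subr0 (ger0_norm s0).
by apply: hc; rewrite s0 ltW.
Qed.

Section positive_time.
Variable t : R.
Hypothesis t0T : 0 < t < T.

Let t0 : 0 < t. Proof. by case/andP: t0T. Qed.
Let tT : t < T. Proof. by case/andP: t0T. Qed.
Let t20 : 0 < t / 2. Proof. by rewrite divr_gt0. Qed.
Let tI : t / 2 <= t <= T.
Proof. by rewrite (ltW tT) andbT; move: t0; lra. Qed.
Let sI (s : R) : 0 <= s < T -> `|s - t| < t / 2 -> t / 2 <= s <= T.
Proof. by move=> /andP[_ sT] /half ->; rewrite ltW. Qed.
Let st1 (s : R) : `|s - t| < t / 2 -> `|s - t| <= 1.
Proof. by move=> h; apply: ltW; apply: lt_trans h _; move: T1 tT t0; lra. Qed.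

Lemma mildu_cont (e : R) : 0 < e ->
  exists2 d : R, 0 < d & forall s : R, 0 <= s < T -> `|s - t| < d ->
  (\int[mu]_x (`|U s x - U t x| * (rho x * w x))%:E < e%:E)%E.
Proof.
pose C := lipc al eps (t / 2) * tau.
have C0 : 0 <= C by rewrite mulr_ge0// lipc_ge0.
apply: (@dct_nw (t / 2) t C rho Q (fun s => 0 <= s < T)) => //.
  by move=> s _; apply: measurable_funB; exact: measurable_mildu_at.
apply: aeS hx => x [hg [hu hut] hp].
have hc (s : R) (h1 : 0 <= s < T) (h2 : `|s - t| < t / 2) :
    `|U s x - U t x| * rho x <= C * Q x * `|s - t|.
  have := mild_rho_lip (c := f x) (g := fun s => g (s, x)) al01 T01 eps01 (a0 x) t20 om1 hut (sI h1 h2) tI.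
  by rewrite !mulrA.
split => [s Is st|].
  apply: le_trans (hc s Is st) _; apply: ler_piMr; last exact: st1.
  exact: mulr_ge0.
exists (C * Q x); first exact: mulr_ge0.
move=> s Is st; apply: le_trans (_ : `|U s x - U t x| * rho x <= _).
  by rewrite ler_peMr//; exact: rho_ge1.
apply: le_trans (hc s Is st) _; apply: ler_wpM2l; first exact: mulr_ge0.
by apply: near_pow; exact: st1.
Qed.

Lemma mildu_cont_rate (e : R) : 0 < e ->
  exists2 d : R, 0 < d & forall s : R, 0 <= s < T -> `|s - t| < d ->
  (\int[mu]_x (`|U s x - U t x| * ((1 + a x) * w x))%:E < e%:E)%E.
Proof.
pose L := lipc al eps (t / 2).
have L0 : 0 <= L by rewrite lipc_ge0.
apply: (@dct_nw (t / 2) t L (fun x => 1 + a x) (fun x => tau * Q x + P x) (fun s => 0 <= s < T)) => //.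
- exact: measurable_funD.
- by move=> x; exact: addr_ge0.
- by apply: measurable_funD => //; exact: measurable_funM.
- by move=> x; rewrite addr_ge0// mulr_ge0.
- rewrite nwD//; last 2 first.
  + exact: measurable_funM.
  + by move=> x; exact: mulr_ge0.
  rewrite nwZ//; apply: lte_add_pinfty => //; exact: lte_mul_pinfty.
- by move=> s _; apply: measurable_funB; exact: measurable_mildu_at.
apply: aeS hx => x [hg [hu hut] hp].
have hc (s : R) (h1 : 0 <= s < T) (h2 : `|s - t| < t / 2) :
    `|U s x - U t x| * (1 + a x) <= L * (tau * Q x + P x) * `|s - t|.
  have q1 := mild_rho_lip (c := f x) (g := fun s => g (s, x)) al01 T01 eps01 (a0 x) t20 om1 hut (sI h1 h2) tI.
  have q2 := mild_rate_lip (c := f x) (g := fun s => g (s, x)) al01 T01 eps01 (a0 x) t20 hp (sI h1 h2) tI.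
  rewrite [leLHS]mulrDr mulr1 [L * _]mulrDr [leRHS]mulrDl; apply: lerD => //.
  apply: le_trans q1; rewrite ler_peMr//; exact: rho_ge1.
have B0 : 0 <= L * (tau * Q x + P x) by rewrite mulr_ge0// addr_ge0// mulr_ge0.
split => [s Is st|].
  by apply: le_trans (hc s Is st) _; apply: ler_piMr => //; exact: st1.
exists (L * (tau * Q x + P x)) => //.
move=> s Is st; apply: le_trans (_ : `|U s x - U t x| * (1 + a x) <= _).
  by rewrite ler_peMr// lerDl.
apply: le_trans (hc s Is st) _; apply: ler_wpM2l => //.
by apply: near_pow; exact: st1.
Qed.

Lemma mildu_deriv (e : R) : 0 < e ->
  exists2 d : R, 0 < d & forall s : R, 0 < s < T /\ s != t -> `|s - t| < d ->
  (\int[mu]_x (`|(U s x - U t x) / (s - t) - mildu_der t x| * (rho x * w x))%:E < e%:E)%E.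
Proof.
pose C := 2 * (lipc al eps (t / 2) * tau).
have C0 : 0 <= C by do 2 ![apply: mulr_ge0 => //]; exact: lipc_ge0.
apply: (@dct_nw (t / 2) t C rho Q (fun s => 0 < s < T /\ s != t)) => //.
  move=> s _; apply: measurable_funB; last exact: measurable_mildu_der.
  by apply: measurable_funM => //; apply: measurable_funB; exact: measurable_mildu_at.
have sI' (s : R) : 0 < s < T -> `|s - t| < t / 2 -> t / 2 <= s <= T.
  by move=> /andP[s0 sT]; apply: sI; rewrite ltW.
apply: aeS hx => x [hg [hu hut] hp]; split => [s [sT st] sd|].
  have q1 : `|(U s x - U t x) / (s - t)| * rho x <= lipc al eps (t / 2) * (tau * Q x).
    exact: (mild_quot_rho (c := f x) (g := fun s => g (s, x)) al01 T01 eps01 (a0 x) t20 om1 hut (sI' s sT sd) tI st).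
  have q2 : `|mildu_der t x| * rho x <= lipc al eps (t / 2) * (tau * Q x).
    have tI' : t / 2 <= t < T by rewrite tT andbT; case/andP: tI.
    exact: (mild_der_rho (c := f x) (g := fun s => g (s, x)) al01 T01 eps01 (a0 x) hg t20 om1 hu hut hp tI').
  apply: le_trans (_ : (`|(U s x - U t x) / (s - t)| + `|mildu_der t x|) * rho x <= _).
    by apply: ler_wpM2r => //; exact: ler_normB.
  rewrite mulrDl; apply: le_trans (lerD q1 q2) _.
  by rewrite /C -!mulrA mulr_natl mulr2n.
exists (quadc al eps (a x) (D x) (t / 2) (Q x) (P x)).
  exact: (quadc_ge0 (c := f x) (g := fun s => g (s, x)) T01 eps01 (a0 x) hg t20 hu hp).
move=> s [sT st] sd; apply: le_trans
  (mild_quot (c := f x) (g := fun s => g (s, x)) al01 T01 eps01 (a0 x) hg t20 om1 hu hp (sI' s sT sd) tI st) _.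
apply: ler_wpM2l; first exact: (quadc_ge0 (c := f x) (g := fun s => g (s, x)) T01 eps01 (a0 x) hg t20 hu hp).
by apply: near_pow; exact: st1.
Qed.

Lemma mildu_der_cont (e : R) : 0 < e ->
  exists2 d : R, 0 < d & forall s : R, 0 < s < T -> `|s - t| < d ->
  (\int[mu]_x (`|mildu_der s x - mildu_der t x| * (rho x * w x))%:E < e%:E)%E.
Proof.
pose C := 2 * (lipc al eps (t / 2) * tau).
have C0 : 0 <= C by do 2 ![apply: mulr_ge0 => //]; exact: lipc_ge0.
apply: (@dct_nw (t / 2) t C rho Q (fun s => 0 < s < T)) => //.
  by move=> s _; apply: measurable_funB; exact: measurable_mildu_der.
have sI' (s : R) : 0 < s < T -> `|s - t| < t / 2 -> t / 2 <= s <= T.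
  by move=> /andP[s0 sT]; apply: sI; rewrite ltW.
apply: aeS hx => x [hg [hu hut] hp].
have bnd (s : R) : t / 2 <= s < T ->
    `|mildu_der s x| * rho x <= lipc al eps (t / 2) * (tau * Q x).
  by move=> h; exact: (mild_der_rho (c := f x) (g := fun s => g (s, x)) al01 T01 eps01 (a0 x) hg t20 om1 hu hut hp h).
split => [s sT sd|].
  have q1 : `|mildu_der s x| * rho x <= lipc al eps (t / 2) * (tau * Q x).
    by apply: bnd; case/andP: sT (sI' _ sT sd) => _ -> /andP[->].
  have q2 : `|mildu_der t x| * rho x <= lipc al eps (t / 2) * (tau * Q x).
    by apply: bnd; rewrite tT andbT; case/andP: tI.
  apply: le_trans (_ : (`|mildu_der s x| + `|mildu_der t x|) * rho x <= _).
    by apply: ler_wpM2r => //; exact: ler_normB.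
  rewrite mulrDl; apply: le_trans (lerD q1 q2) _.
  by rewrite /C -!mulrA mulr_natl mulr2n.
have hd := mild_der_tnorm (c := f x) (g := fun s => g (s, x)) eps01 hg hp.
have L0 := lipc_ge0 al eps (t / 2).
exists (lipc al eps (t / 2) * (P x + D x)).
  exact: mulr_ge0 L0 (tnorm_ge0 T01 eps01 hd).
move=> s sT sd; apply: le_trans (tnorm_lipc al01 T01 eps01 t20 hd (sI' s sT sd) tI) _.
apply: ler_wpM2l; first exact: mulr_ge0 L0 (tnorm_ge0 T01 eps01 hd).
by apply: near_pow; exact: st1.
Qed.

Lemma mildu_der_fin : (\int[mu]_x (`|mildu_der t x| * (rho x * w x))%:E < +oo)%E.
Proof.
pose C := lipc al eps (t / 2) * tau.
have C0 : 0 <= C by rewrite mulr_ge0// lipc_ge0.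
apply: (@le_lt_trans _ _ (nw w (fun x => C * Q x))); last first.
  by rewrite nwZ// lte_mul_pinfty// ?nw_ge0.
apply: ae_integral_le.
- apply: measurable_funM; last exact: measurable_funM.
  by apply: measurableT_comp => //; exact: measurable_mildu_der.
- by apply: measurable_funM => //; exact: measurable_funM.
- by move=> x; rewrite mulr_ge0// mulr_ge0.
- by move=> x; rewrite mulr_ge0// mulr_ge0.
apply: aeS hx => x [hg [hu hut] hp]; rewrite mulrA; apply: ler_wpM2r => //.
have tI' : t / 2 <= t < T by rewrite tT andbT; case/andP: tI.
have := mild_der_rho (c := f x) (g := fun s => g (s, x)) al01 T01 eps01 (a0 x) hg t20 om1 hu hut hp tI'.
by rewrite mulrA.
Qed.

End positive_time.

Lemma mildu_fin (t : R) : 0 <= t <= T -> (\int[mu]_x (`|U t x| * (rho x * w x))%:E <= nw w Q)%E.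
Proof.
move=> tT; apply: ae_integral_le.
- apply: measurable_funM; last exact: measurable_funM.
  by apply: measurableT_comp => //; exact: measurable_mildu_at.
- exact: measurable_funM.
- by move=> x; rewrite mulr_ge0// mulr_ge0.
- by move=> x; exact: mulr_ge0.
apply: aeS hx => x [hg [hu hut] hp]; rewrite mulrA; apply: ler_wpM2r => //.
by have := hu _ tT; rewrite normrM (ger0_norm (rho0 x)) mulrC.
Qed.

Lemma mildu_rate_fin (t : R) : 0 < t <= T -> (\int[mu]_x (`|U t x| * (a x * w x))%:E < +oo)%E.
Proof.
move=> /andP[t0 tT].
have C0 : 0 <= supc al eps t by exact: supc_ge0.
apply: (@le_lt_trans _ _ (nw w (fun x => supc al eps t * P x))); last first.
  by rewrite nwZ// lte_mul_pinfty// ?nw_ge0.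
apply: ae_integral_le.
- apply: measurable_funM; last exact: measurable_funM.
  by apply: measurableT_comp => //; exact: measurable_mildu_at.
- by apply: measurable_funM => //; exact: measurable_funM.
- by move=> x; rewrite mulr_ge0// mulr_ge0.
- by move=> x; rewrite mulr_ge0// mulr_ge0.
apply: aeS hx => x [hg [hu hut] hp]; rewrite mulrA; apply: ler_wpM2r => //.
have := tnorm_supc al01 T01 eps01 t0 hp (lexx t) tT.
by rewrite normrM (ger0_norm (a0 x)) mulrC.
Qed.

Lemma mildu_0 x : U 0 x = f x.
Proof. exact: mild_0. Qed.

End regularity.

(** * Energy estimates *)

Section gronwall.
Context {R : realType}.

Lemma within_continuous_dist (phi : R -> R) (t1 : R) :
  (forall t : R, 0 <= t <= t1 -> forall e : R, 0 < e -> exists2 d : R, 0 < d &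
    forall s : R, 0 <= s <= t1 -> `|s - t| < d -> `|phi s - phi t| < e) ->
  {within `[0, t1], continuous phi}.
Proof.
move=> phc; apply/subspace_continuousP => x; rewrite /= in_itv/= => xI.
apply/cvgrPdist_lt => e e0; have [d d0 hd] := phc x xI e e0.
rewrite near_withinE; apply: filterS (nbhsx_ballx x d d0) => s xs.
by rewrite /= in_itv/= => sI; rewrite distrC; apply: hd => //; rewrite distrC.
Qed.

(* The differential inequality is contradictory at a positive maximum of [expR (- (C + 1) t) * phi t]. *)
Lemma gronwall_left (phi : R -> R) (t1 C : R) : 0 < t1 -> 0 <= C ->
  (forall t : R, 0 <= t <= t1 -> 0 <= phi t) -> phi 0 = 0 ->
  (forall t : R, 0 <= t <= t1 -> forall e : R, 0 < e -> exists2 d : R, 0 < d &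
    forall s : R, 0 <= s <= t1 -> `|s - t| < d -> `|phi s - phi t| < e) ->
  (forall t : R, 0 < t <= t1 -> forall e : R, 0 < e -> exists2 d : R, 0 < d &
    forall s : R, 0 < s < t -> t - s < d -> phi t - phi s <= (t - s) * (C * phi t + e)) ->
  forall t : R, 0 <= t <= t1 -> phi t = 0.
Proof.
move=> t10 C0 phi0 ph00 phc phd.
pose psi t := expR (- ((C + 1) * t)) * phi t.
have cpsi : {within `[0, t1], continuous psi}.
  have cphi := within_continuous_dist phc.
  have cexp : {within `[0, t1], continuous (fun t : R => expR (- ((C + 1) * t)))}.
    apply: continuous_subspaceT => x; apply: continuous_comp; last exact: continuous_expR.
    by apply: continuousN; apply: continuousM; [exact: cvg_cst|exact: cvg_id].
  move/subspace_continuousP : cexp => cexp; move/subspace_continuousP : cphi => cphi.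
  by apply/subspace_continuousP => x xI; apply: cvgM; [exact: cexp|exact: cphi].
have [c /[!in_itv]/= /andP[c0 c1] hmax] := EVT_max (ltW t10) cpsi.
have [hc|hc] := leP (psi c) 0.
  move=> t tI; apply/eqP; rewrite eq_le phi0// andbT.
  have : psi t <= 0 by apply: le_trans (hmax t _) hc; rewrite in_itv.
  by rewrite /psi pmulr_rle0 ?expR_gt0.
have pc : 0 < phi c by move: hc; rewrite /psi pmulr_rgt0 ?expR_gt0.
have {}c0 : 0 < c.
  by move: c0 pc; rewrite le_eqVlt => /predU1P[<-|//]; rewrite ph00 ltxx.
have cI : 0 < c <= t1 by rewrite c0.
have p4 : 0 < phi c / 4 by rewrite divr_gt0.
have [d d0 hd] := phd c cI (phi c / 4) p4.
(* The first two bounds keep c - h positive and within the range of the differential inequality. The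
   third makes the quadratic error at most 1/4, so that comparison at the maximum would give C + 3/4
   <= C + 1/4. *)
pose h := Num.min (Num.min (c / 2) (d / 2)) ((4 * (C + 1) ^+ 2)^-1).
have C1 : 0 < C + 1 by rewrite ltr_pwDr.
have C2 : 0 < 4 * (C + 1) ^+ 2 by rewrite mulr_gt0// exprn_gt0.
have h0 : 0 < h by rewrite !lt_min !divr_gt0//= invr_gt0.
have hc2 : h <= c / 2 by rewrite !ge_min lexx.
have hd2 : h <= d / 2 by rewrite !ge_min lexx orbT.
have h4 : h * (4 * (C + 1) ^+ 2) <= 1 by rewrite -ler_pdivlMr// div1r ge_min lexx orbT.
have hh : phi c - phi (c - h) <= h * (C * phi c + phi c / 4).
  have E : c - (c - h) = h by ring.
  by rewrite -{2}E; apply: hd; rewrite ?E; lra.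
have hm : phi (c - h) <= expR (- ((C + 1) * h)) * phi c.
  have hI : c - h \in `[0, t1] by rewrite in_itv/=; lra.
  have := hmax _ hI; rewrite /psi.
  have -> : - ((C + 1) * (c - h)) = - ((C + 1) * c) + (C + 1) * h by ring.
  rewrite expRD -mulrA ler_pM2l ?expR_gt0// expRN => hm.
  by rewrite mulrC ler_pdivlMr ?expR_gt0// mulrC.
have he : expR (- ((C + 1) * h)) <= 1 - (C + 1) * h + ((C + 1) * h) ^+ 2.
  have := expRN_quad (x := (C + 1) * h); rewrite mulr_ge0 ?(ltW h0) ?(ltW C1)// => /(_ isT).
  by rewrite ler_norml => /andP[_]; lra.
have h5 : phi (c - h) <= (1 - (C + 1) * h + ((C + 1) * h) ^+ 2) * phi c.
  by apply: le_trans hm _; apply: ler_wpM2r => //; exact: ltW.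
have h6 : phi c * (((C + 1) * h) - ((C + 1) * h) ^+ 2) <= h * (C * phi c + phi c / 4) by lra.
have h7 : h * (phi c * ((C + 1) - (C + 1) ^+ 2 * h)) <= h * (C * phi c + phi c / 4).
  by apply: le_trans h6; rewrite le_eqVlt; apply/orP; left; apply/eqP; ring.
rewrite ler_pM2l// in h7.
have h8 : phi c * (h * (4 * (C + 1) ^+ 2)) <= phi c * 1 by rewrite ler_pM2l.
exfalso; nra.
Qed.

End gronwall.

Section fixed_time.
Context {R : realType}.
Local Notation mu := (@lebesgue_measure R).
Variables (al om K Cw q M : R) (a w : R -> R) (b k : R * R -> R).
Hypothesis al01 : 0 < al < 1.
Hypothesis om1 : 1 <= om.
Hypothesis ma : measurable_fun [set: R] a.
Hypothesis a0 : forall x, 0 <= a x.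
Hypothesis mw : measurable_fun [set: R] w.
Hypothesis w1 : forall x, 1 <= w x.
Hypothesis Cw0 : 0 <= Cw.
Hypothesis wadd : forall x y, w (x + y) <= Cw * (w x * w y).
Hypothesis mb : measurable_fun [set: R * R] b.
Hypothesis b0 : forall p, 0 <= b p.
Hypothesis mk : measurable_fun [set: R * R] k.
Hypothesis k0 : forall p, 0 <= k p.
Hypothesis K0 : 0 <= K.
Let rho x := (om + a x) `^ al.
Hypothesis kle : forall x y, k (x, y) <= K * (rho x * rho y).
Hypothesis q0 : 0 <= q.
Hypothesis q1 : q < 1.
Hypothesis M1 : 1 <= M.
Hypothesis bw : {ae mu, forall y,
  (\int[mu]_x (b (x, y) * w x)%:E <= (q * w y)%:E)%E \/
  (\int[mu]_x (b (x, y) * w x)%:E <= (M * w y)%:E)%E /\ a y <= M}.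

Let w0 x : 0 <= w x. Proof. exact: le_trans (w1 x). Qed.
Let rho1 x : 1 <= rho x.
Proof. by apply: powR_ge1 => //; apply: le_trans om1 _; rewrite lerDl. Qed.
Let rho0 x : 0 <= rho x. Proof. exact: powR_ge0. Qed.
Let mrho : measurable_fun [set: R] rho. Proof. exact: measurable_rho. Qed.
Let M0 : 0 <= M. Proof. exact: le_trans M1. Qed.

Definition rk (v : R -> R) (x y : R) : R :=
  b (x, y) * (a y * v y) + 2^-1 * (k (x - y, y) * (v (x - y) * v y)) - k (x, y) * (v x * v y).

(* [rdom] at [T = 1], where its time factor [T `^ (1 - al)] is 1 *)
Definition endom (h F : R -> R) : R * R -> R :=
  rdom al 1 K b (ratedom al 1 M a (fun x => rho x * h x) (fun x => a x * h x))
    (fun x => rho x * F x) (fun x => rho x * h x).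

Definition enint (h F : R -> R) (x : R) : R := fine (\int[mu]_y (endom h F (x, y))%:E).

Lemma endom_ge (h F : R -> R) (x y : R) : (forall x, 0 <= h x) ->
  b (x, y) * (a y * h y) +
  K * (rho (x - y) * h (x - y) * (rho y * F y) + rho (x - y) * F (x - y) * (rho y * h y)) +
  2 * K * (rho x * h x * (rho y * F y) + rho x * F x * (rho y * h y)) <= endom h F (x, y).
Proof.
move=> h0; rewrite /endom /rdom powR1 !mulr1/= !lerD2r; apply: ler_wpM2l => //.
rewrite /ratedom powR1 mulr1; case: ifP => // aM; apply: ler_pM => //.
by rewrite ler_peMl.
Qed.

Lemma kprod_le (c r s A h1 h2 F1 F2 : R) : 0 <= r -> 0 <= s -> 0 <= c <= K * (r * s) ->
  A <= h1 * F2 + F1 * h2 -> 0 <= h1 * F2 + F1 * h2 ->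
  c * A <= K * (r * h1 * (s * F2) + r * F1 * (s * h2)).
Proof.
move=> r0 s0 /andP[c0 cK] hA h0; apply: (@le_trans _ _ (c * (h1 * F2 + F1 * h2))).
  exact: ler_wpM2l.
apply: le_trans (ler_wpM2r h0 cK) _.
by rewrite le_eqVlt; apply/orP; left; apply/eqP; ring.
Qed.

Let kin x y : 0 <= k (x, y) <= K * (rho x * rho y). Proof. by rewrite k0 kle. Qed.

Lemma rk_diff_le (u v : R -> R) (x y : R) :
  `|rk u x y - rk v x y| <=
    endom (fun x => `|u x - v x|) (fun x => `|u x| + `|v x|) (x, y).
Proof.
apply: le_trans (endom_ge _ _ _ _) => //.
set h := fun x => `|u x - v x|; set F := fun x => `|u x| + `|v x|.
have prod (x' y' : R) : `|u x' * u y' - v x' * v y'| <= h x' * F y' + F x' * h y'.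
  have -> : u x' * u y' - v x' * v y' = (u x' - v x') * u y' + v x' * (u y' - v y') by ring.
  apply: le_trans (ler_normD _ _) _; rewrite !normrM.
  by apply: lerD; [apply: ler_wpM2l => //|apply: ler_wpM2r => //]; rewrite /F ?lerDl ?lerDr.
have prod0 (x' y' : R) : 0 <= h x' * F y' + F x' * h y' by exact: le_trans (prod x' y').
have T1 := kprod_le (rho0 (x - y)) (rho0 y) (kin (x - y) y) (prod (x - y) y) (prod0 _ _).
have T2 := kprod_le (rho0 x) (rho0 y) (kin x y) (prod x y) (prod0 _ _).
have -> : rk u x y - rk v x y = b (x, y) * (a y * (u y - v y)) +
  2^-1 * (k (x - y, y) * (u (x - y) * u y - v (x - y) * v y)) -
  k (x, y) * (u x * u y - v x * v y) by rewrite /rk; ring.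
apply: le_trans (ler_normB _ _) _; apply: lerD.
  apply: le_trans (ler_normD _ _) _; apply: lerD.
    by rewrite !normrM (ger0_norm (b0 _)) (ger0_norm (a0 _)).
  rewrite !normrM (ger0_norm (k0 _)) -[leRHS]mul1r; apply: ler_pM => //.
    by rewrite mulr_ge0.
  by rewrite ger0_norm; lra.
rewrite normrM (ger0_norm (k0 _)) -[2 * K * _]mulrA; apply: le_trans (T2) _.
apply: ler_peMl; last by lra.
exact: le_trans (mulr_ge0 (k0 (x, y)) (normr_ge0 _)) T2.
Qed.

Lemma rk_le (v : R -> R) (x y : R) :
  [/\ `|b (x, y) * (a y * v y)| <= endom (fun x => `|v x|) (fun x => `|v x|) (x, y),
      `|k (x - y, y) * (v (x - y) * v y)| <= endom (fun x => `|v x|) (fun x => `|v x|) (x, y) &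
      `|k (x, y) * (v x * v y)| <= endom (fun x => `|v x|) (fun x => `|v x|) (x, y)].
Proof.
have := @endom_ge (fun x => `|v x|) (fun x => `|v x|) x y (fun x => normr_ge0 _).
have prod (x' y' : R) : `|v x' * v y'| <= `|v x'| * `|v y'| + `|v x'| * `|v y'|.
  by rewrite normrM lerDl mulr_ge0.
have prod0 (x' y' : R) : 0 <= `|v x'| * `|v y'| + `|v x'| * `|v y'| by exact: le_trans (prod x' y').
have T1 := kprod_le (rho0 (x - y)) (rho0 y) (kin (x - y) y) (prod (x - y) y) (prod0 _ _).
have T2 := kprod_le (rho0 x) (rho0 y) (kin x y) (prod x y) (prod0 _ _).
have h1 := mulr_ge0 (k0 (x - y, y)) (normr_ge0 (v (x - y) * v y)).
have h2 := mulr_ge0 (k0 (x, y)) (normr_ge0 (v x * v y)).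
have E1 : `|b (x, y) * (a y * v y)| = b (x, y) * (a y * `|v y|).
  by rewrite !normrM (ger0_norm (b0 _)) (ger0_norm (a0 _)).
have h3 : 0 <= b (x, y) * (a y * `|v y|) by rewrite !mulr_ge0.
have E2 : `|k (x - y, y) * (v (x - y) * v y)| = k (x - y, y) * `|v (x - y) * v y|.
  by rewrite normrM (ger0_norm (k0 _)).
have E3 : `|k (x, y) * (v x * v y)| = k (x, y) * `|v x * v y|.
  by rewrite normrM (ger0_norm (k0 _)).
rewrite E1 E2 E3; move: T1 T2 h1 h2 h3.
set B := b _ * _; set k1 := k _ * _; set k2 := k _ * _; rewrite -[2 * K * _]mulrA.
set X := K * _; set Y := K * _; set E := endom _ _ _.
by move=> *; split; lra.
Qed.

Definition negp (z : R) : R := Num.max (- z) 0.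

(** In - rk, the fragmentation and gain terms are positive only through a negative value of u, and
    the loss term carries the factor u(x) < 0 itself. Hence the bound is linear in the negative
    part, with |u| as the other factor. *)
Lemma rk_negp_le (u : R -> R) (x y : R) :
  (if u x < 0 then - rk u x y else 0) <= endom (fun x => negp (u x)) (fun x => `|u x|) (x, y).
Proof.
have n0 (z : R) : 0 <= negp z by rewrite /negp le_max lexx orbT.
have := @endom_ge (fun x => negp (u x)) (fun x => `|u x|) x y (fun x => n0 (u x)).
have n1 (z : R) : - z <= negp z by rewrite /negp le_max lexx.
have hp (z z' : R) : - (z * z') <= negp z * `|z'| + `|z| * negp z'.
  rewrite /negp; have [h|h] := leP (- z) 0; have [h'|h'] := leP (- z') 0.
  - by rewrite mul0r mulr0 addr0; nra.
  - by rewrite mul0r add0r (ger0_norm (_ : 0 <= z)); nra.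
  - by rewrite mulr0 addr0 (ger0_norm (_ : 0 <= z')); nra.
  - by rewrite (ler0_norm (_ : z <= 0)) ?(ler0_norm (_ : z' <= 0)); nra.
have hp0 (z z' : R) : 0 <= negp z * `|z'| + `|z| * negp z' by rewrite addr_ge0// mulr_ge0.
have T1 := kprod_le (rho0 (x - y)) (rho0 y) (kin (x - y) y) (hp (u (x - y)) (u y)) (hp0 _ _).
have h3 : b (x, y) * (a y * - u y) <= b (x, y) * (a y * negp (u y)).
  by do 2 apply: ler_wpM2l => //.
have X0 : 0 <= K * (rho (x - y) * negp (u (x - y)) * (rho y * `|u y|) +
  rho (x - y) * `|u (x - y)| * (rho y * negp (u y))).
  by rewrite mulr_ge0// addr_ge0// !mulr_ge0.
have h4 : 0 <= b (x, y) * (a y * negp (u y)) by rewrite !mulr_ge0.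
have Y0 : 0 <= K * (rho x * negp (u x) * (rho y * `|u y|) + rho x * `|u x| * (rho y * negp (u y))).
  by rewrite mulr_ge0// addr_ge0// !mulr_ge0.
rewrite -[2 * K * _]mulrA; case: ifPn => ux; last first.
  by move: X0 Y0 h4; set A := K * _; set B := K * _; set C := b _ * _; set E := endom _ _ _; lra.
have hq : u x * u y <= negp (u x) * `|u y| + `|u x| * negp (u y).
  apply: (@le_trans _ _ (negp (u x) * `|u y|)); last by rewrite lerDl mulr_ge0.
  have -> : negp (u x) = `|u x| by rewrite /negp ltr0_norm// maxEle leNgt oppr_gt0 ux.
  by rewrite -normrM ler_norm.
have T2 := kprod_le (rho0 x) (rho0 y) (kin x y) hq (hp0 _ _).
have E : - rk u x y = b (x, y) * (a y * - u y) + 2^-1 * (k (x - y, y) * - (u (x - y) * u y)) +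
  k (x, y) * (u x * u y) by rewrite /rk; ring.
rewrite E; move: T1 T2 h3 X0 Y0 h4.
set A := K * _; set B := K * _; set C := b _ * _; set D := b _ * _; set E' := endom _ _ _.
set k1 := k _ * _; set k2 := k _ * _; lra.
Qed.

(** By scaling: z^al <= 1 + z at z = (om + a) / L, multiplied by L^al. The choice of L makes L^al /
    L equal to e. *)
Lemma rho_young (e : R) : 0 < e -> exists2 Ce : R, 0 <= Ce & forall x, rho x <= e * a x + Ce.
Proof.
move=> e0; have [al0 al1] := andP al01; have al1' : 0 < 1 - al by rewrite subr_gt0.
pose L := e^-1 `^ (1 - al)^-1.
have L0 : 0 < L by rewrite powR_gt0// invr_gt0.
exists (e * om + L `^ al); first by rewrite addr_ge0 ?powR_ge0// mulr_ge0 ?(ltW e0)// (le_trans _ om1).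
move=> x; have s0 : 0 <= om + a x by rewrite addr_ge0// (le_trans _ om1).
have -> : rho x = L `^ al * ((om + a x) / L) `^ al.
  by rewrite -powRM ?(ltW L0) ?divr_ge0 ?(ltW L0)// mulrC divfK// gt_eqF.
have h : ((om + a x) / L) `^ al <= 1 + (om + a x) / L.
  have d0 : 0 <= (om + a x) / L by rewrite divr_ge0// ltW.
  have [h1|h1] := leP ((om + a x) / L) 1.
    apply: le_trans (powR_le1 al01 _) _; first by rewrite d0.
    by rewrite lerDl.
  by apply: le_trans (powR_le_ge1 al01 (ltW h1)) _; rewrite lerDr.
apply: le_trans (ler_wpM2l (powR_ge0 _ _) h) _.
have E : L `^ al / L = e.
  have h2 : L `^ (1 - al) = e^-1.
    by rewrite /L -powRrM mulVf ?gt_eqF// powRr1// invr_ge0 ltW.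
  have h3 := powR_split al (ltW L0).
  rewrite {2}h3 h2 invfM invrK mulrCA divff ?mulr1// gt_eqF// powR_gt0//.
by rewrite mulrDr mulr1 mulrCA E; lra.
Qed.

Lemma measurable_rhoM (h : R -> R) : measurable_fun [set: R] h ->
  measurable_fun [set: R] (fun x => rho x * h x).
Proof. by move=> mh; exact: measurable_funM. Qed.

Lemma measurable_rateM (h : R -> R) : measurable_fun [set: R] h ->
  measurable_fun [set: R] (fun x => a x * h x).
Proof. by move=> mh; exact: measurable_funM. Qed.

Section sizes.
Variables (h F : R -> R).
Hypothesis mh : measurable_fun [set: R] h.
Hypothesis mF : measurable_fun [set: R] F.
Hypothesis h0 : forall x, 0 <= h x.
Hypothesis F0 : forall x, 0 <= F x.
Hypothesis fF : (nw w (fun x => rho x * F x)%R < +oo)%E.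
Hypothesis fh : (nw w (fun x => rho x * h x)%R < +oo)%E.
Hypothesis fah : (nw w (fun x => a x * h x)%R < +oo)%E.

Let mrF := measurable_rhoM mF.
Let mrh := measurable_rhoM mh.
Let mah := measurable_rateM mh.
Let rF0 x : 0 <= rho x * F x. Proof. exact: mulr_ge0. Qed.
Let rh0 x : 0 <= rho x * h x. Proof. exact: mulr_ge0. Qed.
Let ah0 x : 0 <= a x * h x. Proof. exact: mulr_ge0. Qed.
Let mA := measurable_ratedom al 1 M ma mrh mah.
Let A0 := ratedom_ge0 al 1 a M1 rh0 ah0.

Let finE (G : R -> R) : (forall x, 0 <= G x) -> (nw w G < +oo)%E -> nw w G = (fine (nw w G))%:E.
Proof. by move=> G0 fG; rewrite fineK// ge0_fin_numE// nw_ge0. Qed.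

Lemma dint_endom_le :
  (\int[mu]_x \int[mu]_y (endom h F (x, y) * w x)%:E <=
   (q * fine (nw w (fun x => a x * h x)%R) + (M ^+ 2 + K * (2 * Cw + 4) *
     fine (nw w (fun x => rho x * F x)%R)) * fine (nw w (fun x => rho x * h x)%R))%:E)%E.
Proof.
have := rdom_bound al 1 ma mw w1 Cw0 wadd mb b0 K0 q0 M1 (ltW q1) bw mrF rF0 mrh rh0 mah ah0
  (N := fine (nw w (fun x => rho x * h x)%R)) (S := fine (nw w (fun x => rho x * F x)%R))
  (NP := fine (nw w (fun x => a x * h x)%R)).
by rewrite powR1 mulr1; apply; rewrite -finE.
Qed.

Lemma measurable_enint : measurable_fun [set: R] (enint h F).
Proof. exact: (measurable_rdomint al 1 mb b0 K0 mA A0 mrF rF0 mrh rh0). Qed.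

Lemma measurable_endom : measurable_fun [set: R * R] (endom h F).
Proof. exact: (measurable_rdom al 1 K mb mA mrF mrh). Qed.

Lemma endom_ge0 p : 0 <= endom h F p.
Proof. exact: (rdom_ge0 al 1 b0 K0 A0 rF0 rh0). Qed.

Lemma enint_ge0 x : 0 <= enint h F x.
Proof. exact: (rdomint_ge0 al 1 b0 K0 A0 rF0 rh0). Qed.

Lemma nw_enint_le : (nw w (enint h F) <= \int[mu]_x \int[mu]_y (endom h F (x, y) * w x)%:E)%E.
Proof. exact: (nw_rdomint_le al 1 mw w1 mb b0 K0 mA A0 mrF rF0 mrh rh0). Qed.

Lemma nw_enint_fin : (nw w (enint h F) < +oo)%E.
Proof. by apply: le_lt_trans nw_enint_le _; apply: le_lt_trans dint_endom_le _; rewrite ltey. Qed.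

Lemma ae_endom_fin : {ae mu, forall x, mu.-integrable [set: R] (fun y => (endom h F (x, y))%:E)}.
Proof.
have : {ae mu, forall x, (\int[mu]_y (endom h F (x, y))%:E < +oo)%E}.
  apply: (ae_rdom_fin mw w1 mb b0 K0 mA A0 mrF rF0 mrh rh0).
  by apply: le_lt_trans dint_endom_le _; rewrite ltey.
apply: aeS => x fx; apply/integrableP; split.
  by apply/measurable_EFinP; exact: (measurable_section1 x measurable_endom).
by under eq_integral do rewrite gee0_abs ?lee_fin ?endom_ge0//.
Qed.

Lemma nw_h_fin : (nw w h < +oo)%E.
Proof.
apply: le_lt_trans fh; apply: nw_le => //; apply: aeW => x; exact: ler_peMl.
Qed.

End sizes.

(** Fragmentation contributes q times the absorption. The remaining terms are linear in rho h and,
    by [rho_young], use at most the fraction 1 - q of the absorption plus a multiple of h. C depends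
    on F only through the bound N, hence may be used at all times. *)
Lemma energy_bound (N : R) : exists2 C : R, 0 <= C & forall h F : R -> R,
  measurable_fun [set: R] h -> measurable_fun [set: R] F -> (forall x, 0 <= h x) ->
  (forall x, 0 <= F x) -> (nw w (fun x => rho x * F x)%R <= N%:E)%E ->
  (nw w (fun x => rho x * h x)%R < +oo)%E -> (nw w (fun x => a x * h x)%R < +oo)%E ->
  fine (nw w (enint h F)) <= fine (nw w (fun x => a x * h x)%R) + C * fine (nw w h).
Proof.
pose c0 := M ^+ 2 + K * (2 * Cw + 4) * `|N|.
have c00 : 0 <= c0.
  rewrite addr_ge0 ?sqr_ge0// !mulr_ge0// addr_ge0// mulr_ge0//.
(* Gives c0 e <= 1 - q; the added 1 avoids division by zero. *)
pose e := (1 - q) / (c0 + 1).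
have c01 : 0 < c0 + 1 by rewrite addrC ltr_pwDl.
have e0 : 0 < e by rewrite divr_gt0// subr_gt0.
have [Ce Ce0 hCe] := rho_young e0.
exists (c0 * Ce); first exact: mulr_ge0.
move=> h F mh mF h0 F0 hN fh fah.
have fF := le_lt_trans hN (ltey _).
have bnd := le_trans (nw_enint_le mh mF h0 F0) (dint_endom_le mh mF h0 F0 fF fh fah).
have fE := nw_enint_fin mh mF h0 F0 fF fh fah.
have {bnd} bnd : fine (nw w (enint h F)) <= q * fine (nw w (fun x => a x * h x)%R) +
    (M ^+ 2 + K * (2 * Cw + 4) * fine (nw w (fun x => rho x * F x)%R)) *
    fine (nw w (fun x => rho x * h x)%R).
  by rewrite -lee_fin fineK// ge0_fin_numE// nw_ge0//; exact: enint_ge0.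
have rF0 x : 0 <= rho x * F x by exact: mulr_ge0.
have rh0 x : 0 <= rho x * h x by exact: mulr_ge0.
have ah0 x : 0 <= a x * h x by exact: mulr_ge0.
have fi (G : R -> R) : (forall x, 0 <= G x) -> 0 <= fine (nw w G).
  by move=> G0; rewrite fine_ge0// nw_ge0.
have fhw := nw_h_fin mh h0 fh.
have hrh : fine (nw w (fun x => rho x * h x)%R) <=
    e * fine (nw w (fun x => a x * h x)%R) + Ce * fine (nw w h).
  rewrite -lee_fin EFinD !EFinM !fineK; try by rewrite ge0_fin_numE// nw_ge0.
  rewrite -nwZ ?(ltW e0)//; last exact: measurable_rateM.
  rewrite -nwZ// -nwD//; last 4 first.
  - by apply: measurable_funM => //; exact: measurable_rateM.
  - exact: measurable_funM.
  - by move=> x; rewrite mulr_ge0// ltW.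
  - by move=> x; rewrite mulr_ge0.
  apply: nw_le => //.
  - exact: measurable_rhoM.
  - apply: measurable_funD; last exact: measurable_funM.
    by apply: measurable_funM => //; exact: measurable_rateM.
  - by move=> x; rewrite addr_ge0// mulr_ge0// ltW.
  - by apply: aeW => x; rewrite mulrA -mulrDl; apply: ler_wpM2r.
have hN' : fine (nw w (fun x => rho x * F x)%R) <= `|N|.
  apply: le_trans (ler_norm N); rewrite -lee_fin fineK// ge0_fin_numE// nw_ge0//.
have i1 : (M ^+ 2 + K * (2 * Cw + 4) * fine (nw w (fun x => rho x * F x)%R)) <= c0.
  by rewrite lerD2l; apply: ler_wpM2l => //; rewrite mulr_ge0// addr_ge0// mulr_ge0.
have A0 := fi _ ah0; have H0 := fi _ h0; have RH0 := fi _ rh0.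
apply: le_trans bnd _.
have i2 := ler_wpM2r RH0 i1.
have i3 := ler_wpM2l c00 hrh.
have i4 : c0 * e <= 1 - q.
  rewrite /e mulrCA ler_piMr ?subr_ge0 ?(ltW q1)// ler_pdivrMr// mul1r lerDl//.
have i5 := ler_wpM2r A0 i4.
move: i2 i3 i5; set X := fine (nw w (fun x => rho x * h x)); set Y := fine (nw w (fun x => a x * h x)).
set Z := fine (nw w h); set U := (_ + _) * X; rewrite mulrDr !mulrA => i2 i3 i5.
lra.
Qed.

Section vanishing.
Variables (hf sg : R -> R) (t1 N : R) (Z G F : R -> R -> R).
Hypothesis mhf : measurable_fun [set: R] hf.
Hypothesis hf0 : forall z, 0 <= hf z.
Hypothesis hf_le : forall z, hf z <= `|z|.
Hypothesis hf_lip : forall z z', hf z - hf z' <= `|z - z'|.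
Hypothesis hf_cvx : forall z z', hf z' - hf z <= sg z' * (z' - z).
Hypothesis sg1 : forall z, `|sg z| <= 1.
Hypothesis t10 : 0 < t1.
Hypothesis mZ : forall t : R, 0 <= t <= t1 -> measurable_fun [set: R] (Z t).
Hypothesis mG : forall t : R, 0 < t <= t1 -> measurable_fun [set: R] (G t).
Hypothesis mF : forall t : R, 0 < t <= t1 -> measurable_fun [set: R] (F t).
Hypothesis F0 : forall t x : R, 0 <= F t x.
Hypothesis fZ : forall t : R, 0 <= t <= t1 -> (nw w (fun x => rho x * `|Z t x|)%R < +oo)%E.
Hypothesis faZ : forall t : R, 0 < t <= t1 -> (nw w (fun x => a x * `|Z t x|)%R < +oo)%E.
Hypothesis hN : forall t : R, 0 < t <= t1 -> (nw w (fun x => rho x * F t x)%R <= N%:E)%E.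
Hypothesis cZ : forall t : R, 0 <= t <= t1 -> forall e : R, 0 < e -> exists2 d : R, 0 < d &
  forall s : R, 0 <= s <= t1 -> `|s - t| < d -> (nw w (fun x => `|Z s x - Z t x|)%R < e%:E)%E.
Hypothesis dZ : forall t : R, 0 < t <= t1 -> forall e : R, 0 < e -> exists2 d : R, 0 < d &
  forall s : R, 0 < s < t -> t - s < d ->
    (nw w (fun x => `|(Z s x - Z t x) / (s - t) - G t x|)%R < e%:E)%E.
Hypothesis gen : forall t : R, 0 < t <= t1 -> {ae mu, forall x,
  sg (Z t x) * G t x + a x * hf (Z t x) <= enint (fun x => hf (Z t x)) (F t) x}.
Hypothesis Z0 : {ae mu, forall x, hf (Z 0 x) = 0}.

Let H t x := hf (Z t x).
Let mH (t : R) : 0 <= t <= t1 -> measurable_fun [set: R] (H t).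
Proof. by move=> tI; apply: measurableT_comp => //; exact: mZ. Qed.
Let H0 t x : 0 <= H t x. Proof. exact: hf0. Qed.

Let fin_le (c : R -> R) (t : R) : measurable_fun [set: R] c -> (forall x, 0 <= c x) ->
  0 <= t <= t1 -> (nw w (fun x => c x * `|Z t x|)%R < +oo)%E -> (nw w (fun x => c x * H t x)%R < +oo)%E.
Proof.
move=> mc c0 tI; apply: le_lt_trans; apply: nw_le => //.
- by apply: measurable_funM => //; exact: mH.
- by apply: measurable_funM => //; apply: measurableT_comp => //; exact: mZ.
- by move=> x; exact: mulr_ge0.
- by move=> x; exact: mulr_ge0.
- by apply: aeW => x; apply: ler_wpM2l => //; exact: hf_le.
Qed.

Let frH (t : R) : 0 <= t <= t1 -> (nw w (fun x => rho x * H t x)%R < +oo)%E.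
Proof. by move=> tI; apply: fin_le => //; exact: fZ. Qed.

Let fH (t : R) : 0 <= t <= t1 -> (nw w (H t) < +oo)%E.
Proof. by move=> tI; apply: nw_h_fin (frH tI) => //; exact: mH. Qed.

Let fnum (P : R -> R) : (forall x, 0 <= P x) -> (nw w P < +oo)%E -> nw w P \is a fin_num.
Proof. by move=> P0 fP; rewrite ge0_fin_numE// nw_ge0. Qed.

Let phi (t : R) : R := fine (nw w (H t)).

Let phi_cont (t : R) : 0 <= t <= t1 -> forall e : R, 0 < e -> exists2 d : R, 0 < d &
  forall s : R, 0 <= s <= t1 -> `|s - t| < d -> `|phi s - phi t| < e.
Proof.
move=> tI e e0; have [d d0 hd] := cZ tI e0; exists d => // s sI st.
have half (r r' : R) : 0 <= r <= t1 -> 0 <= r' <= t1 ->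
    (nw w (fun x => `|Z r x - Z r' x|)%R < e%:E)%E -> phi r < phi r' + e.
  move=> rI r'I hr; rewrite -lte_fin EFinD /phi !fineK; try by apply: fnum => //; exact: fH.
  apply: (@le_lt_trans _ _ (nw w (H r') + nw w (fun x => `|Z r x - Z r' x|)%R)%E); last first.
    by rewrite lteD2lE// fnum// fH.
  have mD : measurable_fun [set: R] (fun x => `|Z r x - Z r' x|).
    by apply: measurableT_comp => //; apply: measurable_funB; exact: mZ.
  rewrite -nwD//; last exact: mH.
  apply: nw_le => //; [exact: mH|apply: measurable_funD => //; exact: mH| |].
    by move=> x; exact: addr_ge0.
  by apply: aeW => x; have := hf_lip (Z r x) (Z r' x); rewrite /H; lra.
have h1 := half s t sI tI (hd s sI st).
have h2 : phi t < phi s + e.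
  apply: half => //; have := hd s sI st.
  by rewrite /nw; under [in X in X -> _]eq_integral do rewrite distrC.
by rewrite ltr_norml; apply/andP; split; lra.
Qed.

(** Convexity with the subgradient taken at the later time bounds hf(Z t) - hf(Z s) by sg(Z t) (Z t
    - Z s), where the left difference quotient may be replaced by G t up to an error that is small
    in norm. No chain rule for the nonsmooth hf is involved. *)
Let phi_diff (C : R) : 0 <= C -> (forall h F : R -> R,
    measurable_fun [set: R] h -> measurable_fun [set: R] F -> (forall x, 0 <= h x) ->
    (forall x, 0 <= F x) -> (nw w (fun x => rho x * F x)%R <= N%:E)%E ->
    (nw w (fun x => rho x * h x)%R < +oo)%E -> (nw w (fun x => a x * h x)%R < +oo)%E ->
    fine (nw w (enint h F)) <= fine (nw w (fun x => a x * h x)%R) + C * fine (nw w h)) ->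
  forall t : R, 0 < t <= t1 -> forall e : R, 0 < e -> exists2 d : R, 0 < d &
    forall s : R, 0 < s < t -> t - s < d -> phi t - phi s <= (t - s) * (C * phi t + e).
Proof.
move=> C0 hC t tI e e0; have [d d0 hd] := dZ tI e0; exists d => // s st sd.
have tI' : 0 <= t <= t1 by case/andP: tI => h ->; rewrite ltW.
have sI : 0 <= s <= t1.
  by move: st tI => /andP[s0 st] /andP[_ t1']; rewrite (ltW s0) (le_trans (ltW st)).
have sI' : 0 < s <= t1 by case/andP: sI => _ ->; case/andP: st => ->.
have ts : 0 < t - s by rewrite subr_gt0; case/andP: st.
pose D x := `|(Z s x - Z t x) / (s - t) - G t x|.
have mD : measurable_fun [set: R] D.
  apply: measurableT_comp => //; apply: measurable_funB; last exact: mG.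
  by apply: measurable_funM => //; apply: measurable_funB; exact: mZ.
have fah : (nw w (fun x => a x * H t x)%R < +oo)%E by apply: fin_le => //; exact: faZ.
have fF := le_lt_trans (hN tI) (ltey _).
have bnd := hC _ _ (mH tI') (mF tI) (H0 t) (F0 t) (hN tI) (frH tI') fah.
have fE := nw_enint_fin (mH tI') (mF tI) (H0 t) (F0 t) fF (frH tI') fah.
have mE := measurable_enint (mH tI') (mF tI) (H0 t) (F0 t).
have E0 := enint_ge0 (H0 t) (F0 t).
have hD := hd s st sd.
have D0 x : 0 <= D x by exact: normr_ge0.
have fD : nw w D \is a fin_num by apply: fnum => //; exact: lt_trans hD (ltey _).
have mahH : measurable_fun [set: R] (fun x => a x * H t x) by apply: measurable_rateM; exact: mH.
have ah0 x : 0 <= a x * H t x by exact: mulr_ge0.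
(* The absorption is kept on the left, so that both sides are sums of nonnegative terms and split
   without subtraction of extended reals. *)
have key : (nw w (fun x => H t x + (t - s) * (a x * H t x))%R <=
    nw w (fun x => H s x + (t - s) * (enint (H t) (F t) x + D x))%R)%E.
  apply: nw_le => //.
  - by apply: measurable_funD; [exact: mH|exact: measurable_funM].
  - by apply: measurable_funD; [exact: mH|apply: measurable_funM => //; exact: measurable_funD].
  - by move=> x; rewrite addr_ge0// mulr_ge0// ltW.
  - move=> x; apply: addr_ge0 => //; apply: mulr_ge0; first exact: ltW.
    by apply: addr_ge0; [exact: E0|exact: D0].
  apply: aeS (gen tI) => x hg.
  have h1 := hf_cvx (Z s x) (Z t x).
  have h2 : sg (Z t x) * (Z t x - Z s x) =
      (t - s) * (sg (Z t x) * ((Z s x - Z t x) / (s - t) - G t x) + sg (Z t x) * G t x).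
    by field; rewrite subr_eq0 lt_eqF//; case/andP: st.
  have h3 : sg (Z t x) * ((Z s x - Z t x) / (s - t) - G t x) <= D x.
    apply: le_trans (ler_norm _) _; rewrite normrM; exact: ler_piMl.
  rewrite h2 in h1.
  have h4 : (t - s) * (sg (Z t x) * ((Z s x - Z t x) / (s - t) - G t x) + sg (Z t x) * G t x) <=
    (t - s) * (D x + (enint (H t) (F t) x - a x * H t x)).
    apply: ler_wpM2l; first exact: ltW.
    by apply: lerD => //; rewrite lerBrDr.
  have {h1 h4} := le_trans h1 h4; rewrite -/(H t x) -/(H s x).
  rewrite !mulrDr mulrN; lra.
have fHt := fnum (H0 t) (fH tI'); have fHs := fnum (H0 s) (fH sI).
have fA := fnum ah0 fah; have fEn := fnum E0 fE.
rewrite nwD// in key; last 3 first.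
- exact: mH.
- exact: measurable_funM.
- by move=> x; rewrite mulr_ge0// ltW.
rewrite nwD// in key; last 3 first.
- exact: mH.
- by apply: measurable_funM => //; exact: measurable_funD.
- move=> x; apply: mulr_ge0; first exact: ltW.
  by apply: addr_ge0; [exact: E0|exact: D0].
rewrite nwZ ?(ltW ts)// in key.
rewrite nwZ ?(ltW ts)// in key; last 2 first.
- exact: measurable_funD.
- by move=> x; apply: addr_ge0; [exact: E0|exact: D0].
rewrite (nwD mw w1 mE mD E0 D0) in key.
have eqf (X : \bar R) : X \is a fin_num -> X = (fine X)%:E by move=> h; rewrite fineK.
rewrite (eqf _ fHt) (eqf _ fHs) (eqf _ fA) (eqf _ fEn) (eqf _ fD) -!(EFinM,EFinD) lee_fin in key.
have hD' : fine (nw w D) <= e by rewrite -lee_fin -(eqf _ fD) ltW.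
rewrite -/(phi t) -/(phi s) in key bnd *.
have i1 : (t - s) * (fine (nw w (enint (H t) (F t))) + fine (nw w D)) <=
  (t - s) * (fine (nw w (fun x => a x * H t x)%R) + C * phi t + e).
  by apply: ler_wpM2l; [exact: ltW|exact: lerD].
move: (le_trans key (lerD (lexx (phi s)) i1)); rewrite !mulrDr; lra.
Qed.

(** One statement for both purposes: hf is a convex, 1-Lipschitz function with subgradient sg,
    namely the negative part for positivity and the absolute value for uniqueness. *)
Theorem energy_vanish (t : R) : 0 <= t <= t1 -> {ae mu, forall x, hf (Z t x) = 0}.
Proof.
move=> tI; have [C C0 hC] := energy_bound N.
have p0 : phi 0 = 0.
  rewrite /phi /nw (ae_eq_integral (fun=> 0%E))//=; first by rewrite integral0.
  - have m0 : 0 <= (0:R) <= t1 by rewrite lexx ltW.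
    by apply/measurable_EFinP; apply: measurable_funM => //; exact: mH.
  - by apply: aeS Z0 => x hx _; rewrite /H hx mul0r.
have pge r : 0 <= r <= t1 -> 0 <= phi r by move=> _; rewrite /phi fine_ge0// nw_ge0.
have ph := gronwall_left t10 C0 pge p0 phi_cont (phi_diff C0 hC) tI.
have nz : nw w (H t) = 0%E by rewrite -(fineK (fnum (H0 t) (fH tI))) -/(phi t) ph.
have mHw : measurable_fun [set: R] (fun x => (H t x * w x)%:E).
  by apply/measurable_EFinP; apply: measurable_funM => //; exact: mH.
have := (ae_eq_integral_abs mu measurableT mHw).1.
have -> : (\int[mu]_x `|(H t x * w x)%:E| = 0)%E.
  by rewrite -nz /nw; apply: eq_integral => x _; rewrite gee0_abs// lee_fin mulr_ge0.
move=> /(_ erefl); apply: aeS => x /(_ I)[] /eqP.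
rewrite mulf_eq0 => /orP[/eqP//|/eqP wx]; have := w1 x; rewrite wx ler10//.
Qed.

End vanishing.

Definition rkint (v : R -> R) (x : R) : R := \int[mu]_y rk v x y.

Lemma measurable_fragint (v : R -> R) : measurable_fun [set: R] v ->
  measurable_fun [set: R * R] (fun p => b (p.1, p.2) * (a p.2 * v p.2)).
Proof.
move=> mv; apply: measurable_funM; first by under eq_fun do rewrite -surjective_pairing.
 apply: measurable_funM; exact: measurableT_comp.
Qed.

Lemma measurable_gainint (v : R -> R) : measurable_fun [set: R] v ->
  measurable_fun [set: R * R] (fun p => k (p.1 - p.2, p.2) * (v (p.1 - p.2) * v p.2)).
Proof.
move=> mv; apply: measurable_funM; last exact: measurable_conv2.
apply: measurableT_comp => //; apply/measurable_fun_pairP; split; last exact: measurable_snd.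
exact: measurable_funB.
Qed.

Lemma measurable_lossint (v : R -> R) : measurable_fun [set: R] v ->
  measurable_fun [set: R * R] (fun p => k (p.1, p.2) * (v p.1 * v p.2)).
Proof.
move=> mv; apply: measurable_funM; first by under eq_fun do rewrite -surjective_pairing.
exact: measurable_prod2.
Qed.

Lemma measurable_rk (v : R -> R) : measurable_fun [set: R] v ->
  measurable_fun [set: R * R] (fun p => rk v p.1 p.2).
Proof.
move=> mv; apply: measurable_funB.
  apply: measurable_funD; first exact: measurable_fragint.
  apply: measurable_funM => //; exact: measurable_gainint.
exact: measurable_lossint.
Qed.

Lemma integrable_EFinZ (c : R) (phi : R -> R) : mu.-integrable [set: R] (fun y => (phi y)%:E) ->
  mu.-integrable [set: R] (fun y => (c * phi y)%:E).
Proof. exact: (integrableZl measurableT c). Qed.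

Section state.
Variable v : R -> R.
Hypothesis mv : measurable_fun [set: R] v.
Hypothesis fv : (nw w (fun x => rho x * `|v x|)%R < +oo)%E.
Hypothesis fav : (nw w (fun x => a x * `|v x|)%R < +oo)%E.

Let V x := `|v x|.
Let mV : measurable_fun [set: R] V. Proof. exact: measurableT_comp. Qed.
Let V0 x : 0 <= V x. Proof. exact: normr_ge0. Qed.
Let aeV := ae_endom_fin mV mV V0 V0 fv fv fav.

Let dom_integrable (phi : R * R -> R) (x : R) : measurable_fun [set: R * R] phi ->
  (forall y, `|phi (x, y)| <= endom V V (x, y)) ->
  mu.-integrable [set: R] (fun y => (endom V V (x, y))%:E) ->
  mu.-integrable [set: R] (fun y => (phi (x, y))%:E).
Proof.
move=> mphi hphi; apply: le_integrable => //.
  by apply/measurable_EFinP; exact: (measurable_section1 x mphi).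
by move=> y _ /=; rewrite lee_fin; apply: le_trans (hphi y) (ler_norm _).
Qed.

Lemma state_integrable : {ae mu, forall x,
  [/\ mu.-integrable [set: R] (fun y => (b (x, y) * (a y * v y))%:E),
      mu.-integrable [set: R] (fun y => (k (x - y, y) * (v (x - y) * v y))%:E) &
      mu.-integrable [set: R] (fun y => (k (x, y) * (v x * v y))%:E)]}.
Proof.
apply: aeS aeV => x hx; split.
- apply: (@dom_integrable _ x (measurable_fragint mv)) => // y.
  by case: (rk_le v x y).
- apply: (@dom_integrable _ x (measurable_gainint mv)) => // y.
  by case: (rk_le v x y).
- apply: (@dom_integrable _ x (measurable_lossint mv)) => // y.
  by case: (rk_le v x y).
Qed.

Let nw_int (phi : R * R -> R) : measurable_fun [set: R * R] phi ->
  (forall x y, `|phi (x, y)| <= endom V V (x, y)) ->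
  (nw w (fun x => `|\int[mu]_y phi (x, y)|)%R < +oo)%E.
Proof.
move=> mphi hphi; apply: le_lt_trans (nw_enint_fin mV mV V0 V0 fv fv fav).
have mI : measurable_fun [set: R] (fun x => \int[mu]_y phi (x, y)).
  exact: measurable_Rintegral_param.
apply: nw_le => //.
- exact: measurableT_comp.
- exact: (measurable_enint mV mV V0 V0).
- exact: (enint_ge0 V0 V0).
apply: aeS aeV => x hx; rewrite -[leLHS]mul1r.
apply: (@norm_Rintegral_le _ _ _ (fun y => endom V V (x, y))) => //.
- exact: (measurable_section1 x mphi).
- exact: (measurable_section1 x (measurable_endom mV mV)).
- by move=> y _; rewrite mul1r.
- by rewrite /enint fineK//; exact: integrable_fin_num hx.
Qed.

Lemma nw_gain_fin : (nw w (fun x => `|\int[mu]_y (k (x - y, y) * (v (x - y) * v y))|)%R < +oo)%E.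
Proof.
by apply: (nw_int (measurable_gainint mv)) => x y; case: (rk_le v x y).
Qed.

Lemma nw_loss_fin : (nw w (fun x => `|\int[mu]_y (k (x, y) * (v x * v y))|)%R < +oo)%E.
Proof.
by apply: (nw_int (measurable_lossint mv)) => x y; case: (rk_le v x y).
Qed.

Lemma rk_integrable : {ae mu, forall x, mu.-integrable [set: R] (fun y => (rk v x y)%:E)}.
Proof.
apply: aeS state_integrable => x [h1 h2 h3].
have h := integrableD measurableT h1 (integrable_EFinZ 2^-1 h2).
exact: (integrableB measurableT h h3).
Qed.

Lemma rkintE : {ae mu, forall x, rkint v x = \int[mu]_y (b (x, y) * (a y * v y)) +
  2^-1 * \int[mu]_y (k (x - y, y) * (v (x - y) * v y)) - \int[mu]_y (k (x, y) * (v x * v y))}.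
Proof.
apply: aeS state_integrable => x [h1 h2 h3].
have h2' : mu.-integrable [set: R] (fun y => (2^-1 * (k (x - y, y) * (v (x - y) * v y)))%:E).
  exact: integrable_EFinZ.
have h := integrableD measurableT h1 h2'.
rewrite /rkint /rk RintegralB//.
by rewrite RintegralD// RintegralZl.
Qed.

(** Where v < 0 the absorption cancels exactly against [a * negp v], leaving - rkint, to which
    [rk_negp_le] applies under the integral; elsewhere the left side is 0. *)
Lemma negp_generator : {ae mu, forall x,
  (if v x < 0 then -1 else 0) * (- (a x * v x) + rkint v x) + a x * negp (v x) <=
    enint (fun x => negp (v x)) V x}.
Proof.
have n0 x : 0 <= negp (v x) by rewrite /negp le_max lexx orbT.
have mn : measurable_fun [set: R] (fun x => negp (v x)).
  by apply: measurable_maxr => //; exact: measurableT_comp.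
have nle x : negp (v x) <= V x by rewrite /V /negp ge_max normr_ge0 andbT -[`|v x|]normrN ler_norm.
have fin (c : R -> R) : measurable_fun [set: R] c -> (forall x, 0 <= c x) ->
    (nw w (fun x => c x * V x)%R < +oo)%E -> (nw w (fun x => c x * negp (v x))%R < +oo)%E.
  move=> mc c0; apply: le_lt_trans; apply: nw_le => //.
  - exact: measurable_funM.
  - exact: measurable_funM.
  - by move=> x; exact: mulr_ge0.
  - by move=> x; exact: mulr_ge0.
  - by apply: aeW => x; exact: ler_wpM2l.
have aeE := ae_endom_fin mn mV n0 V0 fv (fin _ mrho rho0 fv) (fin _ ma a0 fav).
apply: aeS (aeI aeE rk_integrable) => x [iE ir].
case: ifPn => vx; last first.
  rewrite mul0r add0r (_ : negp _ = 0); last by rewrite /negp maxEle oppr_le0 leNgt vx.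
  by rewrite mulr0; exact: enint_ge0.
have -> : negp (v x) = - v x by rewrite /negp maxEle leNgt oppr_gt0 vx.
have -> : -1 * (- (a x * v x) + rkint v x) + a x * - v x = - rkint v x by ring.
rewrite /rkint -mulN1r -RintegralZl//.
apply: le_Rintegral => //.
  exact: integrable_EFinZ.
by move=> y _; have := rk_negp_le v x y; rewrite vx mulN1r.
Qed.

End state.

Section difference.
Variables u v : R -> R.
Hypothesis mu_u : measurable_fun [set: R] u.
Hypothesis mv : measurable_fun [set: R] v.
Hypothesis fu : (nw w (fun x => rho x * `|u x|)%R < +oo)%E.
Hypothesis fau : (nw w (fun x => a x * `|u x|)%R < +oo)%E.
Hypothesis fv : (nw w (fun x => rho x * `|v x|)%R < +oo)%E.
Hypothesis fav : (nw w (fun x => a x * `|v x|)%R < +oo)%E.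

Lemma nw_normD (c : R -> R) : measurable_fun [set: R] c -> (forall x, 0 <= c x) ->
  nw w (fun x => c x * (`|u x| + `|v x|)) = (nw w (fun x => c x * `|u x|)%R + nw w (fun x => c x * `|v x|)%R)%E.
Proof.
move=> mc c0; under eq_fun do rewrite mulrDr; rewrite nwD//.
- by apply: measurable_funM => //; exact: measurableT_comp.
- by apply: measurable_funM => //; exact: measurableT_comp.
- by move=> x; exact: mulr_ge0.
- by move=> x; exact: mulr_ge0.
Qed.

Lemma nw_normB_le (c : R -> R) : measurable_fun [set: R] c -> (forall x, 0 <= c x) ->
  (nw w (fun x => c x * `|u x - v x|)%R <=
    nw w (fun x => c x * `|u x|)%R + nw w (fun x => c x * `|v x|)%R)%E.
Proof.
move=> mc c0; rewrite -nw_normD//; apply: nw_le => //.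
- by apply: measurable_funM => //; apply: measurableT_comp => //; exact: measurable_funB.
- by apply: measurable_funM => //; apply: measurable_funD; exact: measurableT_comp.
- by move=> x; exact: mulr_ge0.
- by move=> x; rewrite mulr_ge0// addr_ge0.
- by apply: aeW => x; apply: ler_wpM2l => //; exact: ler_normB.
Qed.

(** Since sg z times z is |z|, the absorption cancels and only the difference of the two gain-loss
    integrals remains. *)
Lemma diff_generator : {ae mu, forall x,
  Num.sg (u x - v x) * ((- (a x * u x) + rkint u x) - (- (a x * v x) + rkint v x)) +
    a x * `|u x - v x| <= enint (fun x => `|u x - v x|) (fun x => `|u x| + `|v x|) x}.
Proof.
have mZ : measurable_fun [set: R] (fun x => `|u x - v x|).
  by apply: measurableT_comp => //; exact: measurable_funB.
have mF : measurable_fun [set: R] (fun x => `|u x| + `|v x|).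
  by apply: measurable_funD; exact: measurableT_comp.
have Z0 x : 0 <= `|u x - v x| by [].
have F0 x : 0 <= `|u x| + `|v x| by exact: addr_ge0.
have fF : (nw w (fun x => rho x * (`|u x| + `|v x|))%R < +oo)%E.
  by rewrite nw_normD//; exact: lte_add_pinfty.
have fZ : (nw w (fun x => rho x * `|u x - v x|)%R < +oo)%E.
  by apply: le_lt_trans (nw_normB_le mrho rho0) _; exact: lte_add_pinfty.
have faZ : (nw w (fun x => a x * `|u x - v x|)%R < +oo)%E.
  by apply: le_lt_trans (nw_normB_le ma a0) _; exact: lte_add_pinfty.
have aeE := ae_endom_fin mZ mF Z0 F0 fF fZ faZ.
apply: aeS (aeI aeE (aeI (rk_integrable mu_u fu fau) (rk_integrable mv fv fav))) => x [iE [iu iv]].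
have sgZ : Num.sg (u x - v x) * (u x - v x) = `|u x - v x| by rewrite normrEsg.
have -> : Num.sg (u x - v x) * ((- (a x * u x) + rkint u x) - (- (a x * v x) + rkint v x)) +
    a x * `|u x - v x| = Num.sg (u x - v x) * (rkint u x - rkint v x).
  by rewrite -sgZ; ring.
apply: le_trans (ler_norm _) _; rewrite normrM; apply: (@le_trans _ _ `|rkint u x - rkint v x|).
  by apply: ler_piMl => //; rewrite normr_sg; case: eqP => //= _; rewrite ?lexx ?ler01.
rewrite /rkint -RintegralB// -[leLHS]mul1r.
apply: (@norm_Rintegral_le _ _ _ (fun y => endom (fun x => `|u x - v x|) (fun x => `|u x| + `|v x|) (x, y))) => //.
- by apply: measurable_funB; [exact: (measurable_section1 x (measurable_rk mu_u))|exact: (measurable_section1 x (measurable_rk mv))].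
- exact: (measurable_section1 x (measurable_endom mZ mF)).
- by move=> y _; rewrite mul1r; exact: rk_diff_le.
- by rewrite /enint fineK//; exact: integrable_fin_num iE.
Qed.

End difference.

(** The equation on the whole line with V as time derivative of U, in the form on which the energy
    method operates. The further regularity of the constructed solution is stated next to it in
    [csol_exists]. *)
Definition csol (tau : R) (f : R -> R) (U V : R -> R -> R) : Prop :=
  [/\ forall t : R, 0 <= t < tau ->
        measurable_fun [set: R] (U t) /\ (nw w (fun x => rho x * `|U t x|)%R < +oo)%E,
      forall t : R, 0 <= t < tau -> forall e : R, 0 < e -> exists2 d : R, 0 < d &
        forall s : R, 0 <= s < tau -> `|s - t| < d ->
          (nw w (fun x => rho x * `|U s x - U t x|)%R < e%:E)%E,
      forall t : R, 0 < t < tau ->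
        [/\ measurable_fun [set: R] (V t), (nw w (fun x => a x * `|U t x|)%R < +oo)%E &
         forall e : R, 0 < e -> exists2 d : R, 0 < d &
          forall s : R, 0 < s < tau -> s != t -> `|s - t| < d ->
            (nw w (fun x => rho x * `|(U s x - U t x) / (s - t) - V t x|)%R < e%:E)%E],
      forall t : R, 0 < t < tau -> {ae mu, forall x, V t x = - (a x * U t x) + rkint (U t) x} &
      {ae mu, forall x, U 0 x = f x}].

Lemma nw_le_rho (h : R -> R) : measurable_fun [set: R] h -> (forall x, 0 <= h x) ->
  (nw w h <= nw w (fun x => rho x * h x)%R)%E.
Proof.
move=> mh h0; apply: nw_le => //; first exact: measurable_rhoM.
  by move=> x; exact: mulr_ge0.
by apply: aeW => x; exact: ler_peMl.
Qed.

Section solution.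
Variables (tau : R) (f : R -> R) (U V : R -> R -> R).
Hypothesis hU : csol tau f U V.

(** A continuous norm is bounded on a compact interval; this supplies the N of [energy_bound]. *)
Lemma csol_bounded (t1 : R) : 0 < t1 < tau -> exists N : R, forall t : R, 0 <= t <= t1 ->
  (nw w (fun x => rho x * `|U t x|)%R <= N%:E)%E.
Proof.
case: hU => hU1 hU2 _ _ _ /andP[t10 t1tau].
have sub (t : R) : 0 <= t <= t1 -> 0 <= t < tau.
  by move=> /andP[-> h]; exact: le_lt_trans t1tau.
pose phi t := fine (nw w (fun x => rho x * `|U t x|)%R).
have r0 t x : 0 <= rho x * `|U t x| by rewrite mulr_ge0.
have fn (t : R) : 0 <= t <= t1 -> nw w (fun x => rho x * `|U t x|)%R \is a fin_num.
  by move=> /sub/hU1[_ h]; rewrite ge0_fin_numE// nw_ge0.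
have half (e r r' : R) : 0 <= r <= t1 -> 0 <= r' <= t1 ->
    (nw w (fun x => rho x * `|U r x - U r' x|)%R < e%:E)%E -> phi r < phi r' + e.
  move=> rI r'I hr; rewrite -lte_fin EFinD /phi !fineK; try exact: fn.
  have [mr _] := hU1 r (sub r rI); have [mr' _] := hU1 r' (sub r' r'I).
  apply: (@le_lt_trans _ _ (nw w (fun x => rho x * `|U r' x|)%R +
      nw w (fun x => rho x * `|U r x - U r' x|)%R)%E); last first.
    by rewrite lteD2lE// fn.
  have m1 : measurable_fun [set: R] (fun x => rho x * `|U r' x|).
    by apply: measurable_rhoM; exact: measurableT_comp.
  have m2 : measurable_fun [set: R] (fun x => rho x * `|U r x - U r' x|).
    by apply: measurable_rhoM; apply: measurableT_comp => //; exact: measurable_funB.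
  rewrite -nwD//; last by move=> x; rewrite mulr_ge0.
  apply: nw_le => //; [|exact: measurable_funD| |].
  - by apply: measurable_rhoM; exact: measurableT_comp.
  - by move=> x; rewrite addr_ge0// mulr_ge0.
  apply: aeW => x; rewrite -mulrDr; apply: ler_wpM2l => //.
  by rewrite -{1}[U r x](subrK (U r' x)) addrC; apply: le_trans (ler_normD _ _) _.
have cphi : {within `[0, t1], continuous phi}.
  apply: within_continuous_dist => t tI e e0.
  have [d d0 hd] := hU2 t (sub t tI) e e0; exists d => // s sI st.
  have h1 := half e s t sI tI (hd s (sub s sI) st).
  have h2 : phi t < phi s + e.
    apply: half => //; have := hd s (sub s sI) st.
    by rewrite /nw; under [in X in X -> _]eq_integral do rewrite distrC.
  by rewrite ltr_norml; apply/andP; split; lra.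
have [c _ hc] := EVT_max (ltW t10) cphi.
exists (phi c) => t tI; rewrite -(fineK (fn t tI)) lee_fin.
by apply: hc; rewrite in_itv.
Qed.

Lemma csol_positive : {ae mu, forall x, 0 <= f x} ->
  forall t : R, 0 <= t < tau -> {ae mu, forall x, 0 <= U t x}.
Proof.
move=> f0 t /andP[t0 ttau].
(* A compact interval that contains t and ends before tau. *)
pose t1 := (t + tau) / 2.
have t1I : 0 < t1 < tau by apply/andP; split; rewrite /t1; lra.
have [N hN] := csol_bounded t1I.
have [t10 t1tau] := andP t1I.
case: hU => hU1 hU2 hU3 hU4 hU5.
have sub (s : R) : 0 <= s <= t1 -> 0 <= s < tau by move=> /andP[-> h]; exact: le_lt_trans t1tau.
have sub' (s : R) : 0 < s <= t1 -> 0 < s < tau by move=> /andP[-> h]; exact: le_lt_trans t1tau.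
have subw (s : R) : 0 < s <= t1 -> 0 <= s <= t1 by move=> /andP[/ltW-> ->].
have m2 (s r : R) : 0 <= s <= t1 -> 0 <= r <= t1 -> measurable_fun [set: R] (fun x => `|U s x - U r x|).
  by move=> /sub/hU1[ms _] /sub/hU1[mr _]; apply: measurableT_comp => //; exact: measurable_funB.
have tI : 0 <= t <= t1 by apply/andP; split=> //; rewrite /t1; lra.
have : {ae mu, forall x, negp (U t x) = 0}.
  (* The subgradient of the negative part is -1 at negative values and 0 elsewhere, and the second
     density is |U| itself. *)
  apply: (@energy_vanish negp (fun z => if z < 0 then -1 else 0) t1 N U V (fun s x => `|U s x|)) => //.
  - by apply: measurable_maxr => //; exact: measurableT_comp.
  - by move=> z; rewrite /negp le_max lexx orbT.
  - by move=> z; rewrite /negp ge_max normr_ge0 andbT -[`|z|]normrN ler_norm.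
  - move=> z z'; rewrite /negp lerBlDr ge_max.
    have h1 := ler_norm (z' - z); rewrite distrC in h1.
    have h2 : - z' <= Num.max (- z') 0 by rewrite le_max lexx.
    have h3 : 0 <= Num.max (- z') 0 by rewrite le_max lexx orbT.
    by apply/andP; split; [lra|rewrite addr_ge0].
  - move=> z z'; have h2 : - z <= negp z by rewrite /negp le_max lexx.
    have h3 : 0 <= negp z by rewrite /negp le_max lexx orbT.
    case: ifPn => hz'; last first.
      by rewrite (_ : negp z' = 0) ?mul0r ?sub0r ?oppr_le0// /negp maxEle oppr_le0 leNgt hz'.
    have -> : negp z' = - z' by rewrite /negp maxEle leNgt oppr_gt0 hz'.
    lra.
  - by move=> z; case: ifP => _; rewrite ?normr0 ?ler01// normrN normr1.
  - by move=> s /sub/hU1[].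
  - by move=> s /sub'/hU3[].
  - by move=> s /subw/sub/hU1[ms _]; exact: measurableT_comp.
  - by move=> s /sub/hU1[].
  - by move=> s /sub'/hU3[].
  - by move=> s /subw; exact: hN.
  - move=> s sI e e0; have [d d0 hd] := hU2 s (sub s sI) e e0; exists d => // r rI rs.
    by apply: le_lt_trans (hd r (sub r rI) rs); apply: nw_le_rho => //; exact: m2.
  - move=> s sI e e0; have [mV _ hd'] := hU3 s (sub' s sI); have [d d0 hd] := hd' e e0.
    exists d => // r /andP[r0 rs] srd.
    have rI : 0 < r < tau.
      by rewrite r0/=; case/andP: (sub' s sI) => _; exact: lt_trans.
    apply: le_lt_trans (hd r rI _ _); last 2 first.
    + by rewrite lt_eqF.
    + by rewrite distrC gtr0_norm// subr_gt0.
    apply: nw_le_rho => //; apply: measurableT_comp => //; apply: measurable_funB => //.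
    apply: measurable_funM => //.
    have rI' : 0 <= r <= t1 by rewrite (ltW r0)/= (le_trans (ltW rs)); case/andP: sI.
    have [mr _] := hU1 r (sub r rI').
    by have [ms _] := hU1 s (sub s (subw s sI)); exact: measurable_funB.
  - move=> s sI; have [ms fs] := hU1 s (sub s (subw s sI)).
    have [_ fas _] := hU3 s (sub' s sI).
    by apply: aeS (aeI (hU4 s (sub' s sI)) (negp_generator ms fs fas)) => x [->].
  - by apply: aeS (aeI f0 hU5) => x [fx ->]; rewrite /negp maxEle oppr_le0 fx.
apply: aeS => x; rewrite /negp => h; rewrite -oppr_le0 -h.
by rewrite le_max lexx.
Qed.

End solution.

Lemma csol_unique (tau : R) (f : R -> R) (U V U' V' : R -> R -> R) :
  csol tau f U V -> csol tau f U' V' ->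
  forall t : R, 0 <= t < tau -> {ae mu, forall x, U' t x = U t x}.
Proof.
move=> hU hU' t /andP[t0 ttau].
pose t1 := (t + tau) / 2.
have t1I : 0 < t1 < tau by apply/andP; split; rewrite /t1; lra.
have [N hN] := csol_bounded hU t1I; have [N' hN'] := csol_bounded hU' t1I.
have [t10 t1tau] := andP t1I.
case: hU => hU1 hU2 hU3 hU4 hU5; case: hU' => hU1' hU2' hU3' hU4' hU5'.
have sub (s : R) : 0 <= s <= t1 -> 0 <= s < tau by move=> /andP[-> h]; exact: le_lt_trans t1tau.
have sub' (s : R) : 0 < s <= t1 -> 0 < s < tau by move=> /andP[-> h]; exact: le_lt_trans t1tau.
have subw (s : R) : 0 < s <= t1 -> 0 <= s <= t1 by move=> /andP[/ltW-> ->].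
have tI : 0 <= t <= t1 by apply/andP; split=> //; rewrite /t1; lra.
have mU (s : R) : 0 <= s <= t1 -> measurable_fun [set: R] (U s) by move=> /sub/hU1[].
have mU' (s : R) : 0 <= s <= t1 -> measurable_fun [set: R] (U' s) by move=> /sub/hU1'[].
have mB (g h : R -> R) : measurable_fun [set: R] g -> measurable_fun [set: R] h ->
    measurable_fun [set: R] (fun x => `|g x - h x|).
  by move=> mg mh; apply: measurableT_comp => //; exact: measurable_funB.
have key (p p' P : R -> R) (e : R) : (forall x, P x = p x - p' x) -> measurable_fun [set: R] p -> measurable_fun [set: R] p' ->
    (nw w (fun x => rho x * `|p x|)%R < (e / 2)%:E)%E ->
    (nw w (fun x => rho x * `|p' x|)%R < (e / 2)%:E)%E ->
    (nw w (fun x => `|P x|)%R < e%:E)%E.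
  move=> hP mp mp' h1 h2; under eq_fun do rewrite hP.
  apply: le_lt_trans (nw_le_rho _ _) _ => //; first exact: mB.
  apply: le_lt_trans (nw_normB_le mp mp' mrho rho0) _.
  by rewrite [in ltRHS](splitr e) EFinD; apply: lte_leD => //; rewrite ?ltW//;
    rewrite ge0_fin_numE ?nw_ge0//; [exact: lt_trans h2 (ltey _)|move=> x; exact: mulr_ge0].
suff : {ae mu, forall x, `|U t x - U' t x| = 0}.
  by apply: aeS => x /normr0_eq0/subr0_eq ->.
(* The quadratic terms are linear in U - U' with coefficient |U| + |U'|, whose norm is bounded by N
   + N'. *)
apply: (@energy_vanish (fun z => `|z|) Num.sg t1 (N + N') (fun s x => U s x - U' s x)
  (fun s x => V s x - V' s x) (fun s x => `|U s x| + `|U' s x|)) => //.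
- by move=> z z'; exact: lerB_dist.
- move=> z z'; rewrite mulrBr (_ : Num.sg z' * z' = `|z'|); last by rewrite normrEsg.
  apply: lerB => //; apply: le_trans (ler_norm _) _; rewrite normrM; apply: ler_piMl => //.
  by rewrite normr_sg; case: eqP => //= _; rewrite ?lexx ?ler01.
- by move=> z; rewrite normr_sg; case: eqP => //= _; rewrite ?lexx ?ler01.
- by move=> s sI; apply: measurable_funB; [exact: mU|exact: mU'].
- by move=> s sI; apply: measurable_funB; [case: (hU3 s (sub' s sI))|case: (hU3' s (sub' s sI))].
- by move=> s /subw sI; apply: measurable_funD; apply: measurableT_comp => //; [exact: mU|exact: mU'].
- move=> s sI; apply: le_lt_trans (nw_normB_le (mU s sI) (mU' s sI) mrho rho0) _.
  by apply: lte_add_pinfty; [case: (hU1 s (sub s sI))|case: (hU1' s (sub s sI))].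
- move=> s sI; have sI' := subw s sI.
  apply: le_lt_trans (nw_normB_le (mU s sI') (mU' s sI') ma a0) _.
  by apply: lte_add_pinfty; [case: (hU3 s (sub' s sI))|case: (hU3' s (sub' s sI))].
- move=> s /subw sI; rewrite (nw_normD (mU s sI) (mU' s sI) mrho rho0) EFinD.
  by apply: leeD; [exact: hN|exact: hN'].
- move=> s sI e e0; have e2 : 0 < e / 2 by rewrite divr_gt0.
  have [d d0 hd] := hU2 s (sub s sI) _ e2; have [d' d0' hd'] := hU2' s (sub s sI) _ e2.
  exists (Num.min d d'); first by rewrite lt_min d0.
  move=> r rI; rewrite lt_min => /andP[rd rd'].
  apply: (key (fun x => U r x - U s x) (fun x => U' r x - U' s x)).
  + by move=> x; ring.
  + exact: measurable_funB (mU r rI) (mU s sI).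
  + exact: measurable_funB (mU' r rI) (mU' s sI).
  + exact: hd (sub r rI) rd.
  + exact: hd' (sub r rI) rd'.
- move=> s sI e e0; have e2 : 0 < e / 2 by rewrite divr_gt0.
  have [mV _ h] := hU3 s (sub' s sI); have [mV' _ h'] := hU3' s (sub' s sI).
  have [d d0 hd] := h _ e2; have [d' d0' hd'] := h' _ e2.
  exists (Num.min d d'); first by rewrite lt_min d0.
  move=> r /andP[r0 rs]; rewrite lt_min => /andP[rd rd'].
  have rI : 0 < r < tau by rewrite r0/=; case/andP: (sub' s sI) => _; exact: lt_trans.
  have rI' : 0 <= r <= t1 by rewrite (ltW r0)/= (le_trans (ltW rs)); case/andP: sI.
  have sI' := subw s sI.
  have ne : r != s by rewrite lt_eqF.
  have ab : `|r - s| = s - r by rewrite distrC gtr0_norm// subr_gt0.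
  apply: (key (fun x => (U r x - U s x) / (r - s) - V s x) (fun x => (U' r x - U' s x) / (r - s) - V' s x)).
  + by move=> x; ring.
  + apply: measurable_funB => //; apply: measurable_funM => //; exact: measurable_funB (mU r rI') (mU s sI').
  + apply: measurable_funB => //; apply: measurable_funM => //; exact: measurable_funB (mU' r rI') (mU' s sI').
  + by apply: hd => //; rewrite ab.
  + by apply: hd' => //; rewrite ab.
- move=> s sI; have sI' := subw s sI.
  have [_ fs] := hU1 s (sub s sI'); have [_ fs'] := hU1' s (sub s sI').
  have [_ fas _] := hU3 s (sub' s sI); have [_ fas' _] := hU3' s (sub' s sI).
  have dg := diff_generator (mU s sI') (mU' s sI') fs fas fs' fas'.
  by apply: aeS (aeI dg (aeI (hU4 s (sub' s sI)) (hU4' s (sub' s sI)))) => x [h [-> ->]].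
- by apply: aeS (aeI hU5 hU5') => x [-> ->]; rewrite subrr normr0.
Qed.

End fixed_time.

(** * Fragmentation moments *)

Section parameters.
Context {R : realType}.

(** The order of choice matters: z is fixed by the gap 1 - q, then kap is taken near 1 so that its
    negative powers fit below 1 + z, and finally eps is made small compared with 1 - kap. *)
Lemma contraction_parameters (q : R) : 0 <= q -> q < 1 -> exists z kap eps : R,
  [/\ 0 < z <= 1, 0 < kap < 1, 0 < eps <= 2^-1, q * (1 + z) <= (1 + q) / 2 &
    eps / (1 - kap) + kap^-1 <= 1 + z /\ 3 * eps / ((1 - kap) * kap) + kap ^- 2 <= 1 + z].
Proof.
move=> q0 q1; pose z := (1 - q) / 2.
have z0 : 0 < z by rewrite divr_gt0// subr_gt0.
have z1 : z <= 2^-1 by rewrite /z; lra.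
have d0 : 0 < 1 + z / 8 by lra.
(* Now kap^-1 = 1 + z / 8 and 1 - kap = z / (8 + z), so eps / (1 - kap) = z (8 + z) / 100. *)
exists z, (1 + z / 8)^-1, (z ^+ 2 / 100).
have kE : 1 - (1 + z / 8)^-1 = z / (8 + z) by field; rewrite !gt_eqF//; lra.
have k0 : 0 < (1 + z / 8)^-1 by rewrite invr_gt0.
have k1 : (1 + z / 8)^-1 < 1 by rewrite invf_lt1//; lra.
split.
- by rewrite z0; lra.
- by rewrite k0.
- by apply/andP; split; nra.
- by rewrite /z; nra.
rewrite kE invrK; split.
- have -> : z ^+ 2 / 100 / (z / (8 + z)) = z * (8 + z) / 100.
    by field; rewrite !gt_eqF//; lra.
  nra.
- have -> : 3 * (z ^+ 2 / 100) / (z / (8 + z) / (1 + z / 8)) = 3 * z * (8 + z) * (1 + z / 8) / 100.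
    by field; rewrite !gt_eqF//; lra.
  rewrite exprVn invrK; nra.
Qed.

Lemma small_time (al r C : R) : 0 < al < 1 -> 0 < r -> 0 <= C ->
  exists2 T : R, 0 < T <= 1 & C * T `^ (1 - al) <= r.
Proof.
move=> /andP[al0 al1] r0 C0; have al' : 0 < 1 - al by rewrite subr_gt0.
have C1 : 0 < C + 1 by rewrite addrC ltr_pwDl.
exists (Num.min 1 ((r / (C + 1)) `^ (1 - al)^-1)).
  by rewrite lt_min ltr01 powR_gt0 ?divr_gt0//= ge_min lexx.
apply: (@le_trans _ _ (C * (r / (C + 1)))).
  apply: ler_wpM2l => //.
  apply: (@le_trans _ _ (((r / (C + 1)) `^ (1 - al)^-1) `^ (1 - al))).
    apply: ge0_ler_powR; rewrite ?nnegrE ?powR_ge0 ?(ltW al')//.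
      by rewrite le_min ler01 powR_ge0.
    by rewrite ge_min lexx orbT.
  by rewrite -powRrM mulVf ?gt_eqF// powRr1// divr_ge0// ltW.
by rewrite mulrCA ler_piMr ?(ltW r0)// ler_pdivrMr// mul1r lerDl.
Qed.

(* For [m < m0] this is Young's inequality for [s `^ (1 - lam) * (s `^ m0) `^ lam = s `^ m], with
   [s = x / y]. *)
Lemma powR_interpolate (m m0 : R) : 1 < m -> 1 < m0 -> exists2 lam : R, 0 < lam <= 1 &
  forall x y : R, 0 <= x -> x <= y -> 0 < y ->
    x `^ m <= (1 - lam) * (x * y `^ (m - 1)) + lam * (x `^ m0 * y `^ (m - m0)).
Proof.
move=> m1 m01; have mp : 0 < m by exact: lt_trans m1.
have m0p : 0 < m0 by exact: lt_trans m01.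
have scale (lam : R) : (forall s : R, 0 <= s <= 1 -> s `^ m <= (1 - lam) * s + lam * s `^ m0) ->
    forall x y : R, 0 <= x -> x <= y -> 0 < y ->
    x `^ m <= (1 - lam) * (x * y `^ (m - 1)) + lam * (x `^ m0 * y `^ (m - m0)).
  move=> h x y x0 xy y0; have sy : x = x / y * y by rewrite divfK// gt_eqF.
  have s01 : 0 <= x / y <= 1 by rewrite divr_ge0 ?(ltW y0)//= ler_pdivrMr// mul1r.
  have s0 : 0 <= x / y by case/andP: s01.
  have yN : y != 0 by rewrite gt_eqF.
  have e1 : x * y `^ (m - 1) = x / y * y `^ m.
    by rewrite powRB ?yN ?implybT// powRr1 ?(ltW y0)//; field.
  have e2 : x `^ m0 * y `^ (m - m0) = (x / y) `^ m0 * y `^ m.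
    rewrite powRB ?yN ?implybT// {1}sy powRM ?(ltW y0)//.
    by field; rewrite gt_eqF// powR_gt0.
  rewrite e1 e2 {1}sy powRM ?(ltW y0)// (mulrA (1 - lam)) (mulrA lam) -mulrDl.
  by apply: ler_wpM2r; [exact: powR_ge0|exact: h].
have [mm|mm] := leP m0 m.
  (* For m0 <= m no interpolation is required, as s^m <= s^m0 on [0, 1]. *)
  exists 1; first by rewrite ltr01 lexx.
  apply: scale => s /andP[s0 s1]; rewrite subrr mul0r add0r mul1r.
  move: s0; rewrite le_eqVlt => /predU1P[<-|s0]; first by rewrite !powR0 ?gt_eqF.
  by apply: ger_powR => //; rewrite s0.
(* The solution of m = (1 - lam) 1 + lam m0. *)
pose lam := (m - 1) / (m0 - 1).
have l0 : 0 < lam by rewrite divr_gt0 ?subr_gt0.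
have l1 : lam < 1 by rewrite ltr_pdivrMr ?subr_gt0// mul1r ltrD2r.
have l1' : 0 < 1 - lam by rewrite subr_gt0.
exists lam; first by rewrite l0 ltW.
apply: scale => s /andP[s0 s1].
have E : (1 - lam) + m0 * lam = m by rewrite /lam; field; rewrite gt_eqF// subr_gt0.
have := @conjugate_powR R (s `^ (1 - lam)) (s `^ m0 `^ lam) (1 - lam)^-1 lam^-1.
rewrite !powR_ge0 !invr_gt0 !invrK subrK => /(_ isT isT l1' l0 erefl).
have e1 : (s `^ (1 - lam)) `^ (1 - lam)^-1 = s by rewrite -powRrM mulfV ?(gt_eqF l1')// powRr1.
have e2 : ((s `^ m0) `^ lam) `^ lam^-1 = s `^ m0.
  by rewrite -powRrM mulfV ?(gt_eqF l0)// powRr1// powR_ge0.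
have e3 : s `^ (1 - lam) * (s `^ m0) `^ lam = s `^ m.
  by rewrite -powRrM -powRD ?E// gt_eqF.
by rewrite e1 e2 e3 [_ * (1 - lam)]mulrC [_ * lam]mulrC.
Qed.

End parameters.

(** * Extension by zero to the real line, and the weight *)

Section cut_off.
Context {R : realType}.
Local Notation mu := (@lebesgue_measure R).

Definition cut (h : R -> R) (x : R) : R := if 0 <= x then h x else 0.

Lemma RpE (x : R) : Rp x = (0 <= x) :> Prop.
Proof. by rewrite /Rp /= in_itv/= andbT. Qed.

Lemma measurable_Rp : measurable (@Rp R).
Proof. exact: measurable_itv. Qed.

Lemma measurable_cut (h : R -> R) : measurable_fun Rp h -> measurable_fun [set: R] (cut h).
Proof.
move=> mh; have := (measurable_restrictT h measurable_Rp).1 mh.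
by congr measurable_fun; apply/funext => x; rewrite /patch /cut mem_setE in_itv/= andbT.
Qed.

Lemma cut_ge0 (h : R -> R) : (forall x, Rp x -> 0 <= h x) -> forall x, 0 <= cut h x.
Proof. by move=> h0 x; rewrite /cut; case: ifP => // x0; apply: h0; rewrite RpE. Qed.

Lemma cut_Rp (h : R -> R) x : 0 <= x -> cut h x = h x.
Proof. by rewrite /cut => ->. Qed.

Lemma integral_cut (D : set R) (f g : R -> \bar R) :
  (forall x, D x -> f x = g x) -> (forall x, ~ D x -> g x = 0%E) ->
  (\int[mu]_(x in D) f x = \int[mu]_x g x)%E.
Proof.
move=> h1 h2; rewrite integral_mkcond; apply: eq_integral => x _; rewrite /patch.
by case: ifPn; rewrite ?inE => xD; [exact: h1|rewrite h2//; move: xD; rewrite notin_setE].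
Qed.

Lemma wint_cut (W W' h : R -> R) : (forall x, 0 <= x -> W x = W' x) ->
  (wint W h = \int[mu]_x (`|cut h x| * W' x)%:E)%E.
Proof.
move=> hW; apply: integral_cut => x; rewrite RpE.
  by move=> x0; rewrite cut_Rp// hW.
by move=> /negP x0; rewrite /cut (negbTE x0) normr0 mul0r.
Qed.

(** The absolute value extends the weight to the whole line in such a way that it stays above 1 and
    submultiplicative. *)
Definition powweight (m x : R) : R := 1 + `|x| `^ m.

Lemma measurable_powweight (m : R) : measurable_fun [set: R] (powweight m).
Proof.
apply: measurable_funD => //.
exact: (measurableT_comp (measurable_powR m) (@normr_measurable _ _)).
Qed.

Lemma powweight_ge1 (m x : R) : 1 <= powweight m x.
Proof. by rewrite lerDl powR_ge0. Qed.

(** From |x| + |y| <= 2 max (|x|, |y|). *)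
Lemma powweightD (m x y : R) : 0 <= m ->
  powweight m (x + y) <= 2 `^ m * (powweight m x * powweight m y).
Proof.
move=> m0; rewrite /powweight.
have two : 1 <= 2 `^ m :> R.
  by rewrite -[leLHS](powRr0 2); apply: ler_powR => //; rewrite ler1n.
have le (r s : R) : 0 <= r -> r <= s -> (r + s) `^ m <= 2 `^ m * s `^ m.
  move=> r0 rs; have s0 : 0 <= s by exact: le_trans rs.
  by rewrite -powRM//; apply: ge0_ler_powR; rewrite ?nnegrE ?addr_ge0 ?mulr_ge0//; lra.
have h : (`|x| + `|y|) `^ m <= 2 `^ m * (`|x| `^ m + `|y| `^ m).
  have [xy|xy] := leP `|x| `|y|.
    apply: le_trans (le _ _ _ xy) _ => //; apply: ler_wpM2l; first exact: powR_ge0.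
    by rewrite lerDr powR_ge0.
  rewrite addrC; apply: le_trans (le _ _ _ (ltW xy)) _ => //; apply: ler_wpM2l; first exact: powR_ge0.
  by rewrite lerDl powR_ge0.
have hm : `|x + y| `^ m <= (`|x| + `|y|) `^ m.
  by apply: ge0_ler_powR; rewrite ?nnegrE ?addr_ge0//; exact: ler_normD.
have X0 := powR_ge0 `|x| m; have Y0 := powR_ge0 `|y| m.
move: hm h two X0 Y0; set X := `|x| `^ m; set Y := `|y| `^ m; set t := 2 `^ m.
move=> h1 h2 t1 X0 Y0; have XY : 0 <= t * (X * Y) by rewrite !mulr_ge0// (le_trans _ t1).
apply: (@le_trans _ _ (t * (1 + X + Y))); first by lra.
apply: ler_wpM2l; first exact: le_trans t1.
have : 0 <= X * Y by exact: mulr_ge0.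
lra.
Qed.

End cut_off.

Section fragmentation_weight.
Context {R : realType}.
Local Notation mu := (@lebesgue_measure R).

Definition cut2 (b : R -> R -> R) (p : R * R) : R :=
  if (0 <= p.1) && (0 <= p.2) then b p.1 p.2 else 0.

(** The cut to x < y matches the open interval of integration in [opB], so that the fragmentation
    gain becomes an integral over R. *)
Definition cutfrag (b : R -> R -> R) (p : R * R) : R := if p.1 < p.2 then cut2 b p else 0.

Lemma measurable_cut2 (b : R -> R -> R) :
  measurable_fun (Rp `*` Rp) (fun z : R * R => b z.1 z.2) -> measurable_fun [set: R * R] (cut2 b).
Proof.
move=> hb; have mRR : measurable (@Rp R `*` @Rp R).
  exact: measurableX measurable_Rp measurable_Rp.
have := (measurable_restrictT (fun z : R * R => b z.1 z.2) mRR).1 hb.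
congr measurable_fun; apply/funext => -[x y]; rewrite /patch /cut2 /=.
rewrite (_ : ((x, y) \in _) = (0 <= x) && (0 <= y))//.
by apply/idP/idP; rewrite inE /= !RpE => /andP.
Qed.

Lemma measurable_cutfrag (b : R -> R -> R) :
  measurable_fun (Rp `*` Rp) (fun z : R * R => b z.1 z.2) -> measurable_fun [set: R * R] (cutfrag b).
Proof.
move=> hb; apply: measurable_fun_ifT => //; last exact: measurable_cut2.
by apply: measurable_fun_ltr; [exact: measurable_fst|exact: measurable_snd].
Qed.

Lemma cut2_ge0 (b : R -> R -> R) : (forall x y, Rp x -> Rp y -> 0 <= b x y) ->
  forall p, 0 <= cut2 b p.
Proof.
by move=> b0 p; rewrite /cut2; case: ifP => // /andP[h1 h2]; apply: b0; rewrite RpE.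
Qed.

Lemma cutfrag_ge0 (b : R -> R -> R) : (forall x y, Rp x -> Rp y -> 0 <= b x y) ->
  forall p, 0 <= cutfrag b p.
Proof. by move=> b0 p; rewrite /cutfrag; case: ifP => // _; exact: cut2_ge0. Qed.

Variables (a : R -> R) (b : R -> R -> R) (l b0 m m0 : R).
Hypothesis a_loc : forall T : R, 0 < T -> exists M : R,
  {ae mu, forall x, `[0%R, T]%classic x -> a x <= M}.
Hypothesis mb : measurable_fun (Rp `*` Rp) (fun z : R * R => b z.1 z.2).
Hypothesis b_ge0 : forall x y, Rp x -> Rp y -> 0 <= b x y.
Hypothesis mass : {ae mu, forall y : R, 0 < y ->
  (\int[mu]_(x in `[0%R, y]) (x * b x y)%:E = y%:E)%E}.
Hypothesis l0 : 0 <= l.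
Hypothesis b00 : 0 <= b0.
Hypothesis number : forall x, 0 <= x ->
  (\int[mu]_(y in `[0%R, x]) (b y x)%:E <= (b0 * (1 + x `^ l))%:E)%E.
Hypothesis m01 : 1 < m0.
Hypothesis liminf : (0 < liminf_pinfty (fun y => (Nm b m0 y / y `^ m0)%R))%E.
Hypothesis m1 : 1 < m.
Hypothesis lm : l < m.

(** The lower limit may be infinite; capping c at 1 keeps 1 - lam c nonnegative later on. *)
Lemma liminf_bound : exists c Y : R, 0 < c <= 1 /\ forall y, Y < y -> c <= Nm b m0 y / y `^ m0.
Proof.
have /ereal_sup_gt[_ [Y _ <-] hY] := liminf.
set S := [set _ | _ in _] in hY.
have [c c01 hc] : exists2 c : R, 0 < c <= 1 & (c%:E <= ereal_inf S)%E.
  move: hY; case: (ereal_inf S) => [r|_|//]; last first.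
    by exists 1; rewrite ?ltr01 ?lexx// leey.
  rewrite lte_fin => r0; exists (Num.min r 1); first by rewrite lt_min r0 ltr01 ge_min lexx orbT.
  by rewrite lee_fin ge_min lexx.
exists c, Y; split => // y Yy; rewrite -lee_fin; apply: le_trans hc _.
by apply: ereal_inf_lbound; exists y => //; rewrite /= in_itv/= Yy.
Qed.

Section fixed_size.
Variable y : R.
Hypothesis y0 : 0 < y.
Hypothesis mass_y : (\int[mu]_(x in `[0%R, y]) (x * b x y)%:E = y%:E)%E.

Let B x := cut2 b (x, y).
Let mB : measurable_fun [set: R] B.
Proof. exact: (measurable_section2 y (measurable_cut2 mb)). Qed.
Let B0 x : 0 <= B x. Proof. exact: cut2_ge0. Qed.
Let I (phi : R -> R) : \bar R := (\int[mu]_(x in `[0%R, y]) (B x * phi x)%:E)%E.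

Let BE x : x \in `[0, y] -> B x = b x y.
Proof. by rewrite in_itv/= => /andP[x0 xy]; rewrite /B /cut2 /= x0 (ltW y0). Qed.

Let mD : measurable (`[0%R, y] : set R). Proof. exact: measurable_itv. Qed.

Let mphi (phi : R -> R) : measurable_fun [set: R] phi ->
  measurable_fun (`[0%R, y] : set R) (fun x => (B x * phi x)%:E).
Proof.
move=> h; apply: measurable_funTS; apply/measurable_EFinP; exact: measurable_funM.
Qed.

Let I_le (phi psi : R -> R) : measurable_fun [set: R] phi -> measurable_fun [set: R] psi ->
  (forall x, 0 <= x <= y -> 0 <= phi x <= psi x) -> (I phi <= I psi)%E.
Proof.
move=> h1 h2 h; apply: ge0_le_integral => //; [|exact: mphi|exact: mphi|].
- by move=> x; rewrite /= in_itv/= => /h/andP[p0 _]; rewrite lee_fin mulr_ge0.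
- by move=> x; rewrite /= in_itv/= => /h/andP[_ p]; rewrite lee_fin ler_wpM2l.
Qed.

Let I_lin (c d : R) (phi psi : R -> R) : 0 <= c -> 0 <= d ->
  measurable_fun [set: R] phi -> measurable_fun [set: R] psi ->
  (forall x, 0 <= x -> 0 <= phi x) -> (forall x, 0 <= x -> 0 <= psi x) ->
  (I (fun x => c * phi x + d * psi x)%R = c%:E * I phi + d%:E * I psi)%E.
Proof.
move=> c0 d0 h1 h2 p1 p2.
have pos (phi' : R -> R) : (forall x, 0 <= x -> 0 <= phi' x) ->
    forall x, `[0%R, y]%classic x -> (0 <= (B x * phi' x)%:E)%E.
  by move=> h x; rewrite /= in_itv/= => /andP[x0 _]; rewrite lee_fin mulr_ge0// h.
rewrite /I -!ge0_integralZl//; try exact: mphi; try exact: pos.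
rewrite -ge0_integralD//.
- by apply: eq_integral => x _; rewrite -!EFinM -EFinD; congr EFin; ring.
- by move=> x /(pos _ p1); rewrite !lee_fin => h; rewrite mulr_ge0.
- by apply: measurable_funeM; exact: mphi.
- by move=> x /(pos _ p2); rewrite !lee_fin => h; rewrite mulr_ge0.
- by apply: measurable_funeM; exact: mphi.
Qed.

Let mpow (r : R) : measurable_fun [set: R] (fun x : R => x `^ r). Proof. exact: measurable_powR. Qed.

Let I1 : (I (fun=> 1)%R <= (b0 * (1 + y `^ l))%:E)%E.
Proof.
apply: le_trans (number (ltW y0)); rewrite le_eqVlt; apply/orP; left; apply/eqP.
by apply: eq_integral => x; rewrite inE /= => /BE ->; rewrite mulr1.
Qed.

Let Iid : I id = y%:E.
Proof.
by rewrite -mass_y; apply: eq_integral => x; rewrite inE /= => /BE ->; rewrite mulrC.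
Qed.

(** On [0, y] one has x^m0 <= y^(m0 - 1) x, and mass conservation integrates the right side. *)
Let Ipow0 : (I (fun x => x `^ m0)%R <= (y `^ m0)%:E)%E.
Proof.
(* The summand with coefficient 0 only brings the integrand into the form of [I_lin]. *)
apply: (@le_trans _ _ (I (fun x => y `^ (m0 - 1) * id x + 0 * id x))).
  apply: I_le => //; first by apply: measurable_funD; exact: measurable_funM.
  move=> x /andP[x0 xy]; rewrite powR_ge0/= mul0r addr0.
  move: x0; rewrite le_eqVlt => /predU1P[<-|x0].
    by rewrite powR0 ?mulr0// gt_eqF// (lt_trans _ m01).
  have -> : x `^ m0 = x `^ (m0 - 1) * x.
    by rewrite -{3}(powRr1 (ltW x0)) -powRD ?subrK// gt_eqF// (lt_trans _ m01).
  apply: ler_wpM2r; first exact: ltW.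
  by apply: ge0_ler_powR; rewrite ?nnegrE ?subr_ge0 ?(ltW m01)// ltW.
rewrite I_lin ?powR_ge0// Iid mul0e adde0 -EFinM lee_fin.
by rewrite -{2}(powRr1 (ltW y0)) -powRD ?subrK// gt_eqF// (lt_trans _ m01).
Qed.

(** Integrating the interpolation inequality: the mass term gives (1 - lam) y^m and the moment of
    order m0 gives lam (1 - c) y^m, which add up to (1 - lam c) y^m. *)
Let Ipow (lam c : R) : 0 < lam <= 1 ->
  (forall x y : R, 0 <= x -> x <= y -> 0 < y ->
    x `^ m <= (1 - lam) * (x * y `^ (m - 1)) + lam * (x `^ m0 * y `^ (m - m0))) ->
  (I (fun x => x `^ m0)%R <= ((1 - c) * y `^ m0)%:E)%E ->
  (I (fun x => x `^ m)%R <= ((1 - lam * c) * y `^ m)%:E)%E.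
Proof.
move=> /andP[lam0 lam1] hint h0.
have lam1' : 0 <= 1 - lam by rewrite subr_ge0.
apply: (@le_trans _ _ (I (fun x => (1 - lam) * y `^ (m - 1) * id x + lam * y `^ (m - m0) * x `^ m0))).
  apply: I_le => //.
    by apply: measurable_funD; [exact: measurable_funM|exact: measurable_funM].
  move=> x /andP[x0 xy]; rewrite powR_ge0/=.
  apply: le_trans (hint x y x0 xy y0) _.
  by rewrite le_eqVlt; apply/orP; left; apply/eqP; rewrite /=; ring.
rewrite I_lin ?mulr_ge0 ?powR_ge0 ?(ltW lam0)//; last by move=> x _; exact: powR_ge0.
rewrite Iid -EFinM.
apply: (@le_trans _ _ (((1 - lam) * y `^ (m - 1) * y)%:E +
  (lam * y `^ (m - m0))%:E * ((1 - c) * y `^ m0)%:E)%E).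
  by apply: leeD => //; apply: lee_wpmul2l => //; rewrite lee_fin mulr_ge0 ?powR_ge0// ltW.
rewrite -EFinM -EFinD lee_fin.
have yN : y != 0 by rewrite gt_eqF.
rewrite !powRB ?yN ?implybT// powRr1 ?(ltW y0)//.
have p0 : y `^ m0 != 0 by rewrite gt_eqF// powR_gt0.
rewrite le_eqVlt; apply/orP; left; apply/eqP; field.
by rewrite p0.
Qed.

Let cutfrag_le : (\int[mu]_x (cutfrag b (x, y) * powweight m x)%:E <=
  I (fun x => 1 * (1 : R) + 1 * x `^ m)%R)%E.
Proof.
have -> : (\int[mu]_x (cutfrag b (x, y) * powweight m x)%:E =
    \int[mu]_(x in `[0%R, y[) (B x * (1 * (1:R) + 1 * x `^ m))%:E)%E.
  apply/esym/integral_cut => x /=; rewrite in_itv/=.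
    move=> /andP[x0 xy]; rewrite /cutfrag /= xy -/(B x) /powweight ger0_norm//.
    by rewrite !mul1r.
  move=> /negP; rewrite negb_and /cutfrag /cut2 /=.
  by case/orP => [/negbTE ->|/negbTE ->]; rewrite ?if_same mul0r.
apply: ge0_subset_integral => //.
- by apply: mphi; apply: measurable_funD; exact: measurable_funM.
- move=> x; rewrite /= in_itv/= => /andP[x0 _].
  by rewrite lee_fin mulr_ge0// addr_ge0// mulr_ge0// powR_ge0.
- by move=> x; rewrite /= !in_itv/= => /andP[-> /ltW].
Qed.

(** The disjunction serves two ranges of y: c = 0 follows from mass conservation alone and is used
    for small y, a positive c comes from the condition on N_m0 and is used for large y. The constant
    part of the weight is bounded by the number of fragments. *)
Lemma cutfrag_moment (lam c : R) : 0 < lam <= 1 ->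
  (forall x y : R, 0 <= x -> x <= y -> 0 < y ->
    x `^ m <= (1 - lam) * (x * y `^ (m - 1)) + lam * (x `^ m0 * y `^ (m - m0))) ->
  c <= 1 -> c <= 0 \/ c <= Nm b m0 y / y `^ m0 ->
  (\int[mu]_x (cutfrag b (x, y) * powweight m x)%:E <=
    (b0 * (1 + y `^ l) + (1 - lam * c) * y `^ m)%:E)%E.
Proof.
move=> lam01 hint c1 hc; apply: le_trans cutfrag_le _.
rewrite I_lin//; last by move=> x _; exact: powR_ge0.
rewrite !mul1e EFinD; apply: leeD => //; apply: Ipow => //.
have p0 : 0 < y `^ m0 by rewrite powR_gt0.
case: hc => hc.
  apply: le_trans Ipow0 _; rewrite lee_fin ler_peMl ?(ltW p0)//; lra.
move: hc; rewrite /Nm ler_pdivlMr//.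
have -> : (\int[mu]_(x in `[0%R, y]) (b x y * x `^ m0)%:E = I (fun x => x `^ m0)%R)%E.
  by apply: eq_integral => x; rewrite inE /= => /BE ->.
have fI : I (fun x => x `^ m0) \is a fin_num.
  rewrite ge0_fin_numE; first exact: le_lt_trans Ipow0 (ltey _).
  by apply: integral_ge0 => x _; rewrite lee_fin mulr_ge0// powR_ge0.
rewrite -(fineK fI) lee_fin mulrBl mul1r; lra.
Qed.

End fixed_size.

(** For large y, the bound b0 (1 + y^l) on the number of fragments is of lower order because l < m,
    and it uses up only half of the loss lam c y^m; hence q = 1 - lam c / 2. For the remaining y the
    local bound on a is available. *)
Theorem cutfrag_weight : exists q M : R, [/\ 0 <= q, q < 1, 1 <= M &
  {ae mu, forall y,
    (\int[mu]_x (cutfrag b (x, y) * powweight m x)%:E <= (q * powweight m y)%:E)%E \/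
    (\int[mu]_x (cutfrag b (x, y) * powweight m x)%:E <= (M * powweight m y)%:E)%E /\ cut a y <= M}].
Proof.
have [c [Y [/andP[c0 c1] hY]]] := liminf_bound.
have [lam lam01 hint] := powR_interpolate m1 m01.
have [lam0 lam1] := andP lam01.
have lc0 : 0 < lam * c by rewrite mulr_gt0.
have lc1 : lam * c <= 1 by rewrite -[leRHS]mulr1; apply: ler_pM => //; exact: ltW.
(* Makes 2 b0 kp <= lam c / 2. Beyond [Y'] one has y^l <= kp y^m and y > 1, so b0 (1 + y^l) <= 2 b0
   y^l is absorbed. *)
pose kp := lam * c / (4 * (b0 + 1)).
have b01 : 0 < b0 + 1 by rewrite addrC ltr_pwDl.
have kp0 : 0 < kp by rewrite divr_gt0// mulr_gt0.
have ml0 : 0 < m - l by rewrite subr_gt0.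
pose Y' := Num.max Y (Num.max 1 (kp^-1 `^ (m - l)^-1)).
have Y'0 : 0 < Y' by rewrite !lt_max ltr01 orbT.
have [MA hMA] := a_loc Y'0.
(* Bounds both a on [0, Y'] and the ratio of b0 (1 + y^l) + y^m to the weight, as y^l <= 1 + y^m. *)
pose M := 1 + 2 * b0 + `|MA|.
have M1 : 1 <= M by rewrite /M -addrA lerDl addr_ge0// mulr_ge0.
exists (1 - lam * c / 2), M; split => //.
- lra.
- lra.
apply: aeS (aeI mass hMA) => y [hm ha].
have Mw : 0 <= M * powweight m y by rewrite mulr_ge0 ?(le_trans _ M1)// (le_trans _ (powweight_ge1 m y)).
have [y0|y0] := leP y 0.
  left; have -> : (\int[mu]_x (cutfrag b (x, y) * powweight m x)%:E = 0)%E.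
    rewrite (eq_integral (fun=> 0%E)) ?integral0// => x _.
    rewrite /cutfrag /cut2 /=; case: ifP => xy; last by rewrite mul0r.
    by rewrite leNgt (lt_le_trans xy y0)/= mul0r.
  by rewrite lee_fin mulr_ge0//; [lra|exact: le_trans (powweight_ge1 m y)].
have pw : powweight m y = 1 + y `^ m by rewrite /powweight gtr0_norm.
have ym0 := powR_ge0 y m.
have [yY|yY] := leP y Y'; [right; split|left].
- apply: le_trans (cutfrag_moment y0 (hm y0) lam01 hint (ler01) (or_introl (lexx 0))) _.
  rewrite lee_fin pw mulr0 subr0 mul1r.
  have yl : y `^ l <= 1 + y `^ m.
    have [y1|y1] := leP y 1.
      apply: (@le_trans _ _ 1); last by rewrite lerDl.
      have -> : 1 = 1 `^ l :> R by rewrite powR1.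
      by apply: ge0_ler_powR; rewrite ?nnegrE// ltW.
    by apply: le_trans (ler_powR (ltW y1) (ltW lm)) _; rewrite lerDr.
  have h1 := ler_wpM2l b00 yl.
  have h2 : 0 <= `|MA| * (1 + y `^ m) by rewrite mulr_ge0// addr_ge0.
  have h3 : 0 <= b0 * y `^ m by rewrite mulr_ge0.
  rewrite /M; nra.
- have : a y <= MA by apply: ha; rewrite /= in_itv/= (ltW y0).
  rewrite cut_Rp ?(ltW y0)// => h; apply: le_trans h _; apply: le_trans (ler_norm _) _.
  by rewrite /M lerDr addr_ge0// mulr_ge0.
have Yy : Y < y by apply: le_lt_trans yY; rewrite /Y' le_max lexx.
have y1 : 1 < y by apply: le_lt_trans yY; rewrite /Y' !le_max lexx orbT.
apply: le_trans (cutfrag_moment y0 (hm y0) lam01 hint c1 (or_intror (hY y Yy))) _.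
rewrite lee_fin pw.
have hk : kp^-1 <= y `^ (m - l).
  apply: (@le_trans _ _ ((kp^-1 `^ (m - l)^-1) `^ (m - l))).
    by rewrite -powRrM mulVf ?gt_eqF// powRr1// invr_ge0 ltW.
  apply: ge0_ler_powR; rewrite ?nnegrE ?powR_ge0 ?(ltW ml0) ?(ltW y0)//.
  by apply: ltW; apply: le_lt_trans yY; rewrite /Y' !le_max lexx !orbT.
have hl : y `^ l <= kp * y `^ m.
  have -> : y `^ m = y `^ (m - l) * y `^ l.
    by rewrite -powRD ?subrK// gt_eqF// (lt_trans _ m1).
  rewrite mulrA ler_peMl ?powR_ge0//.
  by rewrite mulrC -ler_pdivrMr// div1r.
have h1 : 1 <= y `^ l.
  by rewrite -[leLHS](powRr0 y); apply: ler_powR => //; exact: ltW.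
have kE : 2 * b0 * kp <= lam * c / 2.
  have -> : 2 * b0 * kp = lam * c / 2 * (b0 / (b0 + 1)).
    by rewrite /kp; field; rewrite gt_eqF.
  rewrite ler_piMr//; first by rewrite divr_ge0// ltW.
  by rewrite ler_pdivrMr// mul1r lerDl.
have h2 := ler_wpM2r ym0 kE.
have h3 := ler_wpM2l b00 hl.
have h4 := ler_wpM2l b00 h1.
lra.
Qed.

End fragmentation_weight.

(** * Local existence: choice of constants and assembly *)

Section local_existence.
Context {R : realType}.
Local Notation mu := (@lebesgue_measure R).
Variables (al om K Cw q M : R) (a w : R -> R) (b k : R * R -> R).
Hypothesis al01 : 0 < al < 1.
Hypothesis om1 : 1 <= om.
Hypothesis ma : measurable_fun [set: R] a.
Hypothesis a0 : forall x, 0 <= a x.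
Hypothesis mw : measurable_fun [set: R] w.
Hypothesis w1 : forall x, 1 <= w x.
Hypothesis Cw0 : 0 <= Cw.
Hypothesis wadd : forall x y, w (x + y) <= Cw * (w x * w y).
Hypothesis mb : measurable_fun [set: R * R] b.
Hypothesis b0 : forall p, 0 <= b p.
Hypothesis mk : measurable_fun [set: R * R] k.
Hypothesis k0 : forall p, 0 <= k p.
Hypothesis K0 : 0 <= K.
Let rho x := (om + a x) `^ al.
Hypothesis kle : forall x y, k (x, y) <= K * (rho x * rho y).
Hypothesis q0 : 0 <= q.
Hypothesis q1 : q < 1.
Hypothesis M1 : 1 <= M.
Hypothesis bw : {ae mu, forall y,
  (\int[mu]_x (b (x, y) * w x)%:E <= (q * w y)%:E)%E \/
  (\int[mu]_x (b (x, y) * w x)%:E <= (M * w y)%:E)%E /\ a y <= M}.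

Lemma nw_swap (c h : R -> R) :
  (\int[mu]_x (`|h x| * (c x * w x))%:E)%E = nw w (fun x => c x * `|h x|)%R.
Proof. by apply: eq_integral => x _; rewrite mulrA [`|h x| * _]mulrC. Qed.

Theorem csol_exists (f : R -> R) : measurable_fun [set: R] f ->
  (nw w (fun x => rho x * `|f x|)%R < +oo)%E ->
  exists2 T : R, 0 < T & exists U V : R -> R -> R,
  [/\ csol al om a w b k T f U V,
     forall t : R, 0 < t < T -> (nw w (fun x => rho x * `|V t x|)%R < +oo)%E,
     forall t : R, 0 < t < T -> forall e : R, 0 < e -> exists2 d : R, 0 < d &
       forall s : R, 0 < s < T -> `|s - t| < d ->
         (nw w (fun x => rho x * `|V s x - V t x|)%R < e%:E)%E &
     forall t : R, 0 < t < T -> forall e : R, 0 < e -> exists2 d : R, 0 < d &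
       forall s : R, 0 < s < T -> `|s - t| < d ->
         (nw w (fun x => (1 + a x) * `|U s x - U t x|)%R < e%:E)%E].
Proof.
move=> mf ff.
have [z [kap [eps [z01 kap01 eps01 hq [par1 par2]]]]] := contraction_parameters q0 q1.
have w0 x : 0 <= w x by exact: le_trans (w1 x).
have rho0 x : 0 <= rho x by exact: powR_ge0.
have [z0 z1] := andP z01; have [e0 _] := andP eps01.
(* The sum of (1 + q) / 2, allowed for q (1 + z), and of (1 - q) / 4, left for the terms that are
   small in T. *)
pose th := (3 + q) / 4; have th1 : th < 1 by move: q1; rewrite /th; lra.
pose F := fine (nw w (fun x => rho x * `|f x|)%R).
have F0 : 0 <= F by rewrite fine_ge0// nw_ge0// => x; exact: mulr_ge0.
have hF : (nw w (fun x => rho x * `|f x|)%R <= F%:E)%E.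
  rewrite fineK// ge0_fin_numE// nw_ge0// => x; exact: mulr_ge0.
have Cd0 : 0 <= duh_cst eps om.
  by rewrite /duh_cst !addr_ge0 ?mulr_ge0 ?invr_ge0 ?(ltW e0)// (le_trans _ om1).
(* S and then [cst] are fixed before T, so that T depends on the datum only through its norm F. *)
pose S := F + duh_cst eps om * (F / (1 - th)).
have S0 : 0 <= S by rewrite addr_ge0// mulr_ge0// divr_ge0// subr_ge0 ltW.
pose cst := M ^+ 2 + K * (2 * Cw + 4) * S.
have cst0 : 0 <= cst by rewrite addr_ge0 ?sqr_ge0// !mulr_ge0// addr_ge0// mulr_ge0.
have r0 : 0 < (1 - q) / 4 by rewrite divr_gt0// subr_gt0.
have [T T01 hT] := small_time al01 r0 (mulr_ge0 cst0 Cd0).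
have [T0 T1] := andP T01.
have kle' x y : `|k (x, y)| <= K * (rho x * rho y) by rewrite ger0_norm.
have hth : q * (1 + z) + cst * T `^ (1 - al) * duh_cst eps om <= th.
  by apply: le_trans (lerD hq (_ : _ <= (1 - q) / 4)) _; [rewrite mulrAC|rewrite /th; lra].
have [g [D [mg mD D0 hD hg]]] := picard al01 T01 eps01 z01 kap01 par1 par2 om1 ma a0 mw w1 Cw0
  wadd mb b0 mk K0 kle' q0 M1 (ltW q1) bw mf hF hth th1 (lexx S).
pose Q := Qdom al eps om a f D; pose P := Pdom al z om a f D.
have mQ : measurable_fun [set: R] Q by exact: measurable_Qdom.
have Q0 : forall x, 0 <= Q x by exact: Qdom_ge0.
have mP : measurable_fun [set: R] P by exact: measurable_Pdom.
have P0 : forall x, 0 <= P x by exact: Pdom_ge0.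
have hQ : (nw w Q < +oo)%E.
  apply: le_lt_trans (_ : (S%:E < +oo)%E); last exact: ltey.
  exact: (nw_Qdom al01 eps01 om1 ma a0 mw w1 mf hF (lexx S) mD D0 hD).
have hP : (nw w P < +oo)%E.
  apply: le_lt_trans (nw_Pdom al01 z01 om1 ma a0 mw w1 mf hF mD D0 hD) _; exact: ltey.
have hx : {ae mu, forall x, [/\ tnorm al T eps (fun t => g (t, x)) (D x),
    good al T eps om a (fun t => mildu a f g (t, x)) x (Q x) &
    tnorm al T eps (fun t => a x * mildu a f g (t, x)) (P x)]}.
  apply: aeS hg => x [hgx _]; split => //.
    exact: (good_mildu f al01 T01 eps01 z01 kap01 par1 par2 om1 a0 hgx).
  exact: (tnorm_rate_mildu f al01 T01 eps01 z01 kap01 par1 par2 om1 a0 hgx).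
exists T => //; exists (fun t x => mildu a f g (t, x)), (mildu_der a f g); split.
- split.
  + move=> t /andP[t0 tT]; split; first exact: measurable_mildu_at.
    rewrite -nw_swap; apply: le_lt_trans (mildu_fin ma mw w1 mf mg mQ Q0 hx _) hQ.
    by rewrite t0 ltW.
  + move=> t /andP[]; rewrite le_eqVlt => /predU1P[<-|t0] tT e ep.
      have [d dp hd] := mildu_cont0 al01 T01 eps01 ma a0 mw w1 mf mg mQ Q0 hQ hx ep.
      by exists d => // s sI sd; rewrite -nw_swap; exact: hd.
    have tI : 0 < t < T by rewrite t0.
    have [d dp hd] := mildu_cont al01 T01 eps01 om1 ma a0 mw w1 mf mg mQ Q0 hQ hx tI ep.
    by exists d => // s sI sd; rewrite -nw_swap; exact: hd.
  + move=> t tI; split; first exact: measurable_mildu_der.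
      rewrite -nw_swap; apply: (mildu_rate_fin al01 T01 eps01 ma a0 mw w1 mf mg mP P0 hP hx).
      by case/andP: tI => -> /ltW.
    move=> e ep.
    have [d dp hd] := mildu_deriv al01 T01 eps01 om1 ma a0 mw w1 mf mg mQ Q0 hQ hx tI ep.
    by exists d => // s sI st sd; rewrite -nw_swap; exact: hd.
  + move=> t /andP[t0 tT]; apply: aeS hg => x [_ hgx]; rewrite /mildu_der; congr (_ + _).
    have tI : 0 < t <= T by rewrite t0 ltW.
    by have [_ <-] := hgx t tI.
  + by apply: aeW => x; rewrite mildu_0.
- move=> t tI; rewrite -nw_swap.
  exact: (mildu_der_fin al01 T01 eps01 om1 ma a0 mw w1 mf mg mQ Q0 hQ hx tI).
- move=> t tI e ep.
  have [d dp hd] := mildu_der_cont al01 T01 eps01 om1 ma a0 mw w1 mf mg mQ Q0 hQ hx tI ep.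
  by exists d => // s sI sd; rewrite -nw_swap; exact: hd.
- move=> t tI e ep.
  have [d dp hd] := mildu_cont_rate al01 T01 eps01 om1 ma a0 mw w1 mf mg mQ Q0 hQ mP P0 hP hx tI ep.
  exists d => // s /andP[s0 sT] sd; rewrite -nw_swap; apply: hd => //; by rewrite sT ltW.
Qed.

End local_existence.

(** * Classical solutions *)

Section classical_solutions.
Context {R : realType}.
Local Notation mu := (@lebesgue_measure R).

Lemma cut_neg (f : R -> R) (x : R) : x < 0 -> cut f x = 0.
Proof. by rewrite /cut leNgt => ->. Qed.

Lemma cutB (f g : R -> R) : cut (fun x => f x - g x) = (fun x => cut f x - cut g x).
Proof. by apply/funext => x; rewrite /cut; case: ifP => // _; rewrite subrr. Qed.

Lemma cutMr (f : R -> R) (c : R) : cut (fun x => f x * c) = (fun x => cut f x * c).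
Proof. by apply/funext => x; rewrite /cut; case: ifP => // _; rewrite mul0r. Qed.

Lemma cutM (f g : R -> R) : cut (fun x => f x * g x) = (fun x => cut f x * cut g x).
Proof. by apply/funext => x; rewrite /cut; case: ifP => // _; rewrite mul0r. Qed.

Lemma measurable_cutP (f : R -> R) : measurable_fun [set: R] (cut f) <-> measurable_fun Rp f.
Proof.
split; last exact: measurable_cut.
move=> /(measurable_funS measurableT (@subsetT _ Rp)).
apply: eq_measurable_fun => x; rewrite inE RpE => x0; exact: cut_Rp.
Qed.

Lemma integrable_cut (D : set R) (f g : R -> \bar R) : measurable (D : set (measurableTypeR R)) ->
  (forall x, D x -> f x = g x) -> (forall x, ~ D x -> g x = 0%E) ->
  mu.-integrable [set: R] g -> mu.-integrable D f.
Proof.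
move=> mD h1 h2 ig; apply/(integrable_mkcond _ mD).
apply: eq_integrable ig => // x _; rewrite /patch.
by case: ifPn; rewrite ?inE => xD; [rewrite h1|rewrite h2//; move: xD; rewrite notin_setE].
Qed.

Variables (a : R -> R) (b k : R -> R -> R) (m al om : R).
Hypothesis m0 : 0 < m.
Hypothesis a0 : forall x, Rp x -> 0 <= a x.
Hypothesis al01 : 0 < al < 1.
Hypothesis om1 : 1 <= om.
Let w := powweight m.
Let a' := cut a.
Let b' := cutfrag b.
Let k' := cut2 k.
Let rho x := (om + a' x) `^ al.

Let a'0 x : 0 <= a' x. Proof. exact: cut_ge0. Qed.
Let rho0 x : 0 <= rho x. Proof. exact: powR_ge0. Qed.

Lemma wint_wm (h : R -> R) : wint (wm m) h = nw w (fun x => `|cut h x|)%R.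
Proof. by apply: wint_cut => x x0; rewrite /wm /w /powweight ger0_norm. Qed.

Lemma wint_walpha (h : R -> R) : wint (walpha a om al m) h = nw w (fun x => rho x * `|cut h x|)%R.
Proof.
rewrite -nw_swap; apply: wint_cut => x x0.
by rewrite /walpha /wm /rho /w /powweight /a' cut_Rp// ger0_norm.
Qed.

Lemma wint_wgraph (h : R -> R) : wint (wgraph a m) h = nw w (fun x => (1 + a' x) * `|cut h x|)%R.
Proof.
rewrite -nw_swap; apply: wint_cut => x x0.
have ax : 0 <= a x by apply: a0; rewrite RpE.
by rewrite /wgraph /wm /w /powweight /a' cut_Rp// (ger0_norm ax) (ger0_norm x0).
Qed.

Lemma wint_wm_rate (h : R -> R) : wint (wm m) (fun x => a x * h x) = nw w (fun x => a' x * `|cut h x|)%R.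
Proof.
by rewrite wint_wm; congr nw; apply/funext => x; rewrite cutM normrM ger0_norm.
Qed.

Lemma opB_cut (v : R -> R) (x : R) : 0 <= x ->
  opB a b v x = \int[mu]_y (b' (x, y) * (a' y * cut v y)).
Proof.
move=> x0; rewrite /opB /Rintegral; congr fine; apply: integral_cut => y /=; rewrite in_itv/= andbT.
  move=> xy; have y0 : 0 <= y by apply: le_trans x0 (ltW xy).
  by rewrite /b' /cutfrag /cut2 /= xy x0 y0 /a' !cut_Rp//=; congr EFin; rewrite -mulrA mulrCA.
by move=> /negP/negbTE xy; rewrite /b' /cutfrag /= xy mul0r.
Qed.

Lemma gain_cut_in (v : R -> R) (x y : R) : `[0, x]%classic y ->
  (k (x - y) y * v (x - y) * v y)%:E = (k' (x - y, y) * (cut v (x - y) * cut v y))%:E.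
Proof.
rewrite /= in_itv/= => /andP[y0 yx].
by rewrite /k' /cut2 /= subr_ge0 yx y0 !cut_Rp ?subr_ge0// mulrA.
Qed.

Lemma gain_cut_out (v : R -> R) (x y : R) : ~ `[0, x]%classic y ->
  (k' (x - y, y) * (cut v (x - y) * cut v y))%:E = 0%E.
Proof.
rewrite /= in_itv/= => /negP; rewrite /k' /cut2 /= subr_ge0 andbC => /negbTE ->.
by rewrite mul0r.
Qed.

Lemma loss_cut_in (v : R -> R) (x y : R) : 0 <= x -> Rp y ->
  (k x y * v y * v x)%:E = (k' (x, y) * (cut v x * cut v y))%:E.
Proof.
move=> x0; rewrite RpE => y0.
by rewrite /k' /cut2 /= x0 y0 !cut_Rp//=; congr EFin; rewrite -mulrA [v y * _]mulrC.
Qed.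

Lemma loss_cut_out (v : R -> R) (x y : R) : ~ Rp y ->
  (k' (x, y) * (cut v x * cut v y))%:E = 0%E.
Proof. by rewrite RpE => /negP/negbTE y0; rewrite /cut y0 !mulr0. Qed.

Lemma opC_cut (v : R -> R) (x : R) : 0 <= x ->
  opC k v x = 2^-1 * \int[mu]_y (k' (x - y, y) * (cut v (x - y) * cut v y)) -
    \int[mu]_y (k' (x, y) * (cut v x * cut v y)).
Proof.
move=> x0; rewrite /opC /Rintegral [_ / 2]mulrC; congr (_ * fine _ - fine _).
  by apply: integral_cut => y; [exact: gain_cut_in|exact: gain_cut_out].
by apply: integral_cut => y; [exact: loss_cut_in|exact: loss_cut_out].
Qed.

(** At negative sizes all three terms vanish, the gain because it requires 0 <= y <= x. The extended
    equation is thus trivial there and compatible with extension by zero. *)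
Lemma rkint_neg (v : R -> R) (x : R) : x < 0 -> rkint a' b' k' v x = 0.
Proof.
move=> x0; rewrite /rkint /Rintegral; under eq_integral.
  move=> y _; have -> : rk a' b' k' v x y = 0.
    rewrite /rk /b' /k' /cutfrag /cut2 /= leNgt x0/= if_same !mul0r subr0 add0r.
    rewrite leNgt; case: ltP => xy; rewrite ?mul0r ?mulr0//.
    by rewrite leNgt (le_lt_trans _ x0)/= ?mul0r ?mulr0//; rewrite -subr_ge0.
  over.
by rewrite integral0.
Qed.

(** The truncated kernels already vanish wherever truncation would alter the density. *)
Lemma rk_cut (v : R -> R) (x y : R) : rk a' b' k' (cut v) x y = rk a' b' k' v x y.
Proof.
rewrite /rk; congr (_ + _ - _).
- rewrite /b' /cutfrag /cut2 /=; case: ifP => xy; last by rewrite !mul0r.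
  case: ifP => [/andP[x0 y0]|]; last by rewrite !mul0r.
  by rewrite cut_Rp.
- rewrite /k' /cut2 /=; case: ifP => [/andP[x0 y0]|]; last by rewrite !mul0r.
  by rewrite !cut_Rp.
- rewrite /k' /cut2 /=; case: ifP => [/andP[x0 y0]|]; last by rewrite !mul0r.
  by rewrite !cut_Rp.
Qed.

Lemma rkint_cut (v : R -> R) (x : R) : rkint a' b' k' (cut v) x = rkint a' b' k' v x.
Proof. by rewrite /rkint; under eq_Rintegral do rewrite rk_cut. Qed.

Variables (K q M : R).
Hypothesis ma : measurable_fun Rp a.
Hypothesis mb : measurable_fun (Rp `*` Rp) (fun z : R * R => b z.1 z.2).
Hypothesis b_ge0 : forall x y, Rp x -> Rp y -> 0 <= b x y.
Hypothesis mk : measurable_fun (Rp `*` Rp) (fun z : R * R => k z.1 z.2).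
Hypothesis K0 : 0 < K.
Hypothesis k_le : forall x y, Rp x -> Rp y ->
  0 <= k x y <= K * (1 + a x) `^ al * (1 + a y) `^ al.
Hypothesis q0 : 0 <= q.
Hypothesis q1 : q < 1.
Hypothesis M1 : 1 <= M.
Hypothesis bw : {ae mu, forall y,
  (\int[mu]_x (b' (x, y) * w x)%:E <= (q * w y)%:E)%E \/
  (\int[mu]_x (b' (x, y) * w x)%:E <= (M * w y)%:E)%E /\ a' y <= M}.

Let ma' : measurable_fun [set: R] a'. Proof. exact: measurable_cut. Qed.
Let mw : measurable_fun [set: R] w. Proof. exact: measurable_powweight. Qed.
Let w1 x : 1 <= w x. Proof. exact: powweight_ge1. Qed.
Let w0 x : 0 <= w x. Proof. exact: le_trans (w1 x). Qed.
Let Cw0 : 0 <= 2 `^ m :> R. Proof. exact: powR_ge0. Qed.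
Let wadd x y : w (x + y) <= 2 `^ m * (w x * w y). Proof. exact: powweightD (ltW m0). Qed.
Let mb' : measurable_fun [set: R * R] b'. Proof. exact: measurable_cutfrag. Qed.
Let b'0 p : 0 <= b' p. Proof. exact: cutfrag_ge0. Qed.
Let mk' : measurable_fun [set: R * R] k'. Proof. exact: measurable_cut2. Qed.
Let k'0 p : 0 <= k' p.
Proof. by apply: cut2_ge0 => x y hx hy; case/andP: (k_le hx hy). Qed.
Let K0' : 0 <= K. Proof. exact: ltW. Qed.
Let kle' x y : k' (x, y) <= K * (rho x * rho y).
Proof.
have KR : 0 <= K * (rho x * rho y) by rewrite !mulr_ge0.
rewrite /k' /cut2 /=; case: ifP => // /andP[x0 y0].
have rx : Rp x by rewrite RpE.
have ry : Rp y by rewrite RpE.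
have [_] := andP (k_le rx ry); move/le_trans; apply.
rewrite -mulrA; apply: ler_wpM2l => //.
have al0 : 0 <= al by case/andP: al01 => /ltW.
have h z : Rp z -> (1 + a z) `^ al <= rho z.
  move=> hz; have az := a0 hz; rewrite /rho /a' cut_Rp; last by rewrite -RpE.
  by apply: ge0_ler_powR; rewrite ?nnegrE ?addr_ge0 ?lerD2r// (le_trans _ om1).
by apply: ler_pM; rewrite ?powR_ge0 ?h.
Qed.

Let mrho : measurable_fun [set: R] rho. Proof. exact: measurable_rho. Qed.
Let sint v := @state_integrable R al om K _ q M a' w b' k' al01 om1 ma' a'0 mw w1 Cw0 wadd mb' b'0 mk'
  k'0 K0' kle' q0 q1 M1 bw v.
Let rkE v := @rkintE R al om K _ q M a' w b' k' al01 om1 ma' a'0 mw w1 Cw0 wadd mb' b'0 mk'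
  k'0 K0' kle' q0 q1 M1 bw v.
Let fgain v := @nw_gain_fin R al om K _ q M a' w b' k' al01 om1 ma' a'0 mw w1 Cw0 wadd mb' b'0 mk'
  k'0 K0' kle' q0 q1 M1 bw v.
Let floss v := @nw_loss_fin R al om K _ q M a' w b' k' al01 om1 ma' a'0 mw w1 Cw0 wadd mb' b'0 mk'
  k'0 K0' kle' q0 q1 M1 bw v.

(** Since rho >= 1, finiteness of the stronger norm contains membership in X_{0,m}. *)
Lemma XalphaP (h : R -> R) : Xalpha a om al m h <->
  measurable_fun [set: R] (cut h) /\ (nw w (fun x => rho x * `|cut h x|)%R < +oo)%E.
Proof.
rewrite /Xalpha /X0 /inL1w wint_wm wint_walpha -measurable_cutP; split=> [[[mh _] fh]//|[mh fh]].
split => //; split => //; apply: le_lt_trans fh; apply: (nw_le_rho al01) => //.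
exact: measurableT_comp.
Qed.

Lemma measurable_rate_Rp (h : R -> R) : measurable_fun Rp h -> measurable_fun Rp (fun x => a x * h x).
Proof. by move=> mh; exact: measurable_funM. Qed.

Lemma generatorE (v : R -> R) : measurable_fun [set: R] (cut v) ->
  (nw w (fun x => rho x * `|cut v x|)%R < +oo)%E -> (nw w (fun x => a' x * `|cut v x|)%R < +oo)%E ->
  {ae mu, forall x, 0 <= x -> opB a b v x + opC k v x = rkint a' b' k' (cut v) x}.
Proof.
move=> mv fv fav; apply: aeS (rkE mv fv fav) => x -> x0.
by rewrite opB_cut// opC_cut// addrA.
Qed.

(** Gain and loss are each finite in the weighted norm, without use of cancellation, so the density
    lies in the maximal domain of the coagulation operator. *)
Lemma DC_state (v : R -> R) : measurable_fun [set: R] (cut v) ->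
  (nw w (fun x => rho x * `|cut v x|)%R < +oo)%E -> (nw w (fun x => a' x * `|cut v x|)%R < +oo)%E ->
  DC k m v.
Proof.
move=> mv fv fav.
have gm := measurable_Rintegral_param (measurable_gainint mk' mv).
have lm := measurable_Rintegral_param (measurable_lossint mk' mv).
have Xv : Xalpha a om al m v by apply/XalphaP.
split; first by case: Xv.
split.
  apply: aeS (sint mv fv fav) => x [_ ig il]; rewrite RpE => x0; split.
  - by apply: integrable_cut ig => // y; [exact: gain_cut_in|exact: gain_cut_out].
  - apply: integrable_cut il => //; first exact: measurable_Rp.
    + by move=> y; exact: loss_cut_in.
    + by move=> y; exact: loss_cut_out.
pose J x := 2^-1 * \int[mu]_y (k' (x - y, y) * (cut v (x - y) * cut v y)) -
  \int[mu]_y (k' (x, y) * (cut v x * cut v y)).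
have cE : cut (opC k v) = cut J.
  apply/funext => x; have [x0|x0] := leP 0 x; last by rewrite !cut_neg.
  by rewrite [LHS]cut_Rp// [RHS]cut_Rp// opC_cut.
have mJ : measurable_fun [set: R] J by apply: measurable_funB => //; exact: measurable_funM.
rewrite /X0 /inL1w wint_wm -measurable_cutP cE; split.
  by apply: measurable_cut; exact: measurable_funTS.
have fJ : (nw w (fun x => 2^-1 * `|\int[mu]_y (k' (x - y, y) * (cut v (x - y) * cut v y))| +
    `|\int[mu]_y (k' (x, y) * (cut v x * cut v y))|)%R < +oo)%E.
  have m1 := measurableT_comp (@normr_measurable R setT) gm.
  have m2 := measurableT_comp (@normr_measurable R setT) lm.
  rewrite nwD//; last by apply: measurable_funM.
  apply: lte_add_pinfty; last exact: floss.
  by rewrite nwZ// lte_mul_pinfty//; exact: fgain.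
apply: le_lt_trans fJ; apply: nw_le => //.
- by apply: measurableT_comp => //; apply: measurable_cut; exact: measurable_funTS.
- apply: measurable_funD; last exact: measurableT_comp.
  by apply: measurable_funM => //; exact: measurableT_comp.
- apply: aeW => x; have [x0|x0] := leP 0 x; last by rewrite cut_neg// normr0 addr_ge0.
  by rewrite (cut_Rp J x0); apply: le_trans (ler_normB _ _) _; rewrite normrM ger0_norm.
Qed.

(** Brings an arbitrary classical solution, extended by zero, within reach of the energy
    argument. *)
Lemma classical_csol (fin : R -> R) (tau : R) (f : R -> R -> R) :
  classical_sol a b k om al m fin tau f ->
  exists V, csol al om a' w b' k' tau (cut fin) (fun t => cut (f t)) V.
Proof.
move=> [hX [hc [[g [gX [hd [_ heq]]]] [_ [_ [h0 _]]]]]].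
have I0 (t : R) : 0 <= t < tau -> `[0%R, tau[%classic t by rewrite /= in_itv.
have I1 (t : R) : 0 < t < tau -> `]0%R, tau[%classic t by rewrite /= in_itv.
have I01 (t : R) : 0 < t < tau -> 0 <= t < tau by case/andP => /ltW -> ->.
exists (fun t => cut (g t)); split.
- by move=> t /I0/hX/XalphaP.
- move=> t /I0 tI e e0; have [d d0 hd'] := hc t tI e e0; exists d => // s /I0 sI st.
  by have := hd' s sI st; rewrite wint_walpha cutB.
- move=> t tI; split.
  + by have /XalphaP[] := gX t (I1 _ tI).
  + have [[_ [_ h]] _] := heq t (I1 _ tI).
    by rewrite -wint_wm_rate.
  + move=> e e0; have [d d0 hd'] := hd t (I1 _ tI) e e0; exists d => // s /I1 sI st sd.
    by have := hd' s sI st sd; rewrite wint_walpha cutB cutMr cutB.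
- move=> t tI; have [[_ [_ h]] [_ he]] := heq t (I1 _ tI).
  have /XalphaP[mf ff] := hX t (I0 _ (I01 _ tI)).
  rewrite wint_wm_rate in h.
  apply: aeS (aeI he (generatorE mf ff h)) => x [h1 h2].
  have [x0|x0] := leP 0 x; last first.
    by rewrite rkint_neg// /cut leNgt x0/= mulr0 oppr0 addr0.
  rewrite cut_Rp// h1 ?RpE// -addrA h2// /a' !cut_Rp//.
- apply: aeS h0 => x h; rewrite /cut; case: ifP => // x0; apply: h; by rewrite RpE.
Qed.

Lemma nw_cut_le (c h : R -> R) : measurable_fun [set: R] c -> (forall x, 0 <= c x) ->
  measurable_fun [set: R] h ->
  (nw w (fun x => c x * `|cut h x|)%R <= nw w (fun x => c x * `|h x|)%R)%E.
Proof.
move=> mc c0 mh; apply: nw_le => //.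
- apply: measurable_funM => //; apply: measurableT_comp => //.
  by apply: measurable_cut; exact: measurable_funTS.
- by apply: measurable_funM => //; exact: measurableT_comp.
- by move=> x; exact: mulr_ge0.
- by move=> x; exact: mulr_ge0.
- apply: aeW => x; rewrite /cut; case: ifP => // _; rewrite normr0 mulr0.
  exact: mulr_ge0.
Qed.

(** The solution produced on the whole line is not controlled in form at negative sizes; truncating
    it preserves the equation and prepares its return to the half-line. *)
Lemma csol_cut (fin : R -> R) (tau : R) (U V : R -> R -> R) :
  csol al om a' w b' k' tau (cut fin) U V ->
  csol al om a' w b' k' tau (cut fin) (fun t => cut (U t)) (fun t => cut (V t)).
Proof.
move=> [h1 h2 h3 h4 h5].
have le := nw_cut_le.
have mc (h : R -> R) : measurable_fun [set: R] h -> measurable_fun [set: R] (cut h).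
  by move=> mh; apply: measurable_cut; exact: measurable_funTS.
have I01 (t : R) : 0 < t < tau -> 0 <= t < tau by case/andP => /ltW -> ->.
split.
- move=> t tI; have [mU fU] := h1 t tI; split; first exact: mc.
  exact: le_lt_trans (le _ _ mrho rho0 mU) fU.
- move=> t tI e e0; have [d d0 hd] := h2 t tI e e0; exists d => // s sI st.
  have [ms _] := h1 s sI; have [mt _] := h1 t tI.
  have := le _ _ mrho rho0 (measurable_funB ms mt); rewrite cutB => h.
  exact: le_lt_trans h (hd s sI st).
- move=> t tI; have [mV fU hd'] := h3 t tI; have [mU _] := h1 t (I01 _ tI); split.
  + exact: mc.
  + exact: le_lt_trans (le _ _ ma' a'0 mU) fU.
  + move=> e e0; have [d d0 hd] := hd' e e0; exists d => // s sI st sd.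
    have [ms _] := h1 s (I01 _ sI).
    have mq : measurable_fun [set: R] (fun x => (U s x - U t x) / (s - t) - V t x).
      by apply: measurable_funB => //; apply: measurable_funM => //; exact: measurable_funB.
    have := le _ _ mrho rho0 mq; rewrite cutB cutMr cutB => h.
    exact: le_lt_trans h (hd s sI st sd).
- move=> t tI; apply: aeS (h4 t tI) => x h; rewrite rkint_cut.
  have [x0|x0] := leP 0 x; first by rewrite !cut_Rp// cut_Rp// h /a' cut_Rp.
  by rewrite rkint_neg// /cut leNgt x0/= mulr0 oppr0 addr0.
- by apply: aeS h5 => x h; rewrite /cut; case: ifP => // x0; rewrite h cut_Rp.
Qed.

Lemma csol_classical (fin : R -> R) (tau : R) (U V : R -> R -> R) :
  csol al om a' w b' k' tau (cut fin) (fun t => cut (U t)) (fun t => cut (V t)) ->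
  (forall t : R, 0 < t < tau -> (nw w (fun x => rho x * `|cut (V t) x|)%R < +oo)%E) ->
  (forall t : R, 0 < t < tau -> forall e : R, 0 < e -> exists2 d : R, 0 < d &
    forall s : R, 0 < s < tau -> `|s - t| < d ->
      (nw w (fun x => rho x * `|cut (fun x => V s x - V t x) x|)%R < e%:E)%E) ->
  (forall t : R, 0 < t < tau -> forall e : R, 0 < e -> exists2 d : R, 0 < d &
    forall s : R, 0 < s < tau -> `|s - t| < d ->
      (nw w (fun x => (1 + a' x) * `|cut (fun x => U s x - U t x) x|)%R < e%:E)%E) ->
  (forall t : R, 0 <= t < tau -> {ae mu, forall x, 0 <= cut (U t) x}) ->
  classical_sol a b k om al m fin tau U.
Proof.
move=> [h1 h2 h3 h4 h5] fV cV cU pos.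
have I0 (t : R) : `[0%R, tau[%classic t -> 0 <= t < tau by rewrite /= in_itv.
have I1 (t : R) : `]0%R, tau[%classic t -> 0 < t < tau by rewrite /= in_itv.
have I01 (t : R) : 0 < t < tau -> 0 <= t < tau by case/andP => /ltW -> ->.
have X (t : R) : 0 <= t < tau -> Xalpha a om al m (U t) by move=> /h1 tU; apply/XalphaP.
have dom (t : R) : 0 < t < tau -> DA a m (U t).
  move=> tI; have [XU _] := X t (I01 _ tI); split => //; split.
    by apply: measurable_rate_Rp; case: XU.
  by rewrite wint_wm_rate; case: (h3 t tI).
split; first by move=> t /I0/X.
split.
  move=> t /I0 tI e e0; have [d d0 hd] := h2 t tI e e0; exists d => // s /I0 sI st.
  by rewrite wint_walpha cutB; exact: hd.
split.
  exists V; split.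
    by move=> t /I1 tI; apply/XalphaP; split; [case: (h3 t tI)|exact: fV].
  split.
    move=> t /I1 tI e e0; have [_ _ hd'] := h3 t tI; have [d d0 hd] := hd' e e0.
    exists d => // s /I1 sI st sd; rewrite wint_walpha cutB cutMr cutB; exact: hd.
  split.
    move=> t /I1 tI e e0; have [d d0 hd] := cV t tI e e0; exists d => // s /I1 sI st.
    by rewrite wint_walpha; exact: hd.
  move=> t /I1 tI; split; first exact: dom.
  have [mU fU] := h1 t (I01 _ tI); have [_ fa _] := h3 t tI.
  split; first exact: DC_state.
  apply: aeS (aeI (h4 t tI) (generatorE mU fU fa)) => x [hV hg]; rewrite RpE => x0.
  by have := hV; rewrite cut_Rp// -hg// /a' !cut_Rp// addrA.
split; first by move=> t /I1/dom.
split.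
  move=> t /I1 tI e e0; have [d d0 hd] := cU t tI e e0; exists d => // s /I1 sI st.
  by rewrite wint_wgraph; exact: hd.
split.
  by apply: aeS h5 => x h; rewrite RpE => x0; move: h; rewrite !cut_Rp.
by move=> t /I0/pos; apply: aeS => x h; rewrite RpE => x0; move: h; rewrite cut_Rp.
Qed.

Lemma classical_wellposed (fin : R -> R) : Xalpha a om al m fin ->
  {ae mu, forall x, Rp x -> 0 <= fin x} ->
  exists2 tau : R, 0 < tau & exists f : R -> R -> R, classical_sol a b k om al m fin tau f /\
    forall g : R -> R -> R, classical_sol a b k om al m fin tau g ->
      forall t, `[0%R, tau[%classic t -> {ae mu, forall x, Rp x -> g t x = f t x}.
Proof.
move=> /XalphaP[mfin ffin] fin0.
have cfin0 : {ae mu, forall x, 0 <= cut fin x}.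
  by apply: aeS fin0 => x h; rewrite /cut; case: ifP => // x0; apply: h; rewrite RpE.
have [T T0 [U [V [hU fV cV cU]]]] := csol_exists al01 om1 ma' a'0 mw w1 Cw0 wadd mb' b'0 mk' k'0
  K0' kle' q0 q1 M1 bw mfin ffin.
have hC := csol_cut hU.
have I01 (t : R) : 0 < t < T -> 0 <= t < T by case/andP => /ltW -> ->.
have mU (t : R) : 0 < t < T -> measurable_fun [set: R] (U t).
  by move=> /I01 tI; case: hU => h _ _ _ _; case: (h t tI).
have mV (t : R) : 0 < t < T -> measurable_fun [set: R] (V t).
  by move=> tI; case: hU => _ _ h _ _; case: (h t tI).
have sol : classical_sol a b k om al m fin T U.
  apply: (csol_classical hC).
  - by move=> t tI; apply: le_lt_trans (nw_cut_le mrho rho0 (mV t tI)) _; exact: fV.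
  - move=> t tI e e0; have [d d0 hd] := cV t tI e e0; exists d => // s sI st.
    apply: le_lt_trans (nw_cut_le mrho rho0 _) (hd s sI st).
    exact: measurable_funB (mV s sI) (mV t tI).
  - move=> t tI e e0; have [d d0 hd] := cU t tI e e0; exists d => // s sI st.
    apply: le_lt_trans (nw_cut_le _ _ _) (hd s sI st).
    + exact: measurable_funD.
    + by move=> x; exact: addr_ge0.
    + exact: measurable_funB (mU s sI) (mU t tI).
  - exact: (csol_positive al01 om1 ma' a'0 mw w1 Cw0 wadd mb' b'0 mk' k'0
      K0' kle' q0 q1 M1 bw hC cfin0).
exists T => //; exists U; split => // g /classical_csol[V' hg] t; rewrite /= in_itv/= => tI.
have := csol_unique al01 om1 ma' a'0 mw w1 Cw0 wadd mb' b'0 mk' k'0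
  K0' kle' q0 q1 M1 bw hC hg tI.
by apply: aeS => x h; rewrite RpE => x0; move: h; rewrite !cut_Rp.
Qed.

End classical_solutions.

Unset Implicit Arguments.

Theorem theorem3p1 (R : realType) (a : R -> R) (b k : R -> R -> R)
    (l b0 m K al om : R) :
  (* a : nonnegative, measurable, in L_{oo,loc}([0,oo)) *)
  measurable_fun Rp a ->
  (forall x, Rp x -> 0 <= a x) ->
  (forall T : R, 0 < T -> exists M : R,
     {ae (@lebesgue_measure R), forall x, `[0%R, T]%classic x -> a x <= M}) ->
  (* b : nonnegative, measurable on R_+^2 *)
  measurable_fun (Rp `*` Rp) (fun z : R * R => b z.1 z.2) ->
  (forall x y, Rp x -> Rp y -> 0 <= b x y) ->
  {ae (@lebesgue_measure R), forall y, 0 < y ->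
     (\int[@lebesgue_measure R]_(x in `[0%R, y]) (x * b x y)%:E = y%:E)%E /\
     {ae (@lebesgue_measure R), forall x, y < x -> b x y = 0}} ->
  0 <= l -> 0 <= b0 ->
  (forall x, 0 <= x ->
     (\int[@lebesgue_measure R]_(y in `[0%R, x]) (b y x)%:E
        <= (b0 * (1 + x `^ l))%:E)%E) ->
  (exists2 m0 : R, 1 < m0 &
     (0 < liminf_pinfty (fun y => (Nm b m0 y / y `^ m0)%R))%E) ->
  Num.max 1 l < m ->
  (* k : measurable, symmetric, 0 <= k <= K (1+a x)^al (1+a y)^al *)
  measurable_fun (Rp `*` Rp) (fun z : R * R => k z.1 z.2) ->
  (forall x y, k x y = k y x) ->
  0 < K -> 0 < al < 1 ->
  (forall x y, Rp x -> Rp y ->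
     0 <= k x y <= K * (1 + a x) `^ al * (1 + a y) `^ al) ->
  (* omega > 1 fixing the norm of X^al_{0,m} *)
  1 < om ->
  forall fin : R -> R,
    Xalpha a om al m fin ->
    {ae (@lebesgue_measure R), forall x, Rp x -> 0 <= fin x} ->
    exists2 tau : R, 0 < tau &
      exists f : R -> R -> R,
        classical_sol a b k om al m fin tau f /\
        forall g : R -> R -> R, classical_sol a b k om al m fin tau g ->
          forall t, `[0%R, tau[%classic t ->
            {ae (@lebesgue_measure R), forall x, Rp x -> g t x = f t x}.
Proof.
move=> ma a0 aloc mb b_ge0 mass l0 b00 number [m0 m01 liminf] mlt mk _ K0 al01 k_le om1 fin hfin fin0.
have [m1 lm] : 1 < m /\ l < m by move: mlt; rewrite gt_max => /andP[].
have mass' : {ae (@lebesgue_measure R), forall y : R, 0 < y ->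
    (\int[@lebesgue_measure R]_(x in `[0%R, y]) (x * b x y)%:E = y%:E)%E}.
  by apply: aeS mass => y h /h[].
have [q [M [q0 q1 M1 bw]]] := cutfrag_weight aloc mb b_ge0 mass' l0 b00 number m01 liminf m1 lm.
exact: (classical_wellposed (lt_trans ltr01 m1) a0 al01 (ltW om1) ma mb b_ge0 mk K0 k_le q0 q1 M1 bw).
Qed.
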